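(* Fix $\tau>0$. Assume (A1): $A,C\in\mathscr B_\tau(\mathbb R^{n\times n})$, $B\in\mathscr B_\tau(\mathbb R^{n\times m})$, $b,\sigma,q\in\mathscr B_\tau(\mathbb R^n)$, $Q\in\mathscr B_\tau(\mathbb S^n)$, $S\in\mathscr B_\tau(\mathbb R^{m\times n})$, $R\in\mathscr B_\tau(\mathbb S^m)$, $\rho\in\mathscr B_\tau(\mathbb R^m)$; and (A3): $[A,C;B,0]$ is $\tau$-random periodic mean-square exponentially stabilizable. Let $(\Theta,v)\in\mathbb U$, $x\in\mathbb R^n$, and let $X^{x,\Theta,v}$ and $X^{\xi^{\Theta,v},\Theta,v}$ be the solutions of the closed-loop state equation with initial states $x$ and $\xi^{\Theta,v}$ respectively, where $\xi^{\Theta,v}\in L^2_{\mathscr F}(\Omega;\mathbb R^n)$ is the unique $\mathbb F$-independent initial state for which the solution is $\tau$-random periodic. Then $$\mathcal E(x,u^{x,\Theta,v})=\varliminf_{T\to\infty}\frac1T\mathbb E\int_0^TF(t,X^{x,\Theta,v}_t,u^{x,\Theta,v}_t)\,dt=\frac1\tau\mathbb E\int_0^\tau F(t,X^{\xi^{\Theta,v},\Theta,v}_t,u^{\xi^{\Theta,v},\Theta,v}_t)\,dt,$$ where $u^{x,\Theta,v}_t=\Theta_tX^{x,\Theta,v}_t+v_t$ and $u^{\xi^{\Theta,v},\Theta,v}_t=\Theta_tX^{\xi^{\Theta,v},\Theta,v}_t+v_t$.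
   Context: Probabilistic setting. $(\Omega,\mathscr F,\mathbb P)$ is a complete probability space carrying a standard one-dimensional Brownian motion $W=\{W_t\}_{t\ge0}$; $\mathbb F=\{\mathscr F_t\}_{t\ge0}$ is the natural filtration of $W$ augmented by the $\mathbb P$-null sets. For $t\ge0$, $\theta_t:\Omega\to\Omega$ is measurable, invertible with measurable inverse, with $\theta_t\circ W_s=W_{s+t}-W_t$ for all $s\ge0$, $\theta_0=I$, $\theta_s\circ\theta_t=\theta_{s+t}$, $\mathbb P\circ\theta_t^{-1}=\mathbb P$; for a random variable $\phi$, $(\theta_t\circ\phi)(\omega)=\phi(\theta_t(\omega))$. Spaces. $\mathbb S^n$: symmetric real $n\times n$ matrices. $L^2_{\mathscr F}(\Omega;E)$: $\mathscr F$-measurable $E$-valued square-integrable random variables. $L^2_{\mathbb F}(0,\infty;E)$, $L^\infty_{\mathbb F}(0,\infty;E)$: $\mathbb F$-progressively measurable $E$-valued processes $X$ with $\mathbb E\int_0^\infty|X_t|^2dt<\infty$, respectively $\operatorname{ess\,sup}_{(t,\omega)}|X_t|<\infty$. A process $f$ on $[0,\infty)$ is $\tau$-random periodic if $f_{t+\tau}=\theta_\tau\circ f_t$ a.s. for every $t\ge0$. $\mathscr B_\tau(E)$ is the set of $\tau$-random periodic $f\in L^\infty_{\mathbb F}(0,\infty;E)$. Stability. For $A,C\in\mathscr B_\tau(\mathbb R^{n\times n})$, $[A,C]$ is $\tau$-random periodic mean-square exponentially stable if there are $\beta,\lambda,\delta>0$ such that $d\Phi_t=A_t\Phi_tdt+C_t\Phi_tdW_t$,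 $\Phi_0=I_n$, has a unique solution $\Phi\in L^2_{\mathbb F}(0,\infty;\mathbb R^{n\times n})$ with $\mathbb E|\Phi_t|^2\le\beta e^{-\lambda t}$ for all $t\ge0$ and $\inf_{r\in[0,\tau)}\mathbb E\big(\int_r^\infty(\Phi_s\Phi_r^{-1})^\top\Phi_s\Phi_r^{-1}ds\,\big|\,\mathscr F_r\big)\ge\delta I_n$. For $B\in\mathscr B_\tau(\mathbb R^{n\times m})$, $\mathscr S_\tau[A,C;B,0]$ is the set of $\Theta\in\mathscr B_\tau(\mathbb R^{m\times n})$ such that $[A+B\Theta,C]$ is $\tau$-random periodic mean-square exponentially stable; $[A,C;B,0]$ is $\tau$-random periodic mean-square exponentially stabilizable if this set is nonempty. Control setting. $\mathbb U=\{(\Theta,v):\Theta\in\mathscr S_\tau[A,C;B,0],\ v\in\mathscr B_\tau(\mathbb R^m)\}$. The closed-loop state equation with initial state $x$ is $$dX_t=\big((A_t+B_t\Theta_t)X_t+B_tv_t+b_t\big)dt+\big(C_tX_t+\sigma_t\big)dW_t,\ t\ge0,\qquad X_0=x,$$ with solution $X^{x,\Theta,v}$ (for a random $\mathbb F$-independent initial state $x$, adaptedness is with respect to $\mathscr F_t\vee\sigma(x)$). A random variable is $\mathbb F$-independent if it is independent of $\sigma(\bigcup_t\mathscr F_t)$. $\xi^{\Theta,v}$ is the unique $\mathbb F$-independent element of $L^2_{\mathscr F}(\Omega;\mathbb R^n)$ such that $X^{\xi^{\Theta,v},\Theta,v}_{t+\tau}=\theta_\tau\circ X^{\xi^{\Theta,v},\Theta,v}_t$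 a.s. for every $t\ge0$. The running cost is $$F(t,X,u)=\langle Q_tX,X\rangle+2\langle S_tX,u\rangle+\langle R_tu,u\rangle+2\langle q_t,X\rangle+2\langle\rho_t,u\rangle .$$ The ergodic cost functional is $\mathcal E(x,u)=\varliminf_{T\to\infty}\frac1T\mathbb E\int_0^TF(t,X_t,u_t)\,dt$, with $X$ the state corresponding to $(x,u)$. *)

(* Defs.v *)
From HB Require Import structures.
From mathcomp Require Import all_boot all_order all_algebra.
From mathcomp Require Import all_classical all_reals all_analysis.
From mathcomp Require Import ess_sup_inf.

Set Implicit Arguments.
Unset Strict Implicit.
Unset Printing Implicit Defensive.

Import Order.TTheory GRing.Theory Num.Theory.
Import numFieldNormedType.Exports.

Local Open Scope classical_set_scope.
Local Open Scope ring_scope.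

(* Stochastic processes are functions [R -> Omega -> E]; only their values at
   times t >= 0 are ever constrained or used.  R^n is ['cV[R]_n].  Sub-sigma-
   algebras of Omega are represented as set systems [set (set Omega)]. *)

Definition mxnorm (R : realType) (k l : nat) (M : 'M[R]_(k, l)) : R :=
  Num.sqrt (\sum_i \sum_j M i j ^+ 2).

Definition dotv (R : realType) (k : nat) (x y : 'cV[R]_k) : R :=
  \sum_i x i 0 * y i 0.

(* the order M >= c I on symmetric matrices *)
Definition psd_ge (R : realType) (k : nat) (M : 'M[R]_k) (c : R) : Prop :=
  forall y : 'cV[R]_k, c * dotv y y <= dotv (M *m y) y.

Section Probability.
Context {R : realType} {d : measure_display} {Omega : measurableType d}.
Variable P : probability Omega R.
Implicit Types (G H : set (set Omega)) (FF : R -> set (set Omega)).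

Definition sys_measurable G (Y : Omega -> R) : Prop :=
  forall U : set R, measurable U -> G (Y @^-1` U).

Definition mx_random_variable (k l : nat) (Y : Omega -> 'M[R]_(k, l)) : Prop :=
  forall i j, measurable_fun setT (fun w => Y w i j).

Definition sigma_of (k l : nat) (Y : Omega -> 'M[R]_(k, l)) :
    set (set Omega) :=
  <<s [set E | exists i j (U : set R),
         measurable U /\ E = [set w | U (Y w i j)]] >>.

Definition independent G H : Prop :=
  forall E F, G E -> H F -> P (E `&` F) = (P E * P F)%E.

(* the space L^2 over the full sigma-algebra of Omega *)
Definition L2_random_variable (k l : nat) (Y : Omega -> 'M[R]_(k, l)) : Prop :=
  mx_random_variable Y /\ (\int[P]_w (mxnorm (Y w) ^+ 2)%:E < +oo)%E.

(* Y is a version of E(Z | G) *)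
Definition is_cond_exp G (Z Y : Omega -> R) : Prop :=
  [/\ P.-integrable setT (EFin \o Z),
      P.-integrable setT (EFin \o Y),
      sys_measurable G Y &
      forall E, G E -> (\int[P]_(w in E) (Y w)%:E = \int[P]_(w in E) (Z w)%:E)%E].

Definition is_mx_cond_exp G (k l : nat) (Z Y : Omega -> 'M[R]_(k, l)) : Prop :=
  forall i j, is_cond_exp G (fun w => Z w i j) (fun w => Y w i j).

Definition raw_filtration (W : R -> Omega -> R) (t : R) : set (set Omega) :=
  <<s [set E | exists s (U : set R),
         [/\ 0 <= s <= t, measurable U & E = W s @^-1` U]] >>.

Definition natural_filtration (W : R -> Omega -> R) (t : R) :
    set (set Omega) :=
  <<s raw_filtration W t `|` [set N | P.-negligible N] >>.

Definition filtration_infty FF : set (set Omega) :=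
  <<s \bigcup_(t in `[0, +oo[) FF t >>.

Definition enlarged_filtration FF (k l : nat) (Y : Omega -> 'M[R]_(k, l))
    (t : R) : set (set Omega) :=
  <<s FF t `|` sigma_of Y >>.

Definition brownian_motion (W : R -> Omega -> R) : Prop :=
  [/\ forall t, 0 <= t -> measurable_fun setT (W t),
      {ae P, forall w, W 0 w = 0},
      {ae P, forall w, {within `[0, +oo[, continuous (W ^~ w)}},
      forall s t, 0 <= s < t -> forall U : set R, measurable U ->
        P ((W t \- W s)%R @^-1` U) =
        normal_prob 0 (Num.sqrt (t - s)) U &
      forall s t, 0 <= s < t -> forall (U : set R) E,
        measurable U -> raw_filtration W s E ->
        P (((W t \- W s)%R @^-1` U) `&` E) =
        (P ((W t \- W s)%R @^-1` U) * P E)%E].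

Definition brownian_shift (W : R -> Omega -> R) (theta : R -> Omega -> Omega) :
    Prop :=
  [/\ forall t, 0 <= t -> measurable_fun setT (theta t) /\
        exists g : Omega -> Omega, [/\ cancel (theta t) g, cancel g (theta t)
                                     & measurable_fun setT g],
      forall s t, 0 <= s -> 0 <= t ->
        forall w, W s (theta t w) = W (s + t) w - W t w,
      forall w, theta 0 w = w,
      forall s t, 0 <= s -> 0 <= t ->
        forall w, theta s (theta t w) = theta (s + t) w &
      forall t, 0 <= t -> forall E : set Omega, measurable E ->
        P (theta t @^-1` E) = P E].

(* Measurability of X on [0, t] x Omega for the product of the Borel
   sigma-algebra with FF t, whose trace on [0, t] x Omega is used. *)
Definition progressive FF (k l : nat) (X : R -> Omega -> 'M[R]_(k, l)) :
    Prop :=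
  forall t, 0 <= t -> forall i j (U : set R), measurable U ->
    <<s [set E | exists (I : set R) (A : set Omega),
           [/\ measurable I, FF t A & E = I `*` A]] >>
      ([set p : R * Omega | 0 <= p.1 <= t] `&`
       [set p | U (X p.1 p.2 i j)]).

(* E int_0^T f dt *)
Definition expected_integral (T : R) (f : R -> Omega -> R) : \bar R :=
  (\int[P]_w \int[lebesgue_measure]_(t in `[0%R, T]) (f t w)%:E)%E.

Definition L2_process FF (k l : nat) (X : R -> Omega -> 'M[R]_(k, l)) : Prop :=
  progressive FF X /\
  (\int[P]_w \int[lebesgue_measure]_(t in `[0%R, +oo[)
     (mxnorm (X t w) ^+ 2)%:E < +oo)%E.

Definition L2loc_process FF (k l : nat) (X : R -> Omega -> 'M[R]_(k, l)) :
    Prop :=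
  progressive FF X /\
  forall T, 0 <= T ->
    (expected_integral T (fun t w => mxnorm (X t w) ^+ 2)%R < +oo)%E.

Definition Linfty_process FF (k l : nat) (X : R -> Omega -> 'M[R]_(k, l)) :
    Prop :=
  progressive FF X /\
  (ess_sup (lebesgue_measure \x P)
     ((fun p : R * Omega => (mxnorm (X p.1 p.2))%:E)
        \_ (`[0%R, +oo[ `*` setT)) < +oo)%E.

Definition random_periodic (theta : R -> Omega -> Omega) (tau : R)
    (T : Type) (f : R -> Omega -> T) : Prop :=
  forall t, 0 <= t -> {ae P, forall w, f (t + tau) w = f t (theta tau w)}.

(* The Ito integral over [0, T] of g, in the L^2 theory: the L^2(Omega)-limit
   of the elementary integrals of bounded simple adapted processes converging
   to g in L^2([0, T] x Omega). *)
Record simple_process := SimpleProcess {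
  sp_size : nat;
  sp_time : nat -> R;
  sp_val : nat -> Omega -> R }.

Definition sp_fun (K : simple_process) (t : R) (w : Omega) : R :=
  \sum_(i < sp_size K)
    sp_val K i w * \1_(`]sp_time K i, sp_time K i.+1]) t.

Definition sp_integral (W : R -> Omega -> R) (K : simple_process) (w : Omega) :
    R :=
  \sum_(i < sp_size K)
    sp_val K i w * (W (sp_time K i.+1) w - W (sp_time K i) w).

Definition sp_adapted FF (T : R) (K : simple_process) : Prop :=
  [/\ forall i, (i <= sp_size K)%N -> 0 <= sp_time K i <= T,
      forall i, (i < sp_size K)%N -> sp_time K i <= sp_time K i.+1,
      forall i, (i < sp_size K)%N ->
        sys_measurable (FF (sp_time K i)) (sp_val K i) &
      forall i, (i < sp_size K)%N -> exists M, forall w, `|sp_val K i w| <= M].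

Definition is_ito_integral (W : R -> Omega -> R) FF (T : R)
    (g : R -> Omega -> R) (I : Omega -> R) : Prop :=
  measurable_fun setT I /\
  exists K : nat -> simple_process,
    [/\ forall k, sp_adapted FF T (K k),
        (fun k => expected_integral T (fun t w => (sp_fun (K k) t w - g t w) ^+ 2))
          @ \oo --> 0%E &
        (fun k => \int[P]_w ((sp_integral W (K k) w - I w) ^+ 2)%:E)%E
          @ \oo --> 0%E].

(* X solves  dX = (A X + a) dt + (C X + c) dW,  X_0 = x,  with respect to the
   filtration FF, in the class of processes with E int_0^T |X|^2 dt finite for
   every T.  The unknown may be matrix-valued. *)
Definition linear_sde_solution (W : R -> Omega -> R) FF (n k : nat)
    (A : R -> Omega -> 'M[R]_n) (a : R -> Omega -> 'M[R]_(n, k))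
    (C : R -> Omega -> 'M[R]_n) (c : R -> Omega -> 'M[R]_(n, k))
    (x : Omega -> 'M[R]_(n, k)) (X : R -> Omega -> 'M[R]_(n, k)) : Prop :=
  [/\ L2loc_process FF X,
      {ae P, forall w, {within `[0, +oo[, continuous (X ^~ w)}},
      {ae P, forall w, X 0 w = x w} &
      forall t, 0 <= t -> exists2 I : Omega -> 'M[R]_(n, k),
        forall i j, is_ito_integral W FF t
          (fun s w => (C s w *m X s w + c s w) i j) (fun w => I w i j) &
        {ae P, forall w, X t w = x w +
          (\matrix_(i, j) \int[lebesgue_measure]_(s in `[0, t])
             ((A s w *m X s w + a s w) i j)) + I w}].

End Probability.

Section Control.
Context {R : realType} {d : measure_display} {Omega : measurableType d}.
Variables (P : probability Omega R) (W : R -> Omega -> R).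
Variables (theta : R -> Omega -> Omega) (tau : R).

Let FF := natural_filtration P W.

Definition B_tau (k l : nat) (f : R -> Omega -> 'M[R]_(k, l)) : Prop :=
  Linfty_process P FF f /\ random_periodic P theta tau f.

Definition symmetric_process (k : nat) (f : R -> Omega -> 'M[R]_k) : Prop :=
  forall t w, 0 <= t -> (f t w)^T = f t w.

Definition fundamental_solution (n : nat) (A C Phi : R -> Omega -> 'M[R]_n) :
    Prop :=
  linear_sde_solution P W FF A (fun _ _ => 0) C (fun _ _ => 0)
    (fun _ => 1%:M) Phi /\
  L2_process P FF Phi.

(* E( int_r^oo (Phi_s Phi_r^-1)^T Phi_s Phi_r^-1 ds | F_r ) >= delta I, a.s. *)
Definition cond_energy_ge (n : nat) (Phi : R -> Omega -> 'M[R]_n)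
    (r delta : R) : Prop :=
  exists2 Y : Omega -> 'M[R]_n,
    is_mx_cond_exp P (FF r)
      (fun w => \matrix_(i, j) \int[lebesgue_measure]_(s in `[r, +oo[)
         (((Phi s w *m invmx (Phi r w))^T *m
           (Phi s w *m invmx (Phi r w))) i j)) Y &
    {ae P, forall w, psd_ge (Y w) delta}.

Definition ms_exp_stable (n : nat) (A C : R -> Omega -> 'M[R]_n) : Prop :=
  exists beta lambda delta : R, [/\ 0 < beta, 0 < lambda, 0 < delta &
    exists Phi : R -> Omega -> 'M[R]_n,
    [/\ fundamental_solution A C Phi,
        forall Psi, fundamental_solution A C Psi ->
          forall t, 0 <= t -> {ae P, forall w, Psi t w = Phi t w},
        forall t, 0 <= t ->
          (\int[P]_w (mxnorm (Phi t w) ^+ 2)%:E <=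
           (beta * expR (- (lambda * t)))%:E)%E &
        forall r, 0 <= r < tau -> cond_energy_ge Phi r delta]].

(* the set S_tau[A, C; B, 0] *)
Definition stabilizer (n m : nat) (A C : R -> Omega -> 'M[R]_n)
    (B : R -> Omega -> 'M[R]_(n, m)) (Theta : R -> Omega -> 'M[R]_(m, n)) :
    Prop :=
  B_tau Theta /\
  ms_exp_stable (fun t w => A t w + B t w *m Theta t w) C.

Definition stabilizable (n m : nat) (A C : R -> Omega -> 'M[R]_n)
    (B : R -> Omega -> 'M[R]_(n, m)) : Prop :=
  exists Theta, stabilizer A C B Theta.

(* (Theta, v) belongs to the set U *)
Definition admissible (n m : nat) (A C : R -> Omega -> 'M[R]_n)
    (B : R -> Omega -> 'M[R]_(n, m)) (Theta : R -> Omega -> 'M[R]_(m, n))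
    (v : R -> Omega -> 'cV[R]_m) : Prop :=
  stabilizer A C B Theta /\ B_tau v.

Definition closed_loop_state (G : R -> set (set Omega)) (n m : nat)
    (A C : R -> Omega -> 'M[R]_n) (B : R -> Omega -> 'M[R]_(n, m))
    (b sigma : R -> Omega -> 'cV[R]_n) (Theta : R -> Omega -> 'M[R]_(m, n))
    (v : R -> Omega -> 'cV[R]_m) (x : Omega -> 'cV[R]_n)
    (X : R -> Omega -> 'cV[R]_n) : Prop :=
  linear_sde_solution P W G
    (fun t w => A t w + B t w *m Theta t w)
    (fun t w => B t w *m v t w + b t w) C sigma x X.

(* xi is an F-independent square-integrable initial state whose closed-loop
   state X (adapted to F_t \/ sigma(xi)) is tau-random periodic *)
Definition random_periodic_initial (n m : nat)
    (A C : R -> Omega -> 'M[R]_n) (B : R -> Omega -> 'M[R]_(n, m))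
    (b sigma : R -> Omega -> 'cV[R]_n) (Theta : R -> Omega -> 'M[R]_(m, n))
    (v : R -> Omega -> 'cV[R]_m) (xi : Omega -> 'cV[R]_n)
    (X : R -> Omega -> 'cV[R]_n) : Prop :=
  [/\ L2_random_variable P xi,
      independent P (sigma_of xi) (filtration_infty FF),
      closed_loop_state (enlarged_filtration FF xi) A C B b sigma Theta v xi X &
      random_periodic P theta tau X].

Definition feedback (n m : nat) (Theta : R -> Omega -> 'M[R]_(m, n))
    (v : R -> Omega -> 'cV[R]_m) (X : R -> Omega -> 'cV[R]_n) :
    R -> Omega -> 'cV[R]_m :=
  fun t w => Theta t w *m X t w + v t w.

Definition running_cost (n m : nat) (Q : R -> Omega -> 'M[R]_n)
    (S : R -> Omega -> 'M[R]_(m, n)) (Rm : R -> Omega -> 'M[R]_m)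
    (q : R -> Omega -> 'cV[R]_n) (rho : R -> Omega -> 'cV[R]_m)
    (X : R -> Omega -> 'cV[R]_n) (u : R -> Omega -> 'cV[R]_m)
    (t : R) (w : Omega) : R :=
  dotv (Q t w *m X t w) (X t w) + 2 * dotv (S t w *m X t w) (u t w)
  + dotv (Rm t w *m u t w) (u t w)
  + 2 * dotv (q t w) (X t w) + 2 * dotv (rho t w) (u t w).

Definition ergodic_cost (n m : nat) (Q : R -> Omega -> 'M[R]_n)
    (S : R -> Omega -> 'M[R]_(m, n)) (Rm : R -> Omega -> 'M[R]_m)
    (q : R -> Omega -> 'cV[R]_n) (rho : R -> Omega -> 'cV[R]_m)
    (X : R -> Omega -> 'cV[R]_n) (u : R -> Omega -> 'cV[R]_m) : \bar R :=
  limf_einf (fun T : R => (T^-1)%:E *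
      expected_integral P T (running_cost Q S Rm q rho X u))%E
    (pinfty_nbhs R).

End Control.

(* Main.v *)
(* Let D be the difference of the random periodic state and the state started
   at x, and Phi the fundamental solution of the closed-loop system.  D solves
   the homogeneous linear equation with initial value eta = xi - x, so formally
   D = Phi eta, and Phi_t is independent of eta because xi is independent of
   the Brownian filtration; hence E|D_t|^2 is at most a constant times
   E|Phi_t|^2 E|eta|^2, which is integrable over [0, oo) by stability.
   Pulling eta out of the stochastic integrals requires it to be bounded: for
   the truncation eta_N, the difference D - Phi eta_N is again a solution, with
   initial value eta - eta_N, and the mean-square estimate for linear equations
   (Ito isometry and Gronwall) makes it vanish as N tends to infinity.

   The running costs of the two states differ by at most a multiple of
   (1 + 1/e)|D|^2 + e(1 + |X|^2) for every e > 0, with X the periodic state, so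
   their time averages have the same limit.  For the periodic state the expected
   cost is a tau-periodic function of time, and its time averages converge to
   its mean over one period. *)

Require Import Defs.
From HB Require Import structures.
From mathcomp Require Import all_boot all_order all_algebra.
From mathcomp Require Import all_classical all_reals all_analysis.
From mathcomp Require Import ess_sup_inf.
From mathcomp Require Import measurable_realfun ring lra.

Import Order.TTheory GRing.Theory Num.Theory.
Import numFieldNormedType.Exports.

Local Open Scope classical_set_scope.
Local Open Scope ring_scope.

Set Implicit Arguments.
Unset Strict Implicit.
Unset Printing Implicit Defensive.

(** * Independence *)

(** The two states live on different filtrations: the one started at [x] is adapted to the Brownian
    filtration, the periodic one only to its enlargement by [xi]. Their difference is an Ito process
    for the enlarged filtration, so [W] has to be shown Brownian relative to it. The initial
    difference is then known at time zero and, once truncated, passes through stochastic integrals.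
    The equations provide stochastic integrals existentially, as L^2 limits along some sequence of
    elementary processes. Everything is therefore derived from two facts valid for every such
    sequence: linearity, and an inequality between second moments. The truncation yields the
    mean-square bound directly, rather than the identity D = Phi eta. Essential bounds on the
    coefficients hold almost everywhere in time and [Omega], so they are used only under double
    integrals. The running cost is signed: its integrals are first shown finite, and periodicity is
    exploited on its positive and negative parts, whose integrals are monotone in the horizon. *)

Section real_valued_integral.
Context {R : realType} {d : measure_display} {T : measurableType d}.
Variables (m : {measure set T -> \bar R}) (D : set T).
Hypothesis mD : measurable D.
Local Open Scope ereal_scope.

Lemma integrable_addr (f g : T -> R) :
  m.-integrable D (fun x => (f x)%:E) -> m.-integrable D (fun x => (g x)%:E) ->
  m.-integrable D (fun x => (f x + g x)%:E).
Proof. by move=> fi gi; under eq_fun do rewrite EFinD; exact: integrableD. Qed.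

Lemma integrable_subr (f g : T -> R) :
  m.-integrable D (fun x => (f x)%:E) -> m.-integrable D (fun x => (g x)%:E) ->
  m.-integrable D (fun x => (f x - g x)%:E).
Proof. by move=> fi gi; under eq_fun do rewrite EFinB; exact: integrableB. Qed.

Lemma integral_addr (f g : T -> R) :
  m.-integrable D (fun x => (f x)%:E) -> m.-integrable D (fun x => (g x)%:E) ->
  \int[m]_(x in D) (f x + g x)%:E =
  \int[m]_(x in D) (f x)%:E + \int[m]_(x in D) (g x)%:E.
Proof. by move=> fi gi; rewrite -integralD_EFin//; under eq_integral do rewrite EFinD. Qed.

Lemma integral_subr (f g : T -> R) :
  m.-integrable D (fun x => (f x)%:E) -> m.-integrable D (fun x => (g x)%:E) ->
  \int[m]_(x in D) (f x - g x)%:E =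
  \int[m]_(x in D) (f x)%:E - \int[m]_(x in D) (g x)%:E.
Proof. by move=> fi gi; rewrite -integralB_EFin//; under eq_integral do rewrite EFinB. Qed.

Lemma integrable_scaler (k : R) (f : T -> R) :
  m.-integrable D (fun x => (f x)%:E) -> m.-integrable D (fun x => (k * f x)%:E).
Proof. by move=> fi; under eq_fun do rewrite EFinM; exact: integrableZl. Qed.

Lemma integral_scaler (k : R) (f : T -> R) :
  m.-integrable D (fun x => (f x)%:E) ->
  \int[m]_(x in D) (k * f x)%:E = k%:E * \int[m]_(x in D) (f x)%:E.
Proof. by move=> fi; under eq_integral do rewrite EFinM; rewrite integralZl. Qed.

End real_valued_integral.

Definition independent_fun (R : realType) (d : measure_display)
    (T : measurableType d) (P : probability T R) (f g : T -> R) : Prop :=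
  forall U V : set R, measurable U -> measurable V ->
    P ((f @^-1` U) `&` (g @^-1` V)) = (P (f @^-1` U) * P (g @^-1` V))%E.

Section independence.
Context {R : realType} {d : measure_display} {T : measurableType d}.
Variable P : probability T R.
Local Open Scope ereal_scope.

(** On rectangles, independence makes the law of the pair equal to the product of the two laws;
    uniqueness of the product measure extends this to all measurable sets of the plane, and Tonelli
    gives the iterated integral. *)
Lemma independent_product_law (f g : T -> R) (mf : measurable_fun setT f)
    (mg : measurable_fun setT g) (fg : independent_fun P f g)
    (h : R * R -> \bar R) : measurable_fun setT h -> (forall p, 0 <= h p) ->
  \int[P]_w h (f w, g w) = \int[P]_w \int[P]_w' h (f w, g w').
Proof.
move=> mh h0.
have mfg : measurable_fun setT (fun w => (f w, g w)) by exact: measurable_fun_pair.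
pose F : {mfun T >-> R} := HB.pack f (isMeasurableFun.Build _ _ _ _ f mf).
pose G : {mfun T >-> R} := HB.pack g (isMeasurableFun.Build _ _ _ _ g mg).
pose FG : {mfun T >-> (R * R)%type} := HB.pack (fun w => (f w, g w))
  (isMeasurableFun.Build _ _ _ _ (fun w => (f w, g w)) mfg).
transitivity (\int[distribution P FG]_p h p).
  by rewrite ge0_integral_distribution.
transitivity (\int[distribution P F \x distribution P G]_p h p).
  apply: eq_measure_integral => A mA _; apply/esym.
  have := @product_measure_unique _ _ _ _ R (distribution P F) (distribution P G) (distribution P FG).
  apply => //; by move=> U V mU mV; rewrite /distribution /pushforward /= -(fg U V mU mV).
rewrite fubini_tonelli1//.
have mh' : measurable_fun setT (fubini_F (distribution P G) h).
  exact: measurable_fun_fubini_tonelli_F.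
rewrite ge0_integral_distribution//; last first.
  by move=> x; apply: integral_ge0 => y _.
apply: eq_integral => w _; rewrite /= /fubini_F.
by rewrite ge0_integral_distribution//; exact: measurableT_comp.
Qed.

Lemma independent_ge0_expectationM (f g : T -> R)
    (mf : measurable_fun setT f) (mg : measurable_fun setT g)
    (fg : independent_fun P f g)
    (f0 : forall w, (0 <= f w)%R) (g0 : forall w, (0 <= g w)%R) :
  \int[P]_w (f w * g w)%:E = \int[P]_w (f w)%:E * \int[P]_w (g w)%:E.
Proof.
(* The absolute values make [h] nonnegative on the whole plane, as [independent_product_law]
   requires; on the values of [f] and [g] they change nothing. *)
pose h (p : R * R) : \bar R := (`|p.1| * `|p.2|)%:E.
have mh : measurable_fun setT h.
  by apply/measurable_EFinP; apply: measurable_funM; exact: measurableT_comp.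
transitivity (\int[P]_w h (f w, g w)).
  by apply: eq_integral => w _; rewrite /h /= !ger0_norm.
rewrite independent_product_law//; last by move=> p; rewrite lee_fin mulr_ge0.
rewrite -ge0_integralZr//; last 3 first.
  exact/measurable_EFinP.
  by move=> w _; rewrite lee_fin.
  by apply: integral_ge0 => w _; rewrite lee_fin.
apply: eq_integral => w _; rewrite /h /= -ge0_integralZl//.
- by apply: eq_integral => w' _; rewrite !ger0_norm// EFinM.
- exact/measurable_EFinP.
- by move=> w' _; rewrite lee_fin.
- by rewrite lee_fin.
Qed.

Lemma independent_fun_comp (f g : T -> R) (u v : R -> R) :
    measurable_fun setT u -> measurable_fun setT v ->
  independent_fun P f g -> independent_fun P (u \o f) (v \o g).
Proof.
move=> mu mv fg U V mU mV; apply: (fg (u @^-1` U) (v @^-1` V)).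
  by rewrite -[X in measurable X]setTI; exact: mu.
by rewrite -[X in measurable X]setTI; exact: mv.
Qed.

(** The positive and negative parts of [f] and [g] are measurable functions of them, so each of the
    four products of parts falls under the nonnegative case and is dominated by the absolute value
    of the product, whose integrability comes from the same case. *)
Lemma independent_expectationM (f g : T -> R) :
    P.-integrable setT (EFin \o f) -> P.-integrable setT (EFin \o g) ->
    independent_fun P f g ->
  P.-integrable setT (fun w => (f w * g w)%:E) /\
  \int[P]_w (f w * g w)%:E = \int[P]_w (f w)%:E * \int[P]_w (g w)%:E.
Proof.
move=> /[dup] iF /integrableP[/measurable_EFinP mf foo].
move=> /[dup] iG /integrableP[/measurable_EFinP mg goo] fg.
have mfg : measurable_fun setT (fun w => f w * g w)%R by exact: measurable_funM.
have ifg : P.-integrable setT (fun w => (f w * g w)%:E).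
  apply/integrableP; split; first exact/measurable_EFinP.
  under eq_integral do rewrite /= normrM.
  rewrite (independent_ge0_expectationM (f := fun w => `|f w|%R) (g := fun w => `|g w|%R))//=; last 3 first.
  - exact: measurableT_comp.
  - exact: measurableT_comp.
  - by apply: (independent_fun_comp (u := fun x => `|x|%R) (v := fun x => `|x|%R)).
  by apply: lte_mul_pinfty; [exact: integral_ge0|
     rewrite ge0_fin_numE//; exact: integral_ge0|].
split => //.
have pn (x : R) : (x = Num.max x 0 - Num.max (- x) 0)%R.
  by case: (leP 0%R x) => x0; case: (leP 0%R (- x)%R) => x0'; lra.
pose p (x : R) := (Num.max x 0)%R; pose m (x : R) := (Num.max (- x) 0)%R.
have mp : measurable_fun setT p by apply: measurable_maxr.
have mm : measurable_fun setT m by apply: measurable_maxr.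
have p0 x : (0 <= p x)%R by rewrite /p le_max lexx orbT.
have m0 x : (0 <= m x)%R by rewrite /m le_max lexx orbT.
have absp x : (p x <= `|x|)%R by rewrite /p ge_max ler_norm normr_ge0.
have absm x : (m x <= `|x|)%R by rewrite /m ge_max normr_ge0 -normrN ler_norm.
have ipart (u : R -> R) (k : T -> R) : measurable_fun setT u -> (forall x, 0 <= u x)%R ->
    (forall x, u x <= `|x|)%R -> P.-integrable setT (EFin \o k) ->
    P.-integrable setT (fun w => (u (k w))%:E).
  move=> mu u0 ub /[dup] ik /integrableP[/measurable_EFinP mk _].
  apply: le_integrable ik => //; first by apply/measurable_EFinP; exact: measurableT_comp.
  by move=> w _; rewrite /= lee_fin ger0_norm.
have key (u v : R -> R) : measurable_fun setT u -> (forall x, 0 <= u x)%R ->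
    (forall x, u x <= `|x|)%R -> measurable_fun setT v -> (forall x, 0 <= v x)%R ->
    (forall x, v x <= `|x|)%R ->
    P.-integrable setT (fun w => (u (f w) * v (g w))%:E) /\
    \int[P]_w (u (f w) * v (g w))%:E = \int[P]_w (u (f w))%:E * \int[P]_w (v (g w))%:E.
  move=> mu u0 uu mv v0 vv; split.
    apply: le_integrable ifg => //.
      apply/measurable_EFinP; apply: measurable_funM; exact: measurableT_comp.
    by move=> w _; rewrite /= lee_fin ger0_norm ?mulr_ge0// normrM ler_pM.
  apply: (independent_ge0_expectationM (f := u \o f) (g := v \o g)) ; try exact: measurableT_comp.
  - exact: independent_fun_comp.
  - by move=> w /=.
  - by move=> w /=.
have [ipp epp] := key p p mp p0 absp mp p0 absp.
have [ipm epm] := key p m mp p0 absp mm m0 absm.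
have [imp emp] := key m p mm m0 absm mp p0 absp.
have [imm emm] := key m m mm m0 absm mm m0 absm.
have fpf := ipart p f mp p0 absp iF; have fmf := ipart m f mm m0 absm iF.
have gpf := ipart p g mp p0 absp iG; have gmf := ipart m g mm m0 absm iG.
have Ef : \int[P]_w (f w)%:E = \int[P]_w (p (f w))%:E - \int[P]_w (m (f w))%:E.
  rewrite -integralB_EFin//; apply: eq_integral => w _; by rewrite -EFinB [in LHS](pn (f w)).
have Eg : \int[P]_w (g w)%:E = \int[P]_w (p (g w))%:E - \int[P]_w (m (g w))%:E.
  rewrite -integralB_EFin//; apply: eq_integral => w _; by rewrite -EFinB [in LHS](pn (g w)).
have Efg : \int[P]_w (f w * g w)%:E = (\int[P]_w (p (f w) * p (g w))%:E - \int[P]_w (p (f w) * m (g w))%:E)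
   - (\int[P]_w (m (f w) * p (g w))%:E - \int[P]_w (m (f w) * m (g w))%:E).
  rewrite -!integral_subr//; try exact: integrable_subr.
  apply: eq_integral => w _; congr EFin.
  rewrite [in LHS](pn (f w)) [in LHS](pn (g w)) -/(p (f w)) -/(p (g w)) -/(m (f w)) -/(m (g w)).
  by ring.
rewrite Efg Ef Eg epp epm emp emm.
move: (integrable_fin_num measurableT fpf) (integrable_fin_num measurableT fmf)
  (integrable_fin_num measurableT gpf) (integrable_fin_num measurableT gmf).
move: (\int[P]_w (p (f w))%:E) (\int[P]_w (m (f w))%:E)
  (\int[P]_w (p (g w))%:E) (\int[P]_w (m (g w))%:E).
move=> [a| |] [b| |] [c| |] [e| |]//= _ _ _ _.
by rewrite -!(EFinM, EFinB); congr EFin; ring.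
Qed.

End independence.

(** * Gaussian moments *)

Section normal_moments.
Context {R : realType}.
Notation mu := (@lebesgue_measure R).

(** The Radon-Nikodym derivative of the normal law agrees almost everywhere with [normal_pdf],
    because both have the same integral over every measurable set. *)
Lemma ge0_integral_normal_prob (m s : R) (h : R -> R) :
    measurable_fun setT h -> (forall x, 0 <= h x) ->
  (\int[normal_prob m s]_x (h x)%:E =
   \int[mu]_x (h x * normal_pdf m s x)%:E)%E.
Proof.
move=> mh h0.
have dom := normal_prob_dominates m s.
rewrite -(Radon_Nikodym_SigmaFinite.change_of_variables dom)//; last exact/measurable_EFinP.
have igm := Radon_Nikodym_SigmaFinite.f_integrable dom.
have mpdf : measurable_fun setT (fun x => (normal_pdf m s x)%:E).
  by apply/measurable_EFinP; exact: measurable_normal_pdf.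
apply: ae_eq_integral => //.
- apply: emeasurable_funM; first exact/measurable_EFinP.
  exact: measurable_int igm.
- by apply/measurable_EFinP/measurable_funM => //; exact: measurable_normal_pdf.
- under [X in ae_eq _ _ _ X]eq_fun do rewrite EFinM.
  apply: ae_eqe_mul2l; apply: integral_ae_eq => //.
  by move=> E _ mE; rewrite -Radon_Nikodym_SigmaFinite.f_integral.
Qed.

(* The value is 1, but only its finiteness and nonnegativity matter. *)
Definition normal_variance_unit : R :=
  fine (\int[mu]_x (x ^+ 2 * normal_pdf 0 1 x)%:E)%E.

(** Finiteness: x^2 is at most 4 exp(x^2/4), so the integrand is at most a multiple of the normal
    density of variance 2, whose total mass is 1. *)
Lemma integral_normal_variance_unit :
  (\int[mu]_x (x ^+ 2 * normal_pdf 0 1 x)%:E = normal_variance_unit%:E)%E.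
Proof.
rewrite /normal_variance_unit fineK// ge0_fin_numE; last first.
  by apply: integral_ge0 => x _; rewrite lee_fin mulr_ge0 ?sqr_ge0 ?normal_pdf_ge0.
pose s : R := Num.sqrt 2.
have s2 : s ^+ 2 = 2 by rewrite sqr_sqrtr.
have s0 : s != 0 by rewrite gt_eqF// sqrtr_gt0.
pose c := 4 * normal_peak (1 : R) / normal_peak s.
have c0 : 0 <= c.
  by rewrite /c !mulr_ge0// ?normal_peak_ge0// invr_ge0 normal_peak_ge0.
apply: (@le_lt_trans _ _ (\int[mu]_x (c%:E * (normal_pdf 0 s x)%:E))%E).
  apply: ge0_le_integral => //.
  - by move=> x _; rewrite lee_fin mulr_ge0 ?sqr_ge0 ?normal_pdf_ge0.
  - apply/measurable_EFinP/measurable_funM; first exact: exprn_measurable.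
    exact: measurable_normal_pdf.
  - apply: emeasurable_funM => //; apply/measurable_EFinP.
    exact: measurable_normal_pdf.
  - move=> x _; rewrite -EFinM lee_fin !normal_pdfE// /normal_fun !subr0 s2 expr1n.
    rewrite /c -[leRHS]mulrA (mulrA _^-1) mulVf ?gt_eqF ?normal_peak_gt0// mul1r.
    have -> : - x ^+ 2 / (2 *+ 2) = x ^+ 2 / 4 + (- x ^+ 2 / (1 *+ 2)) :> R by field.
    rewrite expRD.
    set e := expR (_ / (1 *+ 2)); set a := expR (_ / 4).
    have -> : 4 * normal_peak 1 * (a * e) = 4 * a * (normal_peak 1 * e) :> R by ring.
    apply: ler_wpM2r; first by rewrite mulr_ge0 ?normal_peak_ge0 ?expR_ge0.
    rewrite /a.
    have := expR_ge1Dx (x ^+ 2 / 4); lra.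
rewrite ge0_integralZl//; last 2 first.
- by apply/measurable_EFinP; exact: measurable_normal_pdf.
- by move=> x _; rewrite lee_fin normal_pdf_ge0.
by rewrite integral_normal_pdf mule1 ltry.
Qed.

Lemma normal_variance_unit_ge0 : 0 <= normal_variance_unit.
Proof.
rewrite /normal_variance_unit fine_ge0//; apply: integral_ge0 => x _.
by rewrite lee_fin mulr_ge0 ?sqr_ge0 ?normal_pdf_ge0.
Qed.

(** The substitution x/s turns the density of standard deviation [s] into the unit one and produces
    the factor s^2. *)
Lemma integral_normal_variance (s : R) : 0 < s ->
  (\int[mu]_x (x ^+ 2 * normal_pdf 0 s x)%:E =
   (s ^+ 2 * normal_variance_unit)%:E)%E.
Proof.
move=> s0; have s0' : s != 0 by rewrite gt_eqF.
pose F (x : R^o) : R := x / s.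
have F'E : F^`()%classic = cst s^-1.
  apply/funext => x; rewrite /F derive1E deriveM// derive_cst scaler0.
  by rewrite add0r derive_id scaler1.
have cpdf : continuous (fun x : R => x ^+ 2 * normal_pdf 0 1 x).
  by move=> x; apply: cvgM; [exact: exprn_continuous|exact: continuous_normal_pdf].
rewrite EFinM -integral_normal_variance_unit.
rewrite (@increasing_ge0_integration_by_substitutionT R F (fun x : R => x ^+ 2 * normal_pdf 0 1 x))//; first last.
- by move=> x; rewrite mulr_ge0 ?sqr_ge0 ?normal_pdf_ge0.
- apply/gt0_cvgMly; last exact: cvg_id.
  by rewrite invr_gt0.
- apply/gt0_cvgMlNy; last exact: cvg_id.
  by rewrite invr_gt0.
- by rewrite F'E; exact: is_cvg_cst.
- by rewrite F'E; exact: is_cvg_cst.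
- by rewrite F'E => ?; exact: cvg_cst.
- by move=> x y xy; rewrite /F ltr_pM2r// invr_gt0.
rewrite F'E -ge0_integralZl//; first last.
- by rewrite lee_fin sqr_ge0.
- move=> x _; rewrite lee_fin; apply: mulr_ge0; last by rewrite /= invr_ge0 ltW.
  by rewrite /= mulr_ge0 ?sqr_ge0 ?normal_pdf_ge0.
- apply/measurable_EFinP; apply: measurable_funM => //.
  apply: measurableT_comp; first exact: continuous_measurable_fun.
  exact: mulrr_measurable.
apply: eq_integral => x _; rewrite !fctE/= -EFinM; congr EFin.
rewrite !normal_pdfE// /normal_fun !subr0 expr1n /F.
have -> : - (x / s) ^+ 2 / (1 *+ 2) = - x ^+ 2 / (s ^+ 2 *+ 2) by field.
have -> : normal_peak 1 = s * normal_peak s :> R.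
  rewrite /normal_peak expr1n mul1r -mulrnAr sqrtrM ?sqr_ge0// sqrtr_sqr gtr0_norm//.
  by rewrite invfM mulrA divff// mul1r.
by field.
Qed.

Lemma ge0_integralNx (f : R -> \bar R) : measurable_fun setT f ->
  (forall x, 0 <= f x)%E -> (\int[mu]_x f (- x)%R = \int[mu]_x f x)%E.
Proof.
move=> mf f0.
transitivity (\int[pushforward mu (-%R : _ -> measurableTypeR R)]_x f x)%E.
  by rewrite ge0_integral_pushforward//= preimage_setT.
by apply: eq_measure_integral => //= A mA _; exact: lebesgue_measureN.
Qed.

Lemma normal_pdf0N (s x : R) : s != 0 -> normal_pdf 0 s (- x) = normal_pdf 0 s x.
Proof. by move=> s0; rewrite !normal_pdfE// /normal_fun !subr0 sqrrN. Qed.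

End normal_moments.

Section normal_law.
Context {R : realType} {d : measure_display} {T : measurableType d}.
Variables (P : probability T R) (Z : T -> R) (s : R).
Hypothesis mZ : measurable_fun setT Z.
Hypothesis s0 : 0 < s.
Hypothesis lawZ : forall U : set R, measurable U -> P (Z @^-1` U) = normal_prob 0 s U.

Lemma ge0_expectation_normal (h : R -> R) : measurable_fun setT h ->
    (forall x, 0 <= h x) ->
  (\int[P]_w (h (Z w))%:E = \int[lebesgue_measure]_x (h x * normal_pdf 0 s x)%:E)%E.
Proof.
move=> mh h0.
pose F : {mfun T >-> measurableTypeR R} :=
  HB.pack Z (isMeasurableFun.Build _ _ T (measurableTypeR R) Z mZ).
rewrite -ge0_integral_normal_prob//.
transitivity (\int[distribution P F]_x (h x)%:E)%E.
  by rewrite ge0_integral_distribution//; exact/measurable_EFinP.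
apply: eq_measure_integral.
by move=> U mU _; exact: lawZ.
Qed.

Lemma expectation_normal_sqr :
  (\int[P]_w (Z w ^+ 2)%:E = (s ^+ 2 * normal_variance_unit)%:E)%E.
Proof.
rewrite (ge0_expectation_normal (h := fun x => x ^+ 2)).
- exact: integral_normal_variance.
- exact: exprn_measurable.
- by move=> x; exact: sqr_ge0.
Qed.

Lemma integrable_normal_sqr : P.-integrable setT (fun w => (Z w ^+ 2)%:E).
Proof.
apply/integrableP; split; first by apply/measurable_EFinP; exact: measurable_funX.
under eq_integral do rewrite gee0_abs ?lee_fin ?sqr_ge0//.
by rewrite expectation_normal_sqr ltry.
Qed.

Lemma integrable_normal : P.-integrable setT (EFin \o Z).
Proof.
apply: (@le_integrable _ _ _ _ _ _ _ (fun w => (1 + Z w ^+ 2)%:E)) => //.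
- exact/measurable_EFinP.
- move=> w _; rewrite /= lee_fin [leRHS]ger0_norm; last by have := sqr_ge0 (Z w); lra.
  have := sqr_ge0 (`|Z w| - 1); have := sqr_ge0 (Z w).
  rewrite sqrrB real_normK ?num_real// => ? ?; have := normr_ge0 (Z w); lra.
- under eq_fun do rewrite EFinD.
  apply: integrableD => //; last exact: integrable_normal_sqr.
  exact: finite_measure_integrable_cst.
Qed.

(** The density is even, so the positive and negative parts of [Z] have the same finite
    expectation. *)
Lemma expectation_normal0 : (\int[P]_w (Z w)%:E = 0)%E.
Proof.
pose p (x : R) := Num.max x 0.
have mp : measurable_fun setT p by apply: measurable_maxr.
have mpN : measurable_fun setT (fun x : R => p (- x)).
  by apply: measurableT_comp => //; exact: oppr_measurable.
have p0 x : 0 <= p x by rewrite /p le_max lexx orbT.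
have eqp : (\int[P]_w (p (Z w))%:E = \int[P]_w (p (- Z w))%:E)%E.
  rewrite (ge0_expectation_normal mp p0).
  rewrite (ge0_expectation_normal (h := fun x : R => p (- x)) mpN)//.
  rewrite -(ge0_integralNx (f := fun x => (p x * normal_pdf 0 s x)%:E)).
  - by apply: eq_integral => x _; rewrite normal_pdf0N// gt_eqF.
  - by apply/measurable_EFinP/measurable_funM => //; exact: measurable_normal_pdf.
  - by move=> x; rewrite lee_fin mulr_ge0 ?normal_pdf_ge0.
have ip (u : R -> R) : measurable_fun setT u -> (forall x, 0 <= u x <= `|x|) ->
    P.-integrable setT (fun w => (u (Z w))%:E).
  move=> mu u0; apply: le_integrable integrable_normal => //.
    by apply/measurable_EFinP; exact: measurableT_comp.
  by move=> w _; have /andP[u1 u2] := u0 (Z w); rewrite /= lee_fin ger0_norm.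
have ipp : P.-integrable setT (fun w => (p (Z w))%:E).
  by apply: ip => // x; rewrite p0 /p ge_max ler_norm normr_ge0.
have ipm : P.-integrable setT (fun w => (p (- Z w))%:E).
  by apply: (ip (fun x : R => p (- x))) => // x; rewrite p0 /p ge_max -normrN ler_norm normr_ge0.
have -> : (\int[P]_w (Z w)%:E = \int[P]_w (p (Z w))%:E - \int[P]_w (p (- Z w))%:E)%E.
  rewrite -integralB_EFin//; apply: eq_integral => w _; rewrite -EFinB; congr EFin.
  by rewrite /p; case: (leP 0 (Z w)) => x0; case: (leP 0 (- Z w)) => x0'; lra.
by rewrite eqp subee// integrable_fin_num.
Qed.

End normal_law.

(** * Brownian filtrations *)

Section sub_sigma_algebras.
Context {R : realType} {d : measure_display} {T : measurableType d}.
Variable P : probability T R.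
Implicit Types (G : set (set T)).

(** Dynkin's argument: the measurable sets independent of [A] form a lambda-system, which contains
    the sigma-algebra generated by the intersection-stable class [C]. *)
Lemma independent_generated (A : set T) (C : set (set T)) : measurable A ->
    setI_closed C -> C `<=` measurable ->
    (forall E, C E -> P (A `&` E) = (P A * P E)%E) ->
  forall E, <<s C >> E -> P (A `&` E) = (P A * P E)%E.
Proof.
move=> mA CI Cm AC.
have mC : <<s C >> `<=` measurable.
  by apply: smallest_sub => //; exact: sigma_algebra_measurable.
suff sub : <<s C >> `<=` [set E | measurable E /\ P (A `&` E) = (P A * P E)%E].
  by move=> E /sub[].
apply: lambda_system_subset => //; last first.
  by move=> E CE; split; [exact: Cm|exact: AC].
apply/dynkin_lambda_system; split => /=.
- by split => //; rewrite setIT probability_setT mule1.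
- move=> E [mE AE]; split; first exact: measurableC.
  rewrite probability_setC// -setDE measureD//; last by rewrite -ge0_fin_numE// fin_num_measure.
  have [a Aa] : exists a, P A = a%:E by exists (fine (P A)); rewrite fineK// fin_num_measure.
  have [e Ee] : exists e, P E = e%:E by exists (fine (P E)); rewrite fineK// fin_num_measure.
  rewrite [X in (_ - X)%E]AE Ee; transitivity (a%:E - a%:E * e%:E)%E.
    by congr (_ - _ * _)%E.
  by rewrite Aa -EFinM -!EFinB -EFinM; congr EFin; ring.
- move=> F tF mAF; have mF k : measurable (F k) by case: (mAF k).
  split; first exact: bigcup_measurable.
  have sAF : P (\bigcup_k (A `&` F k)) = (\sum_(k <oo) P (A `&` F k))%E.
    have mAFk k : measurable (A `&` F k) by exact: measurableI.
    apply: measure_semi_bigcup => //; first exact: trivIset_setIl.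
    exact: bigcup_measurable.
  have sF : P (\bigcup_k F k) = (\sum_(k <oo) P (F k))%E.
    by apply: measure_semi_bigcup => //; exact: bigcup_measurable.
  rewrite setI_bigcupr sAF sF.
  have [a Aa] : exists a, P A = a%:E by exists (fine (P A)); rewrite fineK// fin_num_measure.
  rewrite Aa -nneseriesZl//; apply: eq_eseriesr => k _.
  by rewrite -Aa; exact: (mAF k).2.
Qed.

(** The sets that agree with a member of [G] up to a negligible symmetric difference form a
    sigma-algebra containing all the generators. This strips the null sets off an augmented
    filtration. *)
Lemma ae_sub_sigma_algebra G (E : set T) : sigma_algebra setT G ->
    <<s G `|` [set N | P.-negligible N] >> E ->
  exists2 E', G E' & P.-negligible ((E `\` E') `|` (E' `\` E)).
Proof.
move=> sG; move: E; apply: smallest_sub => /=; last first.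
  move=> E [GE|nE]; first by exists E => //; rewrite setDv setU0; exact: negligible_set0.
  exists set0; first by case: sG.
  by rewrite set0D setU0 setD0.
have GC E : G E -> G (~` E) by move=> GE; rewrite -setTD; case: sG => _ + _; apply.
split => //.
- by exists set0; [case: sG|rewrite setDv setU0; exact: negligible_set0].
- move=> E [E' GE' nE]; exists (~` E'); first exact: GC.
  apply: negligibleS nE => w /= [[[_ nEw] /contrapT E'w]|[nE'w nEw]].
    by right.
  by left; split => //; apply: contrapT => nEw'; exact: nEw.
- move=> F FP.
  have /choice[F' F'P] : forall k, exists E', G E' /\ P.-negligible ((F k `\` E') `|` (E' `\` F k)).
    by move=> k; have [E' ? ?] := FP k; exists E'.
  exists (\bigcup_k F' k); first by case: sG => _ _; apply => k; case: (F'P k).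
  apply: (@negligibleS _ _ _ P (\bigcup_k ((F k `\` F' k) `|` (F' k `\` F k)))).
    move=> w [[[k _ Fkw] nF']|[[k _ F'kw] nF]]; exists k => //.
      by left; split => // F'kw; apply: nF'; exists k.
    by right; split => // Fkw; apply: nF; exists k.
  by apply: negligible_bigcup => k; case: (F'P k).
Qed.

Lemma measure_setI_negligible (A E E' : set T) : measurable A -> measurable E ->
    measurable E' -> P.-negligible ((E `\` E') `|` (E' `\` E)) ->
  P (A `&` E) = P (A `&` E').
Proof.
move=> mA mE mE' [N [mN N0 sub]].
have le (E1 E2 : set T) : measurable E1 -> measurable E2 -> E1 `\` E2 `<=` N ->
    (P (A `&` E1) <= P (A `&` E2))%E.
  move=> mE1 mE2 sN; rewrite -[leRHS]adde0 -N0.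
  apply: le_trans (measureU2 _ _ _) => //; last exact: measurableI.
  apply: le_measure; rewrite ?inE; [exact: measurableI|apply: measurableU => //; exact: measurableI|].
  move=> w [Aw E1w]; have [E2w|nE2w] := pselect (E2 w); first by left.
  by right; apply: sN.
by apply/eqP; rewrite eq_le !le//; apply: subset_trans sub => w ?; [right|left].
Qed.

End sub_sigma_algebras.

Section sys_measurable.
Context {R : realType} {d : measure_display} {T : measurableType d}.
Variable G : set (set T).
Hypothesis sG : sigma_algebra setT G.

(** Regarding [G] as the sigma-algebra of a measurable type gives access to the closure properties
    of measurable functions; generating from a sigma-algebra adds no sets. *)
Lemma sys_measurableP (Y : T -> R) :
  sys_measurable G Y <-> measurable_fun setT (Y : g_sigma_algebraType G -> R).
Proof.
split => [GY _ U mU|mY U mU].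
  by rewrite setTI /measurable/=; apply: sub_sigma_algebra; exact: GY.
have := mY measurableT U mU; rewrite setTI /measurable/=.
by rewrite sigma_algebra_id.
Qed.

Lemma sys_measurableT : G setT.
Proof. by case: sG => G0 GC _; rewrite -(setD0 setT); exact: GC. Qed.

Lemma sys_measurable_comp (h : R -> R) (Y : T -> R) :
  measurable_fun setT h -> sys_measurable G Y -> sys_measurable G (h \o Y).
Proof.
move=> mh GY U mU; apply: (GY (h @^-1` U)).
by rewrite -[X in measurable X]setTI; exact: mh.
Qed.

Lemma sys_measurable_cst (c : R) : sys_measurable G (fun=> c).
Proof. by apply/sys_measurableP; exact: measurable_cst. Qed.

Lemma sys_measurableB (Y Z : T -> R) : sys_measurable G Y ->
  sys_measurable G Z -> sys_measurable G (fun w => Y w - Z w).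
Proof. by rewrite !sys_measurableP => ? ?; exact: measurable_funB. Qed.

Lemma sys_measurableM (Y Z : T -> R) : sys_measurable G Y ->
  sys_measurable G Z -> sys_measurable G (fun w => Y w * Z w).
Proof. by rewrite !sys_measurableP => ? ?; exact: measurable_funM. Qed.

End sys_measurable.

(** Brownian motion relative to a filtration [G] possibly larger than its own: the increments after
    [s] are independent of all of [G s]. The stochastic calculus below is done for such a [G], so
    that it applies to the enlarged filtration. *)
Definition brownian_wrt (R : realType) (d : measure_display)
    (T : measurableType d) (P : probability T R) (W : R -> T -> R)
    (G : R -> set (set T)) : Prop :=
  [/\ forall t, 0 <= t -> sigma_algebra setT (G t) /\ G t `<=` measurable,
      forall s t, 0 <= s -> s <= t -> G s `<=` G t,
      forall t, 0 <= t -> sys_measurable (G t) (W t),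
      forall s t, 0 <= s < t -> forall U : set R, measurable U ->
        P ((W t \- W s)%R @^-1` U) = normal_prob 0 (Num.sqrt (t - s)) U &
      forall s t, 0 <= s < t -> forall (U : set R) E, measurable U -> G s E ->
        P (((W t \- W s)%R @^-1` U) `&` E) =
        (P ((W t \- W s)%R @^-1` U) * P E)%E].

Section brownian_filtrations.
Context {R : realType} {d : measure_display} {T : measurableType d}.
Variables (P : probability T R) (W : R -> T -> R).
Hypothesis Pcomplete : measure_is_complete P.
Hypothesis Wb : brownian_motion P W.

Lemma raw_filtration_measurable (t : R) : raw_filtration W t `<=` measurable.
Proof.
case: Wb => mW _ _ _ _; apply: smallest_sub; first exact: sigma_algebra_measurable.
move=> _ [s [U [/andP[s0 _] mU ->]]]; rewrite -[X in measurable X]setTI.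
exact: mW.
Qed.

Lemma natural_filtration_measurable (t : R) : natural_filtration P W t `<=` measurable.
Proof.
apply: smallest_sub; first exact: sigma_algebra_measurable.
by move=> E [|]; [exact: raw_filtration_measurable|exact: Pcomplete].
Qed.

(** Independence of the increments is given for the raw filtration. An event of the augmented one
    differs from a raw event by a null set, which changes no probability; completeness makes the
    null sets measurable. *)
Lemma brownian_wrt_natural : brownian_wrt P W (natural_filtration P W).
Proof.
case: (Wb) => mW _ _ lawW indW; split => //.
- move=> t t0; split; [exact: smallest_sigma_algebra|exact: natural_filtration_measurable].
- move=> s t s0 st; apply: sub_sigma_algebra2 => E [rE|nE]; [left|by right].
  move: E rE; apply: sub_sigma_algebra2 => E [r [U [/andP[r0 rs] mU ->]]].
  by exists r, U; split => //; rewrite r0 (le_trans rs).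
- move=> t t0 U mU; apply: sub_sigma_algebra; left; apply: sub_sigma_algebra.
  by exists t, U; split => //; rewrite t0 lexx.
- move=> s t st U E mU FE.
  have [E' rE' nEE'] := ae_sub_sigma_algebra (smallest_sigma_algebra _ _) FE.
  have [s0 s_t] := andP st.
  have mA : measurable ((W t \- W s)%R @^-1` U).
    rewrite -[X in measurable X]setTI; apply: measurable_funB => //; apply: mW => //.
    exact: le_trans (ltW s_t).
  have mE : measurable E := natural_filtration_measurable FE.
  have mE' : measurable E' := raw_filtration_measurable rE'.
  rewrite (measure_setI_negligible mA mE mE' nEE') indW//; congr (_ * _)%E.
  by rewrite -[E]setTI -[in LHS](setTI E') (measure_setI_negligible _ mE mE' nEE').
Qed.

Lemma natural_filtration_infty (t : R) : 0 <= t ->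
  natural_filtration P W t `<=` filtration_infty (natural_filtration P W).
Proof.
move=> t0 E FE; apply: sub_sigma_algebra; exists t => //=.
by rewrite in_itv/= t0.
Qed.

(** For an increment event after [s], an event of [F s] and an event of [sigma_of Y], the joint
    probability factors: first [Y] splits off, being independent of the whole Brownian filtration,
    then the increment splits off from [F s]. The intersections of events of the last two kinds form
    an intersection-stable class generating the enlarged sigma-algebra. *)
Lemma brownian_wrt_enlarged (k l : nat) (Y : T -> 'M[R]_(k, l)) :
  mx_random_variable Y ->
  independent P (sigma_of Y) (filtration_infty (natural_filtration P W)) ->
  brownian_wrt P W (enlarged_filtration (natural_filtration P W) Y).
Proof.
move=> mY indY; have [sF nF WF lawW indW] := brownian_wrt_natural.
set F := natural_filtration P W in sF nF WF lawW indW *.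
have sY : sigma_of Y `<=` measurable.
  apply: smallest_sub; first exact: sigma_algebra_measurable.
  move=> _ [i [j [U [mU ->]]]]; have := mY i j measurableT U mU.
  by rewrite setTI.
have genE t : 0 <= t -> enlarged_filtration F Y t `<=` <<s [set E | exists A B,
    [/\ F t A, sigma_of Y B & E = A `&` B]] >>.
  move=> t0; apply: sub_sigma_algebra2 => E [FE|sE].
    exists E, setT; split => //; last by rewrite setIT.
    exact: sys_measurableT (smallest_sigma_algebra _ _).
  exists setT, E; split => //; last by rewrite setTI.
  exact: sys_measurableT (sF t t0).1.
split => //.
- move=> t t0; split; first exact: smallest_sigma_algebra.
  apply: smallest_sub; first exact: sigma_algebra_measurable.
  by move=> E [FE|]; [exact: (sF t t0).2|exact: sY].
- move=> s t s0 st; apply: sub_sigma_algebra2 => E [FE|]; [left|by right].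
  exact: nF FE.
- by move=> t t0 U mU; apply: sub_sigma_algebra; left; exact: WF.
- move=> s t st U E mU /genE; case/andP: (st) => s0 s_t.
  have t0 : 0 <= t by exact: le_trans (ltW s_t).
  set A := _ @^-1` U.
  (* The increment event lies in [F t], so its intersection with an event of [F s] stays in the
     Brownian filtration, from which [Y] is independent. *)
  have FA : F t A.
    have := sys_measurableB (sF t t0).1 (WF t t0) _; apply => //.
    by move=> V mV; apply: (nF s t) => //; [exact: ltW|exact: WF].
  have mA : measurable A by exact: (sF t t0).2.
  move=> /(_ s0); apply: independent_generated => //.
  + move=> _ _ [A1 [B1 [FA1 YB1 ->]]] [A2 [B2 [FA2 YB2 ->]]].
    exists (A1 `&` A2), (B1 `&` B2); split; last by rewrite setIACA.
      exact: (@measurableI _ (g_sigma_algebraType (raw_filtration W s `|` [set N | P.-negligible N]))).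
    by apply: (@measurableI _ (g_sigma_algebraType _)).
  + move=> _ [A1 [B1 [FA1 YB1 ->]]]; apply: measurableI; [exact: (sF s s0).2|exact: sY].
  + move=> _ [A1 [B1 [FA1 YB1 ->]]].
    have FtA1 : F t A1 by apply: (nF s t) => //; exact: ltW.
    rewrite setIA setIC indY//; last first.
      apply: (natural_filtration_infty t0).
      exact: (@measurableI _ (g_sigma_algebraType (raw_filtration W t `|` [set N | P.-negligible N]))).
    rewrite (indW s t)// [in RHS]setIC indY//; last exact: (natural_filtration_infty t0).
    by rewrite muleCA.
Qed.

End brownian_filtrations.

Section bounded_integrable.
Context {R : realType} {d : measure_display} {T : measurableType d}.
Variable P : probability T R.

Lemma integrable_bounded_mul (y f : T -> R) (M : R) : measurable_fun setT y ->
    (forall w, `|y w| <= M) -> P.-integrable setT (fun w => (f w)%:E) ->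
  P.-integrable setT (fun w => (y w * f w)%:E).
Proof.
move=> my yM /[dup] fi /integrableP[/measurable_EFinP mf _].
apply: le_integrable (integrable_scaler measurableT M fi) => //.
  by apply/measurable_EFinP; exact: measurable_funM.
move=> w _; rewrite /= lee_fin !normrM ler_wpM2r//.
by rewrite (le_trans (yM w))// ler_norm.
Qed.

Lemma integrable_bounded (y : T -> R) (M : R) : measurable_fun setT y ->
    (forall w, `|y w| <= M) -> P.-integrable setT (fun w => (y w)%:E).
Proof.
move=> my yM; under eq_fun do rewrite -[y _]mulr1.
by apply: (integrable_bounded_mul my yM); exact: finite_measure_integrable_cst.
Qed.

End bounded_integrable.

(** * Second moments of products of Brownian increments *)

Section elementary_integral.
Context {R : realType} {d : measure_display} {T : measurableType d}.
Variables (P : probability T R) (W : R -> T -> R) (G : R -> set (set T)).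
Hypothesis Wb : brownian_wrt P W G.
Notation mu := (@lebesgue_measure R).
Notation kappa := (@normal_variance_unit R).

Let sG t : 0 <= t -> sigma_algebra setT (G t).
Proof. by case: Wb => h _ _ _ _ /h[]. Qed.

Let GS s t (Y : T -> R) : 0 <= s -> s <= t -> sys_measurable (G s) Y ->
  sys_measurable (G t) Y.
Proof. by case: Wb => _ h _ _ _ s0 st GY U mU; apply: (h s t) => //; exact: GY. Qed.

Let GW s t : 0 <= s -> s <= t -> sys_measurable (G t) (W s).
Proof. by move=> s0 st; apply: (GS s0 st); case: Wb => _ _ + _ _; exact. Qed.

Lemma sys_measurable_fun t (Y : T -> R) : 0 <= t -> sys_measurable (G t) Y ->
  measurable_fun setT Y.
Proof.
move=> t0 GY _ U mU; rewrite setTI; case: Wb => h _ _ _ _.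
by apply: (h t t0).2; exact: GY.
Qed.

Let mW t : 0 <= t -> measurable_fun setT (W t).
Proof. by move=> t0; apply: (sys_measurable_fun t0); exact: GW. Qed.

Lemma increment_law s t (U : set R) : 0 <= s -> s < t -> measurable U ->
  P ((fun w => W t w - W s w) @^-1` U) = normal_prob 0 (Num.sqrt (t - s)) U.
Proof. by case: Wb => _ _ _ h _ s0 st mU; apply: h => //; rewrite s0. Qed.

Lemma measurable_increment s t : 0 <= s -> s <= t ->
  measurable_fun setT (fun w => W t w - W s w).
Proof.
move=> s0 st; apply: measurable_funB; apply: mW => //.
exact: le_trans st.
Qed.

Lemma increment_independent s t (Y : T -> R) : 0 <= s -> s < t ->
    sys_measurable (G s) Y -> independent_fun P Y (fun w => W t w - W s w).
Proof.
case: Wb => _ _ _ _ h s0 st GY U V mU mV.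
have s0t : 0 <= s < t by rewrite s0.
by rewrite setIC (h s t s0t V _ mV (GY U mU)) muleC.
Qed.

Lemma integrable_increment s t : 0 <= s -> s <= t ->
  P.-integrable setT (fun w => (W t w - W s w)%:E).
Proof.
move=> s0; rewrite le_eqVlt => /predU1P[<-|st].
  by under eq_fun do rewrite subrr; exact: integrable0.
apply: (integrable_normal (s := Num.sqrt (t - s))).
- by apply: measurable_increment => //; exact: ltW.
- by rewrite sqrtr_gt0 subr_gt0.
- by move=> U mU; exact: increment_law.
Qed.

Lemma expectation_mul_increment s t (Y : T -> R) : 0 <= s -> s <= t ->
    sys_measurable (G s) Y -> P.-integrable setT (fun w => (Y w)%:E) ->
  P.-integrable setT (fun w => (Y w * (W t w - W s w))%:E) /\
  (\int[P]_w (Y w * (W t w - W s w))%:E = 0)%E.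
Proof.
(* Empty intervals are allowed in elementary processes; there the increment vanishes and no Gaussian
   law is at hand. *)
move=> s0; rewrite le_eqVlt => /predU1P[<-|st] GY Yi.
  split; first by under eq_fun do rewrite subrr mulr0; exact: integrable0.
  by under eq_integral do rewrite subrr mulr0; exact: integral0.
have := independent_expectationM Yi (integrable_increment s0 (ltW st))
  (increment_independent s0 st GY).
rewrite (expectation_normal0 (s := Num.sqrt (t - s)) (Z := fun w => W t w - W s w)).
- by rewrite mule0.
- by apply: measurable_increment => //; exact: ltW.
- by rewrite sqrtr_gt0 subr_gt0.
- by move=> U mU; exact: increment_law.
Qed.

Lemma expectation_mul_increment_sqr s t (Y : T -> R) : 0 <= s -> s <= t ->
    sys_measurable (G s) Y -> P.-integrable setT (fun w => (Y w)%:E) ->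
  P.-integrable setT (fun w => (Y w * (W t w - W s w) ^+ 2)%:E) /\
  (\int[P]_w (Y w * (W t w - W s w) ^+ 2)%:E =
   (kappa * (t - s))%:E * \int[P]_w (Y w)%:E)%E.
Proof.
move=> s0; rewrite le_eqVlt => /predU1P[<-|st] GY Yi.
  rewrite subrr mulr0 mul0e.
  split; first by under eq_fun do rewrite subrr expr0n mulr0; exact: integrable0.
  by under eq_integral do rewrite subrr expr0n mulr0; exact: integral0.
have mI := measurable_increment s0 (ltW st).
have sq0 : 0 < Num.sqrt (t - s) by rewrite sqrtr_gt0 subr_gt0.
have law U (mU : measurable U) := increment_law s0 st mU.
have i2 := integrable_normal_sqr mI sq0 law.
have ind : independent_fun P Y (fun w => (W t w - W s w) ^+ 2).
  apply: (independent_fun_comp (u := id) (v := fun x => x ^+ 2)) => //.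
  exact: increment_independent.
have [-> ->] := independent_expectationM Yi i2 ind; split => //.
rewrite (expectation_normal_sqr mI sq0 law) sqr_sqrtr ?subr_ge0 ?ltW//.
by rewrite muleC mulrC.
Qed.

Definition bounded_adapted s (y : T -> R) :=
  sys_measurable (G s) y /\ exists M, forall w, `|y w| <= M.

Lemma bounded_adapted_integrable s y : 0 <= s -> bounded_adapted s y ->
  P.-integrable setT (fun w => (y w)%:E).
Proof.
move=> s0 [Gy [M yM]]; apply: integrable_bounded yM.
exact: sys_measurable_fun s0 Gy.
Qed.

Lemma bounded_adaptedM s t y z : 0 <= s -> s <= t ->
  bounded_adapted s y -> bounded_adapted t z ->
  bounded_adapted t (fun w => y w * z w).
Proof.
move=> s0 st [Gy [M yM]] [Gz [N zN]]; split.
  apply: sys_measurableM => //; first by apply: sG; exact: le_trans st.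
  exact: (GS s0 st Gy).
exists (M * N) => w; rewrite normrM; exact: ler_pM.
Qed.

(** [z] times the earlier increment is [G a']-measurable, hence independent of the later, centred
    increment. [z] itself may become known only at time [a']. *)
Lemma expectation_mul2_disjoint a b a' b' (z : T -> R) :
    0 <= a -> a <= b -> b <= a' -> a' <= b' -> bounded_adapted a' z ->
  P.-integrable setT (fun w => (z w * (W b w - W a w) * (W b' w - W a' w))%:E) /\
  (\int[P]_w (z w * (W b w - W a w) * (W b' w - W a' w))%:E = 0)%E.
Proof.
move=> a0 ab ba' ab' [Gz [M zM]].
have b0 := le_trans a0 ab; have a'0 := le_trans b0 ba'.
apply: expectation_mul_increment => //.
  apply: sys_measurableM => //; first exact: sG.
  apply: sys_measurableB; [exact: sG|exact: GW|apply: GW => //].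
  exact: le_trans ba'.
apply: integrable_bounded_mul zM _; first exact: sys_measurable_fun a'0 Gz.
exact: integrable_increment.
Qed.

Definition overlap (a b a' b' : R) : R :=
  fine (mu (`]a, b] `&` `]a', b'])).

Lemma overlapE a b a' b' : a <= a' ->
  overlap a b a' b' = Num.max 0 (Num.min b b' - a').
Proof.
move=> aa'; rewrite /overlap.
have -> : `]a, b] `&` `]a', b'] = `]a', (Num.min b b')]%classic.
  apply/seteqP; split => x; rewrite /= !in_itv/= le_min.
    by move=> [/andP[_ ->] /andP[-> ->]].
  move=> /andP[a'x /andP[-> ->]]; rewrite a'x.
  by rewrite (le_lt_trans aa' a'x).
rewrite lebesgue_measure_itv/= lte_fin; case: ltP => h.
  by rewrite -EFinB /= max_r// subr_ge0 ltW.
by rewrite max_l// subr_le0.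
Qed.

Lemma overlapC a b a' b' : overlap a b a' b' = overlap a' b' a b.
Proof. by rewrite /overlap setIC. Qed.

(** When the intervals meet, both increments are cut at [a'] and at the smaller right endpoint [c].
    Of the resulting products only the square of the increment over the common part contributes to
    the mean; the others pair increments over successive intervals, as in
    [expectation_mul2_disjoint]. *)
Lemma expectation_increments_le a b a' b' (z : T -> R) :
    0 <= a -> a <= b -> a <= a' -> a' <= b' -> bounded_adapted a' z ->
  P.-integrable setT (fun w => (z w * (W b w - W a w) * (W b' w - W a' w))%:E) /\
  (\int[P]_w (z w * (W b w - W a w) * (W b' w - W a' w))%:E =
   (kappa * overlap a b a' b')%:E * \int[P]_w (z w)%:E)%E.
Proof.
move=> a0 ab aa' a'b' za; have a'0 := le_trans a0 aa'.
have zi := bounded_adapted_integrable a'0 za.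
have [ba'|a'b] := leP b a'.
  have [i e] := expectation_mul2_disjoint a0 ab ba' a'b' za; split => //.
  rewrite e overlapE// max_l ?mulr0 ?mul0e//.
  by rewrite subr_le0 ge_min ba'.
pose c := Num.min b b'.
have a'c : a' <= c by rewrite le_min (ltW a'b).
have cb : c <= b by rewrite ge_min lexx.
have cb' : c <= b' by rewrite ge_min lexx orbT.
have c0 := le_trans a'0 a'c.
have zc : bounded_adapted c z by case: za => Gz ?; split => //; exact: (GS a'0 a'c Gz).
have [i1 e1] := expectation_mul2_disjoint a0 aa' (lexx a') a'c za.
have [i2 e2] := expectation_mul2_disjoint a0 aa' a'c cb' zc.
have [i3 e3] := expectation_mul_increment_sqr a'0 a'c za.1 zi.
have [i4 e4] := expectation_mul2_disjoint a'0 a'c (lexx c) cb' zc.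
have [i5 e5] := expectation_mul2_disjoint a'0 a'c (lexx c) cb zc.
have dec w : z w * (W b w - W a w) * (W b' w - W a' w) =
    z w * (W a' w - W a w) * (W c w - W a' w) +
    z w * (W a' w - W a w) * (W b' w - W c w) +
    z w * (W c w - W a' w) ^+ 2 +
    z w * (W c w - W a' w) * (W b' w - W c w) +
    z w * (W c w - W a' w) * (W b w - W c w).
  (* [c] is one of [b] and [b'], so one of the two pieces beyond it is empty. *)
  have : (W b w - W c w) * (W b' w - W c w) = 0.
    by rewrite /c; case: leP => _; rewrite subrr ?mul0r ?mulr0.
  move=> e; transitivity (z w * (W a' w - W a w) * (W c w - W a' w) +
    z w * (W a' w - W a w) * (W b' w - W c w) +
    z w * (W c w - W a' w) ^+ 2 +
    z w * (W c w - W a' w) * (W b' w - W c w) +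
    z w * (W c w - W a' w) * (W b w - W c w) + z w * ((W b w - W c w) * (W b' w - W c w))).
    by ring.
  by rewrite e mulr0 addr0.
under eq_fun do rewrite dec.
split; first by do !apply: integrable_addr => //.
rewrite !integral_addr//; try by do !apply: integrable_addr => //.
rewrite e1 e2 e3 e4 e5 !add0e !adde0 overlapE// max_r//.
by rewrite subr_ge0.
Qed.

(** The weight y y' is known at the later of the two left endpoints; the two possible orders are
    exchanged by the symmetry of [overlap]. *)
Lemma expectation_increments a b a' b' (y y' : T -> R) :
    0 <= a -> a <= b -> 0 <= a' -> a' <= b' ->
    bounded_adapted a y -> bounded_adapted a' y' ->
  P.-integrable setT
    (fun w => (y w * (W b w - W a w) * (y' w * (W b' w - W a' w)))%:E) /\
  (\int[P]_w (y w * (W b w - W a w) * (y' w * (W b' w - W a' w)))%:E =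
   (kappa * overlap a b a' b')%:E * \int[P]_w (y w * y' w)%:E)%E.
Proof.
move=> a0 ab a'0 a'b' ya y'a.
have [aa'|a'a] := leP a a'.
  have := expectation_increments_le a0 ab aa' a'b' (bounded_adaptedM a0 aa' ya y'a).
  rewrite (_ : (fun w => (y w * y' w * (W b w - W a w) * (W b' w - W a' w))%:E) =
    (fun w => (y w * (W b w - W a w) * (y' w * (W b' w - W a' w)))%:E))//.
  by apply/funext => w; congr EFin; ring.
have := expectation_increments_le a'0 a'b' (ltW a'a) ab (bounded_adaptedM a'0 (ltW a'a) y'a ya).
rewrite overlapC.
rewrite (_ : (fun w => (y' w * y w * (W b' w - W a' w) * (W b w - W a w))%:E) =
  (fun w => (y w * (W b w - W a w) * (y' w * (W b' w - W a' w)))%:E)); last first.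
  by apply/funext => w; congr EFin; ring.
have -> // : (\int[P]_w (y' w * y w)%:E = \int[P]_w (y w * y' w)%:E)%E.
by apply: eq_integral => w _; rewrite mulrC.
Qed.

End elementary_integral.

(** * Product measurability and the Ito isometry *)

Section has_integral.
Context {R : realType} {d : measure_display} {T : measurableType d}.
Variables (m : {measure set T -> \bar R}) (D : set T).
Hypothesis mD : measurable D.

(** Integrability and the real value travel together, so that finite sums of integrals can be
    treated by induction. *)
Definition has_integral (f : T -> R) (v : R) :=
  m.-integrable D (fun x => (f x)%:E) /\ (\int[m]_(x in D) (f x)%:E = v%:E)%E.

Lemma has_integral0 : has_integral (fun=> 0) 0.
Proof. by split; [exact: integrable0|exact: integral0]. Qed.

Lemma has_integralD f g u v : has_integral f u -> has_integral g v ->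
  has_integral (fun x => f x + g x) (u + v).
Proof.
move=> [fi fe] [gi ge]; split; first exact: integrable_addr.
by rewrite integral_addr// fe ge.
Qed.

Lemma has_integralZ k f u : has_integral f u -> has_integral (fun x => k * f x) (k * u).
Proof.
move=> [fi fe]; split; first exact: integrable_scaler.
by rewrite integral_scaler// fe.
Qed.

End has_integral.

Lemma ler_sqr_norm (R : realDomainType) (x y : R) : (x ^+ 2 <= y ^+ 2) = (`|x| <= `|y|).
Proof.
by rewrite -(real_normK (num_real x)) -(real_normK (num_real y)) ler_pXn2r ?nnegrE.
Qed.

Lemma lte_scale_pinfty (R : realDomainType) (k : R) (x : \bar R) :
  0 <= k -> (x < +oo)%E -> (k%:E * x < +oo)%E.
Proof. by move=> k0; exact: lte_mul_pinfty. Qed.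

Section square_integrals.
Context {R : realType} {d : measure_display} {T : measurableType d}.
Variables (m : {measure set T -> \bar R}) (D : set T).
Hypothesis mD : measurable D.
Local Open Scope ereal_scope.

Lemma measurable_sqr_EFin (f : T -> R) : measurable_fun D f ->
  measurable_fun D (fun x => (f x ^+ 2)%:E).
Proof. by move=> mf; apply/measurable_EFinP; exact: measurable_funX. Qed.

Lemma integral_sqr_ge0 (f : T -> R) : 0 <= \int[m]_(x in D) (f x ^+ 2)%:E.
Proof. by apply: integral_ge0 => x _; rewrite lee_fin sqr_ge0. Qed.

Lemma le_integral_sqrD (f g h : T -> R) : measurable_fun D f ->
    measurable_fun D g -> measurable_fun D h ->
    (forall x, D x -> (f x = g x + h x)%R) ->
  \int[m]_(x in D) (f x ^+ 2)%:E <=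
  2%:E * \int[m]_(x in D) (g x ^+ 2)%:E + 2%:E * \int[m]_(x in D) (h x ^+ 2)%:E.
Proof.
move=> mf mg mh fgh.
rewrite -!ge0_integralZl//; try exact: measurable_sqr_EFin;
  try by move=> x _; rewrite lee_fin sqr_ge0.
rewrite -ge0_integralD//; first last.
- by apply: emeasurable_funM => //; exact: measurable_sqr_EFin.
- by move=> x _; rewrite -EFinM lee_fin mulr_ge0// sqr_ge0.
- by apply: emeasurable_funM => //; exact: measurable_sqr_EFin.
- by move=> x _; rewrite -EFinM lee_fin mulr_ge0// sqr_ge0.
apply: ge0_le_integral => //.
- by move=> x _; rewrite lee_fin sqr_ge0.
- exact: measurable_sqr_EFin.
- by apply: emeasurable_funD; apply: emeasurable_funM => //; exact: measurable_sqr_EFin.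
- move=> x Dx; rewrite -!EFinM -EFinD lee_fin fgh//.
  by have := sqr_ge0 (g x - h x)%R; nra.
Qed.

Lemma le_integral_sqrM (f g : T -> R) (M : R) : measurable_fun D f ->
    measurable_fun D g -> {ae m, forall x, D x -> (`|f x| <= M * `|g x|)%R} ->
  \int[m]_(x in D) (f x ^+ 2)%:E <= (M ^+ 2)%:E * \int[m]_(x in D) (g x ^+ 2)%:E.
Proof.
move=> mf mg fM.
rewrite -ge0_integralZl//; last 3 first.
- exact: measurable_sqr_EFin.
- by move=> x _; rewrite lee_fin sqr_ge0.
- by rewrite lee_fin sqr_ge0.
apply: ae_ge0_le_integral => //.
- by move=> x _; rewrite lee_fin sqr_ge0.
- exact: measurable_sqr_EFin.
- by move=> x _; rewrite -EFinM lee_fin mulr_ge0// sqr_ge0.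
- by apply: emeasurable_funM => //; exact: measurable_sqr_EFin.
- apply: filterS fM => x fM Dx; rewrite -EFinM lee_fin -exprMn.
  by rewrite ler_sqr_norm normrM (le_trans (fM Dx))// ler_wpM2r// ler_norm.
Qed.

End square_integrals.

Section joint_measurability.
Context {R : realType} {d : measure_display} {T : measurableType d}.
Variables (P : probability T R).
Notation mu := (@lebesgue_measure R).

(** Made an instance below, so that [filterS] and its variants apply to properties holding almost
    everywhere for the product measure. *)
Lemma ae_product_filter : Filter (nbhs (almost_everywhere (mu \x P)%E)).
Proof. exact: (ae_filter_ringOfSetsType (mu \x P)%E). Qed.

Definition time_slab (S : R) : set (R * T) := `[0, S] `*` setT.

(** Measurability is asked on bounded slabs because progressive measurability speaks of bounded time
    intervals only. *)
Definition jointly_measurable (S : R) (f : R -> T -> R) :=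
  measurable_fun (time_slab S) (fun p => f p.1 p.2).

Lemma measurable_time_slab S : measurable (time_slab S).
Proof. by apply: measurableX. Qed.
Hint Resolve measurable_time_slab : core.

Lemma jointly_measurable_restrict S f : jointly_measurable S f ->
  measurable_fun setT ((fun p : R * T => (f p.1 p.2)%:E) \_ (time_slab S)).
Proof.
move=> mf; apply/(measurable_restrictT _ _).1 => //.
exact/measurable_EFinP.
Qed.

Lemma time_slab_patch S (f : R -> T -> R) t w :
  ((fun p : R * T => (f p.1 p.2)%:E) \_ (time_slab S)) (t, w) =
  ((fun t => (f t w)%:E) \_ `[0, S]) t.
Proof.
rewrite /patch; congr (if _ then _ else _).
apply/idP/idP; rewrite !inE; first by case.
by move=> ?; split.
Qed.

(** Tonelli, with the integrand extended by zero outside the slab so that the theorem on the full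
    product space applies. *)
Lemma expected_integralE S f : jointly_measurable S f ->
    (forall t w, 0 <= t <= S -> 0 <= f t w) ->
  (expected_integral P S f =
   \int[mu \x P]_(p in time_slab S) (f p.1 p.2)%:E)%E.
Proof.
move=> mf f0; rewrite integral_mkcond fubini_tonelli2/=; last 2 first.
- exact: jointly_measurable_restrict.
- move=> -[t w]; rewrite time_slab_patch /patch; case: ifPn => //.
  by rewrite inE/= in_itv/= lee_fin => /f0.
rewrite /expected_integral; apply: eq_integral => w _.
rewrite integral_mkcond /fubini_G; apply: eq_integral => t _.
by rewrite time_slab_patch.
Qed.

Lemma expected_integral_swap S f : jointly_measurable S f ->
    (forall t w, 0 <= t <= S -> 0 <= f t w) ->
  (expected_integral P S f =
   \int[mu]_(t in `[0%R, S]) \int[P]_w (f t w)%:E)%E.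
Proof.
move=> mf f0; rewrite expected_integralE//.
rewrite integral_mkcond fubini_tonelli1/=; last 2 first.
- exact: jointly_measurable_restrict.
- move=> -[t w]; rewrite time_slab_patch /patch; case: ifPn => //.
  by rewrite inE/= in_itv/= lee_fin => /f0.
rewrite [RHS]integral_mkcond; apply: eq_integral => t _.
rewrite /fubini_F [in RHS]/patch; case: ifPn => tS.
  by apply: eq_integral => w _; rewrite time_slab_patch /patch tS.
by apply: integral0_eq => w _; rewrite time_slab_patch /patch (negbTE tS).
Qed.

Lemma measurable_expectation_time S f : jointly_measurable S f ->
    (forall t w, 0 <= t <= S -> 0 <= f t w) ->
  measurable_fun `[0, S] (fun t => \int[P]_w (f t w)%:E)%E.
Proof.
move=> mf f0.
have : measurable_fun setT (fubini_F P ((fun p : R * T => (f p.1 p.2)%:E) \_ (time_slab S))).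
  apply: measurable_fun_fubini_tonelli_F; first exact: jointly_measurable_restrict.
  move=> -[t w]; rewrite time_slab_patch /patch; case: ifPn => //.
  by rewrite inE/= in_itv/= lee_fin => /f0.
move=> /(measurable_funS measurableT (@subsetT _ `[0, S])).
apply: eq_measurable_fun => t tS; apply: eq_integral => w _.
by rewrite time_slab_patch /patch tS.
Qed.

Lemma jointly_measurable_slice S f t : 0 <= t <= S -> jointly_measurable S f ->
  measurable_fun setT (f t).
Proof.
move=> tS mf; have -> : f t = (fun p : R * T => f p.1 p.2) \o (fun w => (t, w)) by [].
apply: (measurable_comp (measurable_time_slab S)) => //.
  by move=> _ [w _ <-]; split.
exact: pair1_measurable.
Qed.

Lemma jointly_measurable_section S (f : R -> T -> R) w : jointly_measurable S f ->
  measurable_fun `[0, S] (f^~ w).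
Proof.
move=> mf; have -> : f^~ w = (fun p : R * T => f p.1 p.2) \o (fun t => (t, w)) by [].
apply: (measurable_comp (measurable_time_slab S)) => //.
  by move=> _ [t tS <-]; split.
by apply: measurable_funTS; exact: pair2_measurable.
Qed.

End joint_measurability.
#[global] Hint Resolve measurable_time_slab : core.
#[global] Existing Instance ae_product_filter.

Section elementary_sums.
Context {R : realType} {d : measure_display} {T : measurableType d}.
Variables (P : probability T R) (W : R -> T -> R) (G : R -> set (set T)).
Hypothesis Wb : brownian_wrt P W G.
Notation mu := (@lebesgue_measure R).
Notation kappa := (@normal_variance_unit R).

(* [(a, b, y)] stands for the process [y 1_(]a, b])]; overlaps are allowed, so
   that elementary processes add up by concatenation. *)
Definition elementary : Type := (R * R * (T -> R))%type.

Definition elem_fun (L : seq elementary) (t : R) (w : T) : R :=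
  \sum_(e <- L) e.2 w * \1_(`]e.1.1, e.1.2]) t.

Definition elem_integral (L : seq elementary) (w : T) : R :=
  \sum_(e <- L) e.2 w * (W e.1.2 w - W e.1.1 w).

Definition elem_adapted1 (S : R) (e : elementary) :=
  [/\ 0 <= e.1.1, e.1.1 <= e.1.2, e.1.2 <= S & bounded_adapted G e.1.1 e.2].

Fixpoint elem_adapted (S : R) (L : seq elementary) : Prop :=
  if L is e :: L' then elem_adapted1 S e /\ elem_adapted S L' else True.

Lemma elem_adapted_cat S L L' : elem_adapted S L -> elem_adapted S L' ->
  elem_adapted S (L ++ L').
Proof. by elim: L => //= e L IH [? ?] ?; split => //; exact: IH. Qed.

Lemma elem_fun_cat L L' t w : elem_fun (L ++ L') t w = elem_fun L t w + elem_fun L' t w.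
Proof. by rewrite /elem_fun big_cat. Qed.

Lemma elem_integral_cat L L' w :
  elem_integral (L ++ L') w = elem_integral L w + elem_integral L' w.
Proof. by rewrite /elem_integral big_cat. Qed.

(** Multiplication by a bounded variable known at time zero keeps every piece adapted; this is the
    mechanism by which the truncated initial difference passes through stochastic integrals. *)
Definition elem_scale (z : T -> R) (L : seq elementary) : seq elementary :=
  [seq (e.1, fun w => z w * e.2 w) | e <- L].

Lemma elem_fun_scale z L t w : elem_fun (elem_scale z L) t w = z w * elem_fun L t w.
Proof.
by rewrite /elem_fun big_map big_distrr/=; apply: eq_bigr => e _; rewrite mulrA.
Qed.

Lemma elem_integral_scale z L w :
  elem_integral (elem_scale z L) w = z w * elem_integral L w.
Proof.
by rewrite /elem_integral big_map big_distrr/=; apply: eq_bigr => e _; rewrite mulrA.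
Qed.

Lemma elem_adapted_scale S z L : bounded_adapted G 0 z -> elem_adapted S L ->
  elem_adapted S (elem_scale z L).
Proof.
move=> zb; elim: L => //= e L IH [[a0 ab bS ya] /IH ?]; split => //; split => //=.
exact: (bounded_adaptedM Wb (lexx 0) a0 zb ya).
Qed.

Lemma measurable_elem_integral S L : elem_adapted S L ->
  measurable_fun setT (elem_integral L).
Proof.
rewrite /elem_integral; elim: L => [|e L IH] /=.
  by move=> _; under eq_fun do rewrite big_nil; exact: measurable_cst.
move=> [[a0 ab bS [Gy _]] /IH mL]; under eq_fun do rewrite big_cons.
apply: measurable_funD => //; apply: measurable_funM.
  exact: (sys_measurable_fun Wb a0 Gy).
exact: (measurable_increment Wb).
Qed.

Lemma jointly_measurable_elem_fun S S' L : elem_adapted S L ->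
  jointly_measurable S' (elem_fun L).
Proof.
rewrite /elem_fun /jointly_measurable; elim: L => [|e L IH] /=.
  by move=> _; under eq_fun do rewrite big_nil; exact: measurable_cst.
move=> [[a0 ab bS [Gy _]] /IH mL]; under eq_fun do rewrite big_cons.
apply: measurable_funD => //; apply: measurable_funM; apply: measurable_funTS.
  exact: measurableT_comp (sys_measurable_fun Wb a0 Gy) measurable_snd.
apply: (measurableT_comp _ measurable_fst).
exact: (measurable_indic (U := `]e.1.1, e.1.2]%classic)).
Qed.

(** Stated for an arbitrary measure because it serves in two ways in the isometry: over time at a
    fixed sample point, and over the probability space. *)
Lemma has_integral_sum2 (d' : measure_display) (X : measurableType d')
    (m : {measure set X -> \bar R}) (D : set X) (mD : measurable D) (S : R)
    (f : elementary -> elementary -> X -> R) (v : elementary -> elementary -> R)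
    (L L' : seq elementary) :
  (forall e e', elem_adapted1 S e -> elem_adapted1 S e' ->
    has_integral m D (f e e') (v e e')) ->
  elem_adapted S L -> elem_adapted S L' ->
  has_integral m D (fun x => \sum_(e <- L) \sum_(e' <- L') f e e' x)
    (\sum_(e <- L) \sum_(e' <- L') v e e').
Proof.
move=> fv; elim: L => [|e L IH] /=.
  move=> _ _; rewrite big_nil; under eq_fun do rewrite big_nil.
  exact: has_integral0.
move=> [ea /IH {}IH] L'a; rewrite big_cons; under eq_fun do rewrite big_cons.
apply: has_integralD => //; last exact: IH.
move: L'a {IH}; elim: L' => [|e' L' IH'] /=.
  move=> _; rewrite big_nil; under eq_fun do rewrite big_nil.
  exact: has_integral0.
move=> [e'a /IH' {}IH']; rewrite big_cons; under eq_fun do rewrite big_cons.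
by apply: has_integralD => //; exact: fv.
Qed.

Let ov (e e' : elementary) := overlap e.1.1 e.1.2 e'.1.1 e'.1.2.

Let v (e e' : elementary) : R := ov e e' * fine (\int[P]_w (e.2 w * e'.2 w)%:E)%E.

Let has_integral_mul S e e' : elem_adapted1 S e -> elem_adapted1 S e' ->
  has_integral P setT (fun w => e.2 w * e'.2 w) (fine (\int[P]_w (e.2 w * e'.2 w)%:E)%E).
Proof.
move=> [a0 ab bS [Gy [M yM]]] [a'0 ab' bS' [Gy' [M' yM']]].
have i : P.-integrable setT (fun w => (e.2 w * e'.2 w)%:E).
  apply: integrable_bounded_mul yM _; first exact: (sys_measurable_fun Wb a0 Gy).
  apply: integrable_bounded yM'; exact: (sys_measurable_fun Wb a'0 Gy').
by split => //; rewrite fineK// integrable_fin_num.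
Qed.

Let has_integral_indic_overlap S e e' : elem_adapted1 S e ->
  has_integral mu `[0, S]%classic (\1_(`]e.1.1, e.1.2] `&` `]e'.1.1, e'.1.2])) (ov e e').
Proof.
move=> [a0 ab bS _]; set A := _ `&` _.
have mA : measurable A by exact: measurableI.
have muA : (mu A < +oo)%E.
  apply: (@le_lt_trans _ _ (mu `]e.1.1, e.1.2])); first by apply: le_measure; rewrite ?inE//; exact: subIsetl.
  by rewrite lebesgue_measure_itv/=; case: ifP; rewrite // -EFinB ltry.
split.
  apply: (@integrableS _ _ _ mu setT) => //.
  apply/integrableP; split; first exact/measurable_EFinP.
  under eq_integral do rewrite /= ger0_norm//.
  by rewrite integral_indic// setIT.
rewrite integral_indic//; have -> : A `&` `[0, S] = A.
  apply/setIidPl => t [/= + _]; rewrite !in_itv/= => /andP[at' tb].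
  by rewrite (le_trans a0 (ltW at')) (le_trans tb bS).
by rewrite /ov /overlap fineK// ge0_fin_numE.
Qed.

(** Both sides expand into the same double sum over pairs of pieces, with terms kappa times overlap
    times E(y y'). On the left this is [expectation_increments]; on the right the overlap is the
    time integral of a product of two indicators. *)
Lemma elem_isometry S L : elem_adapted S L ->
  (\int[P]_w (elem_integral L w ^+ 2)%:E =
   kappa%:E * expected_integral P S (fun t w => (elem_fun L t w ^+ 2)%R))%E.
Proof.
move=> La.
have time w : (\int[mu]_(t in `[0%R, S]) (elem_fun L t w ^+ 2)%:E =
    (\sum_(e <- L) \sum_(e' <- L) ov e e' * (e.2 w * e'.2 w))%R%:E)%E.
  have := @has_integral_sum2 _ _ mu `[0, S]%classic (measurable_itv _) S
    (fun e e' t => e.2 w * \1_(`]e.1.1, e.1.2]) t * (e'.2 w * \1_(`]e'.1.1, e'.1.2]) t))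
    (fun e e' => ov e e' * (e.2 w * e'.2 w)) L L.
  case=> //.
    move=> e e' ea _; rewrite [X in has_integral _ _ _ X]mulrC.
    have -> : (fun t => e.2 w * \1_(`]e.1.1, e.1.2]) t * (e'.2 w * \1_(`]e'.1.1, e'.1.2]) t)) =
        (fun t => e.2 w * e'.2 w * \1_(`]e.1.1, e.1.2] `&` `]e'.1.1, e'.1.2]) t).
      by apply/funext => t; rewrite mulrACA indicI.
    apply: has_integralZ; first exact: measurable_itv.
    exact: has_integral_indic_overlap.
  by move=> _ <-; apply: eq_integral => t _; rewrite /elem_fun expr2 big_distrlr.
rewrite /expected_integral; under [X in (_ * X)%E]eq_integral do rewrite time.
have [_ ->] := @has_integral_sum2 _ _ P setT measurableT S
  (fun e e' w => ov e e' * (e.2 w * e'.2 w)) v L L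
  (fun e e' ea e'a => has_integralZ measurableT (ov e e') (has_integral_mul ea e'a)) La La.
have [|_ e] := @has_integral_sum2 _ _ P setT measurableT S
  (fun e e' w => e.2 w * (W e.1.2 w - W e.1.1 w) * (e'.2 w * (W e'.1.2 w - W e'.1.1 w)))
  (fun e e' => kappa * v e e') L L _ La La.
  move=> e e' ea e'a; have [_ E] := has_integral_mul ea e'a.
  case: ea e'a => [a0 ab bS ya] [a'0 ab' bS' ya'].
  have [i ee] := expectation_increments Wb a0 ab a'0 ab' ya ya'.
  by split => //; rewrite ee -/(ov e e') E -EFinM mulrA.
rewrite -EFinM big_distrr/=; under [in RHS]eq_bigr do rewrite big_distrr/=.
by rewrite -e; apply: eq_integral => w _; rewrite /elem_integral expr2 big_distrlr.
Qed.

End elementary_sums.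

(** * Stochastic integrals as L^2 limits *)

Section ereal_limits.
Context {R : realType}.
Local Open Scope ereal_scope.

Lemma cvge0_squeeze (u v : nat -> \bar R) : (forall k, 0 <= u k <= v k) ->
  v @ \oo --> 0 -> u @ \oo --> 0.
Proof.
move=> uv v0; apply: (@squeeze_cvge _ _ _ _ (cst 0) _ v) => //; last exact: cvg_cst.
exact: nearW.
Qed.

Lemma cvge0_comb (a b : R) (u v : nat -> \bar R) : u @ \oo --> 0 -> v @ \oo --> 0 ->
  (fun k => a%:E * u k + b%:E * v k) @ \oo --> 0.
Proof.
move=> u0 v0.
have : (fun k => a%:E * u k + b%:E * v k) @ \oo --> a%:E * 0 + b%:E * 0.
  by apply: cvgeD; [rewrite !mule0|exact: cvgeZl|exact: cvgeZl].
by rewrite !mule0 adde0.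
Qed.

Lemma le_cvge0 (x c : \bar R) (u : nat -> \bar R) : u @ \oo --> 0 ->
  (forall k, x <= u k + c) -> x <= c.
Proof.
move=> u0 xu; apply/lee_addgt0Pr => e e0.
have : \forall k \near \oo, u k < e%:E.
  move: u0 => /fine_cvgP[fu /cvgr0_norm_lt u0].
  near=> k; rewrite -(fineK (_ : u k \is a fin_num)); last by near: k.
  rewrite lte_fin (le_lt_trans (ler_norm _))//; near: k.
  exact: u0.
move=> [k _ /(_ k (leqnn k)) /= uke].
by apply: (le_trans (xu k)); rewrite addeC leeD2l// ltW.
Unshelve. all: by end_near.
Qed.

End ereal_limits.

Section ito_class.
Context {R : realType} {d : measure_display} {T : measurableType d}.
Variables (P : probability T R) (W : R -> T -> R) (G : R -> set (set T)).
Hypothesis Wb : brownian_wrt P W G.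
Notation mu := (@lebesgue_measure R).
Notation kappa := (@normal_variance_unit R).

(* [is_ito_integral] with overlapping elementary processes allowed, which makes
   the class closed under sums. *)
Definition ito_limit (S : R) (g : R -> T -> R) (I : T -> R) : Prop :=
  measurable_fun setT I /\ exists L : nat -> seq elementary,
  [/\ forall k, elem_adapted G S (L k),
      (fun k => expected_integral P S (fun t w => (elem_fun (L k) t w - g t w) ^+ 2))
        @ \oo --> 0%E &
      (fun k => \int[P]_w ((elem_integral W (L k) w - I w) ^+ 2)%:E)%E
        @ \oo --> 0%E].

Lemma expected_integral_sqrE S f : jointly_measurable S f ->
  (expected_integral P S (fun t w => (f t w ^+ 2)%R) =
   \int[mu \x P]_(p in time_slab S) (f p.1 p.2 ^+ 2)%:E)%E.
Proof.
move=> mf; rewrite expected_integralE//; first exact: measurable_funX.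
by move=> t w _; exact: sqr_ge0.
Qed.

Lemma expected_integral_sqr_ge0 S f :
  (0 <= expected_integral P S (fun t w => (f t w ^+ 2)%R))%E.
Proof.
by apply: integral_ge0 => w _; apply: integral_ge0 => t _; rewrite lee_fin sqr_ge0.
Qed.

Lemma le_expected_integral_sqrD S f g h : jointly_measurable S f ->
    jointly_measurable S g -> jointly_measurable S h ->
    (forall t w, f t w = g t w + h t w) ->
  (expected_integral P S (fun t w => (f t w ^+ 2)%R) <=
   2%:E * expected_integral P S (fun t w => (g t w ^+ 2)%R) +
   2%:E * expected_integral P S (fun t w => (h t w ^+ 2)%R))%E.
Proof.
move=> mf mg mh fgh; rewrite !expected_integral_sqrE//.
apply: le_integral_sqrD; [exact: measurable_time_slab|exact: mf|exact: mg|exact: mh|].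
by move=> p _; exact: fgh.
Qed.

Lemma ito_limitD S g h I J : jointly_measurable S g -> jointly_measurable S h ->
  ito_limit S g I -> ito_limit S h J ->
  ito_limit S (fun t w => g t w + h t w) (fun w => I w + J w).
Proof.
move=> mg mh [mI [K [Ka Kg KI]]] [mJ [L [La Lh LJ]]]; split.
  exact: measurable_funD.
exists (fun k => K k ++ L k); split.
- by move=> k; exact: elem_adapted_cat.
- apply: cvge0_squeeze (cvge0_comb 2 2 Kg Lh) => k.
  have mK := jointly_measurable_elem_fun Wb (S' := S) (Ka k).
  have mL := jointly_measurable_elem_fun Wb (S' := S) (La k).
  rewrite expected_integral_sqr_ge0 /=; apply: le_expected_integral_sqrD.
  + apply: measurable_funB; last exact: measurable_funD.
    exact: (jointly_measurable_elem_fun Wb (S' := S) (elem_adapted_cat (Ka k) (La k))).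
  + exact: measurable_funB.
  + exact: measurable_funB.
  + by move=> t w; rewrite elem_fun_cat; ring.
- apply: cvge0_squeeze (cvge0_comb 2 2 KI LJ) => k.
  have mK := measurable_elem_integral Wb (Ka k).
  have mL := measurable_elem_integral Wb (La k).
  rewrite integral_sqr_ge0 /=; apply: le_integral_sqrD => //.
  + apply: measurable_funB; last exact: measurable_funD.
    exact: (measurable_elem_integral Wb (elem_adapted_cat (Ka k) (La k))).
  + exact: measurable_funB.
  + exact: measurable_funB.
  + by move=> w _; rewrite elem_integral_cat; ring.
Qed.

Lemma ito_limitZ S g I z : bounded_adapted G 0 z -> jointly_measurable S g ->
  ito_limit S g I -> ito_limit S (fun t w => z w * g t w) (fun w => z w * I w).
Proof.
move=> zb mg [mI [K [Ka Kg KI]]].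
have [Gz [M zM]] := zb; have mz := sys_measurable_fun Wb (lexx 0) Gz.
have M0 : 0 <= M.
  (* The sample space is pointed, so the bound is attained by some |z w| from below and [M] cannot
     be negative. *)
  have [w _] : exists w : T, True by exists point.
  exact: le_trans (zM w).
have mz2 : jointly_measurable S (fun _ => z).
  by apply: measurable_funTS; exact: measurableT_comp mz measurable_snd.
split; first exact: measurable_funM.
exists (fun k => elem_scale z (K k)); split.
- by move=> k; exact: (elem_adapted_scale Wb).
- apply: cvge0_squeeze (cvge0_comb (M ^+ 2) 0 Kg Kg) => k.
  have mK := jointly_measurable_elem_fun Wb (S' := S) (Ka k).
  rewrite mul0e adde0 expected_integral_sqr_ge0 /= !expected_integral_sqrE.
  + apply: le_integral_sqrM; first exact: measurable_time_slab.
    * apply: measurable_funB; last exact: measurable_funM.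
      exact: (jointly_measurable_elem_fun Wb (S' := S) (elem_adapted_scale Wb zb (Ka k))).
    * exact: measurable_funB.
    * apply: aeW => p _; rewrite elem_fun_scale -mulrBr normrM ler_wpM2r//.
  + exact: measurable_funB.
  + apply: measurable_funB; last exact: measurable_funM.
    exact: (jointly_measurable_elem_fun Wb (S' := S) (elem_adapted_scale Wb zb (Ka k))).
- apply: cvge0_squeeze (cvge0_comb (M ^+ 2) 0 KI KI) => k.
  have mK := measurable_elem_integral Wb (Ka k).
  rewrite mul0e adde0 integral_sqr_ge0 /=.
  apply: le_integral_sqrM => //.
  + apply: measurable_funB; last exact: measurable_funM.
    exact: (measurable_elem_integral Wb (elem_adapted_scale Wb zb (Ka k))).
  + exact: measurable_funB.
  + by apply: aeW => w _; rewrite elem_integral_scale -mulrBr normrM ler_wpM2r.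
Qed.

Lemma ito_limit0 S : ito_limit S (fun _ _ => 0) (fun=> 0).
Proof.
split; first exact: measurable_cst.
exists (fun=> [::]); split => //.
- under eq_fun do rewrite /expected_integral.
  rewrite (_ : (fun _ => _) = cst 0%E); first exact: cvg_cst.
  apply/funext => k; apply: integral0_eq => w _; apply: integral0_eq => t _.
  by rewrite /elem_fun big_nil subrr expr0n.
- rewrite (_ : (fun _ => _) = cst 0%E); first exact: cvg_cst.
  apply/funext => k; apply: integral0_eq => w _.
  by rewrite /elem_integral big_nil subrr expr0n.
Qed.

(** The isometry holds along the elementary processes. Comparing [I] with their integrals, and them
    with [g], costs a factor 2 each time, hence 4 kappa; the errors tend to zero. A bound of this
    form is enough for the Gronwall argument. *)
Lemma le_ito_limit S g I : jointly_measurable S g -> ito_limit S g I ->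
  (\int[P]_w (I w ^+ 2)%:E <=
   (4 * kappa)%:E * expected_integral P S (fun t w => (g t w ^+ 2)%R))%E.
Proof.
move=> mg [mI [K [Ka Kg KI]]].
have k0 : (0 <= kappa%:E)%E by rewrite lee_fin normal_variance_unit_ge0.
apply: (le_cvge0 (cvge0_comb 2 (4 * kappa) KI Kg)) => k.
have mK := jointly_measurable_elem_fun Wb (S' := S) (Ka k).
have mKI := measurable_elem_integral Wb (Ka k).
have h1 : (\int[P]_w (I w ^+ 2)%:E <=
    2%:E * \int[P]_w ((elem_integral W (K k) w - I w) ^+ 2)%:E +
    2%:E * \int[P]_w (elem_integral W (K k) w ^+ 2)%:E)%E.
  have -> : (\int[P]_w ((elem_integral W (K k) w - I w) ^+ 2)%:E =
      \int[P]_w ((I w - elem_integral W (K k) w) ^+ 2)%:E)%E.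
    by apply: eq_integral => w _; congr EFin; ring.
  apply: le_integral_sqrD => //; first exact: measurable_funB.
  by move=> w _; ring.
have h2 : (expected_integral P S (fun t w => (elem_fun (K k) t w ^+ 2)%R) <=
    2%:E * expected_integral P S (fun t w => ((elem_fun (K k) t w - g t w) ^+ 2)%R) +
    2%:E * expected_integral P S (fun t w => (g t w ^+ 2)%R))%E.
  apply: le_expected_integral_sqrD => //; first exact: measurable_funB.
  by move=> t w; ring.
apply: (le_trans h1); rewrite (elem_isometry Wb (Ka k)) -addeA; apply: leeD2l.
apply: (@le_trans _ _ (2%:E * (kappa%:E *
  (2%:E * expected_integral P S (fun t w => ((elem_fun (K k) t w - g t w) ^+ 2)%R) +
    2%:E * expected_integral P S (fun t w => (g t w ^+ 2)%R))))%E).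
  by rewrite lee_pmul2l// lee_wpmul2l.
rewrite -ge0_muleDr ?mule_ge0 ?expected_integral_sqr_ge0//.
rewrite -muleDr ?ge0_adde_def ?inE ?expected_integral_sqr_ge0//.
by rewrite !muleA -!EFinM (_ : 2 * kappa * 2 = 4 * kappa)//; ring.
Qed.

(** Adaptedness to a smaller filtration implies adaptedness to [G], and the consecutive intervals
    become a list of pieces. In this way equations posed on different filtrations are brought to a
    common one. *)
Lemma ito_limit_is_ito (FF : R -> set (set T)) S g I :
    (forall t, 0 <= t -> FF t `<=` G t) ->
  is_ito_integral P W FF S g I -> ito_limit S g I.
Proof.
move=> FG [mI [K [Ka Kg KI]]]; split => //.
pose L k : seq elementary := [seq (sp_time (K k) i, sp_time (K k) i.+1, sp_val (K k) i)
  | i <- index_iota 0 (sp_size (K k))].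
have LE k t w : elem_fun (L k) t w = sp_fun (K k) t w.
  by rewrite /elem_fun big_map big_mkord.
have LI k w : elem_integral W (L k) w = sp_integral W (K k) w.
  by rewrite /elem_integral big_map big_mkord.
exists L; split; last 2 first.
- by under eq_fun do under [X in expected_integral _ _ X]eq_fun do
     under eq_fun do rewrite LE.
- by under eq_fun do under eq_integral do rewrite LI.
move=> k; have [time_in time_nd adapt bnd] := Ka k; rewrite /L.
have : forall i, i \in index_iota 0 (sp_size (K k)) -> (i < sp_size (K k))%N.
  by move=> i; rewrite mem_index_iota.
elim: (index_iota _ _) => //= i s IH sub; split; last first.
  by apply: IH => j js; apply: sub; rewrite inE js orbT.
have iK := sub i (mem_head _ _).
have /andP[i0 _] := time_in i (ltnW iK); have /andP[_ iS] := time_in i.+1 iK.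
split => //=; first exact: time_nd.
split; last exact: bnd.
by move=> U mU; apply: (FG _ i0); exact: adapt.
Qed.

End ito_class.

(** * Mean-square estimate for linear equations *)

Section gronwall.
Context {R : realType}.
Notation mu := (@lebesgue_measure R).
Local Open Scope ereal_scope.

(** A version for functions that are only measurable: [[0, S]] is cut into steps so short that the
    integral at the end of a step can be absorbed into the left-hand side. [K] depends on [L] and
    [S] only, so it is uniform over the functions to which it is applied. *)
Lemma gronwall (L S : R) : (0 <= L)%R -> (0 <= S)%R -> exists2 K : R, (0 <= K)%R &
  forall (f : R -> \bar R) (a : R), (0 <= a)%R -> measurable_fun `[0%R, S] f ->
    (forall t, (0 <= t <= S)%R -> 0 <= f t) ->
    \int[mu]_(t in `[0%R, S]) f t < +oo ->
    (forall t, (0 <= t <= S)%R -> f t <= a%:E + L%:E * \int[mu]_(s in `[0%R, t]) f s) ->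
  forall t, (0 <= t <= S)%R -> f t <= (K * a)%:E.
Proof.
move=> L0 S0; pose N := (Num.bound (2 * (L * S))).+1.
have LSN : (2 * (L * S) <= N%:R)%R.
  have LS0 : (0 <= 2 * (L * S))%R by rewrite !mulr_ge0.
  by apply: (le_trans (ltW (archi_boundP LS0))); rewrite ler_nat.
pose dl : R := (S / N%:R)%R.
have N0 : (0 < N%:R :> R)%R by rewrite ltr0n.
have dl0 : (0 <= dl)%R by rewrite divr_ge0// ltW.
have Ldl : (2 * (L * dl) <= 1)%R by rewrite /dl !mulrA ler_pdivrMr// mul1r -mulrA.
have dlN : (N%:R * dl = S)%R by rewrite /dl mulrCA divff ?mulr1// gt_eqF.
(* The solution of c_(k+1) = 2 c_k + 2 dl with c_0 = 0, the recursion produced by one step. *)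
pose c (k : nat) : R := (2 * dl * (2 ^+ k - 1))%R.
have c0 k : (0 <= c k)%R by rewrite /c !mulr_ge0// subr_ge0 exprn_ege1// ler1n.
exists (1 + L * c N)%R; first by rewrite addr_ge0// mulr_ge0.
move=> f a a0 mf f0 foo fL.
pose F (r : R) := \int[mu]_(s in `[0%R, r]) f s.
have mfS r : (r <= S)%R -> measurable_fun `[0%R, r] f.
  move=> rS; apply: measurable_funS mf => //; apply: subset_itvl.
  by rewrite bnd_simp.
have F0 r : (r <= S)%R -> 0 <= F r.
  move=> rS; apply: integral_ge0 => s /=; rewrite in_itv/= => /andP[s0 sr].
  by apply: f0; rewrite s0 (le_trans sr).
have Fle r r' : (r <= r')%R -> (r' <= S)%R -> F r <= F r'.
  move=> rr' r'S; apply: ge0_subset_integral => //; first exact: mfS.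
    move=> s /=; rewrite in_itv/= => /andP[s0 sr].
    by apply: f0; rewrite s0 (le_trans sr).
  by apply: subset_itvl; rewrite bnd_simp.
(* Absorbing the integral at the end of a step into the left-hand side requires it to be finite. *)
have Ffin r : (r <= S)%R -> F r \is a fin_num.
  by move=> rS; rewrite ge0_fin_numE ?F0//; apply: le_lt_trans foo; exact: Fle.
have step r : (0 <= r)%R -> (r + dl <= S)%R ->
    F (r + dl)%R <= F r + (a%:E + L%:E * F (r + dl)%R) * dl%:E.
  move=> r0 rS.
  have rS' : (r <= S)%R by apply: le_trans rS; rewrite lerDl.
  have split_itv : `[0%R, (r + dl)%R]%classic = `[0%R, r] `|` `]r, (r + dl)%R].
    apply/seteqP; split => s /=; rewrite !in_itv/=.
      by move=> /andP[s0 sr]; case: (leP s r) => h; [left|right]; rewrite ?s0.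
    case=> /andP[s0 sr]; first by rewrite s0 (le_trans sr)// lerDl.
    by rewrite sr (le_trans r0 (ltW s0)).
  rewrite {1}/F split_itv ge0_integral_setU//; last 3 first.
  - by rewrite -split_itv; exact: mfS.
  - by move=> s; rewrite -split_itv /= in_itv/= => /andP[s0 sr]; apply: f0; rewrite s0 (le_trans sr).
  - apply/disj_setPS => s [] /=; rewrite !in_itv/= => /andP[_ sr] /andP[rs _].
    by move: (lt_le_trans rs sr); rewrite ltxx.
  apply: leeD2l.
  apply: (@le_trans _ _ (\int[mu]_(s in `]r, (r + dl)%R]) (cst (a%:E + L%:E * F (r + dl)%R)) s)).
    apply: ge0_le_integral => //.
    - move=> s /=; rewrite in_itv/= => /andP[s0 sr]; apply: f0.
      by rewrite (le_trans r0 (ltW s0)) (le_trans sr).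
    - apply: measurable_funS (mfS _ rS) => //.
      by rewrite split_itv; exact: subsetUr.
    - move=> s /=; rewrite in_itv/= => /andP[s0 sr].
      have s0S : (0 <= s <= S)%R by rewrite (le_trans r0 (ltW s0)) (le_trans sr).
      apply: (le_trans (fL _ s0S)); apply: leeD2l; apply: lee_wpmul2l; rewrite ?lee_fin//.
      exact: Fle.
  rewrite integral_cst//= lebesgue_measure_itv/= lte_fin ltrDl; case: ifP => h.
    by rewrite -EFinB (_ : (r + dl - r = dl)%R) ?lexx//; ring.
  by rewrite mule0 mule_ge0// ?lee_fin// adde_ge0 ?lee_fin// mule_ge0 ?lee_fin ?F0.
(* 2 L dl <= 1, so each step at most doubles F and adds 2 dl a. *)
have bnd (k : nat) : (k <= N)%N -> F (k%:R * dl)%R <= (c k * a)%:E.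
  elim: k => [_|k IH kN].
    by rewrite mul0r /F set_itv1 integral_set1 /c expr0 subrr mulr0 mul0r.
  have kS (j : nat) : (j <= N)%N -> (j%:R * dl <= S)%R.
    by move=> jN; rewrite -dlN ler_wpM2r// ler_nat.
  have kS' : (k%:R * dl + dl <= S)%R by have := kS _ kN; rewrite -natr1 mulrDl mul1r.
  rewrite -natr1 mulrDl mul1r.
  have := step _ (mulr_ge0 (ler0n _ k) dl0) kS'.
  move: (IH (ltnW kN)) (Ffin _ (kS _ (ltnW kN))) (Ffin _ kS') (F0 _ kS').
  case: (F (k%:R * dl + dl)%R) => [y| |]//; case: (F (k%:R * dl)%R) => [x| |]// + _ _.
  rewrite -!(EFinM, EFinD) !lee_fin => xc y0 yx.
  rewrite /c exprS; move: xc; rewrite /c; set p := (2 ^+ k)%R => xc.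
  have : (L * y * dl <= y / 2)%R.
    have : (y * (2 * (L * dl)) <= y * 1)%R by rewrite ler_wpM2l.
    by lra.
  by lra.
move=> t tS; apply: (le_trans (fL _ tS)).
have [t0 tS'] := andP tS.
have : F t <= (c N * a)%:E.
  by apply: le_trans (bnd _ (leqnn N)); rewrite dlN; exact: Fle.
move=> Fc; rewrite mulrDl mul1r EFinD; apply: leeD2l.
rewrite -mulrA EFinM; apply: lee_wpmul2l => //; by rewrite lee_fin.
Qed.

(** Cauchy-Schwarz, from the nonnegative integral of (g - m)^2 with m the mean of g over [[0, t]].
    If t is positive and g^2 is not integrable, the right-hand side is +oo. *)
Lemma Rintegral_sqr_le (t : R) (g : R -> R) : (0 <= t)%R ->
    measurable_fun `[0%R, t] g ->
  ((\int[mu]_(s in `[0, t]) g s)%R ^+ 2)%:E <=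
  t%:E * \int[mu]_(s in `[0%R, t]) (g s ^+ 2)%:E.
Proof.
rewrite le_eqVlt => /predU1P[<-|t0] mg.
  by rewrite set_itv1 Rintegral_set1 expr0n mul0e.
have g2 : 0 <= \int[mu]_(s in `[0%R, t]) (g s ^+ 2)%:E by exact: integral_sqr_ge0.
have [|goo] := leP +oo (\int[mu]_(s in `[0%R, t]) (g s ^+ 2)%:E).
  by rewrite leye_eq => /eqP ->; rewrite gt0_muley ?lte_fin// leey.
have mut : mu `[0%R, t] = t%:E by rewrite lebesgue_measure_itv/= lte_fin t0 sube0.
have ci r : mu.-integrable `[0%R, t] (EFin \o cst r).
  apply: measurable_bounded_integrable => //=; first by rewrite mut ltry.
  exact: bounded_cst.
have ig2 : mu.-integrable `[0%R, t] (fun s => (g s ^+ 2)%:E).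
  apply/integrableP; split; first exact: measurable_sqr_EFin.
  by under eq_integral do rewrite gee0_abs ?lee_fin ?sqr_ge0//.
have ig : mu.-integrable `[0%R, t] (fun s => (g s)%:E).
  have ih : mu.-integrable `[0%R, t] (fun s => (1 + g s ^+ 2)%:E).
    by apply: integrable_addr => //; exact: ci.
  apply: le_integrable ih => //.
  - exact/measurable_EFinP.
  - move=> s _; rewrite /= lee_fin [leRHS]ger0_norm; last by have := sqr_ge0 (g s); lra.
    have := sqr_ge0 (`|g s| - 1)%R; have := sqr_ge0 (g s).
    by rewrite sqrrB real_normK ?num_real// => ? ?; have := normr_ge0 (g s); lra.
set v := Rintegral _ _ _.
have gv : \int[mu]_(s in `[0%R, t]) (g s)%:E = v%:E.
  by rewrite /v /Rintegral fineK// integrable_fin_num.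
pose m := (v / t)%R.
have : 0 <= \int[mu]_(s in `[0%R, t]) ((g s ^+ 2 + (- 2 * m) * g s) + m ^+ 2)%:E.
  apply: integral_ge0 => s _; rewrite lee_fin.
  by have := sqr_ge0 (g s - m)%R; rewrite sqrrB; lra.
rewrite integral_addr//; last 2 first.
- by apply: integrable_addr => //; exact: integrable_scaler.
- exact: (ci (m ^+ 2)%R).
rewrite integral_addr//; last exact: integrable_scaler.
have -> : \int[mu]_(s in `[0%R, t]) (m ^+ 2)%:E = (m ^+ 2 * t)%:E.
  by rewrite (integral_cst mu _ (m ^+ 2)%:E)// EFinM; congr (_ * _).
rewrite integral_scaler// gv.
move: g2 goo; case: (\int[mu]_(s in `[0%R, t]) (g s ^+ 2)%:E) => [x| |]// _ _.
rewrite -!(EFinM, EFinD) !lee_fin /m => h.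
have : (0 <= (x + - 2 * (v / t) * v + (v / t) ^+ 2 * t) * t)%R by rewrite mulr_ge0// ltW.
rewrite (_ : (_ * t = x * t - v ^+ 2)%R); last by field; rewrite gt_eqF.
by rewrite subr_ge0 mulrC.
Qed.

End gronwall.

Section vector_square.
Context {R : realType}.

Definition vsq (n : nat) (y : 'cV[R]_n) : R := \sum_i y i 0 ^+ 2.

Lemma vsq_ge0 n (y : 'cV[R]_n) : 0 <= vsq y.
Proof. by apply: sumr_ge0 => i _; exact: sqr_ge0. Qed.

Lemma sqr_sum_le (n : nat) (a : 'I_n -> R) :
  (\sum_i a i) ^+ 2 <= n%:R * \sum_i a i ^+ 2.
Proof.
rewrite expr2 big_distrlr /=.
apply: (@le_trans _ _ (\sum_i \sum_j (a i ^+ 2 / 2 + a j ^+ 2 / 2))).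
  by apply: ler_sum => i _; apply: ler_sum => j _; have := sqr_ge0 (a i - a j); nra.
set s := \sum_i a i ^+ 2.
rewrite (_ : \sum_i \sum_j _ = \sum_(i < n) (n%:R * (a i ^+ 2 / 2) + s / 2)); last first.
  apply: eq_bigr => i _.
  by rewrite big_split/= sumr_const card_ord -mulr_suml mulr_natl.
rewrite big_split/= -mulr_sumr -mulr_suml -/s sumr_const card_ord -mulr_natl.
by rewrite le_eqVlt; apply/orP; left; apply/eqP; field.
Qed.

Lemma mulmx_entry_sqr_le (k n : nat) (c : R) (M : 'M[R]_(k, n)) (y : 'cV[R]_n) i :
  (forall i j, `|M i j| <= c) -> (M *m y) i 0 ^+ 2 <= c ^+ 2 * n%:R * vsq y.
Proof.
move=> Mc; rewrite mxE; apply: (le_trans (sqr_sum_le _)).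
rewrite (mulrC (c ^+ 2)) -mulrA ler_wpM2l ?ler0n// /vsq mulr_sumr.
apply: ler_sum => j _; rewrite exprMn ler_wpM2r ?sqr_ge0//.
by rewrite ler_sqr_norm (le_trans (Mc i j))// ler_norm.
Qed.

End vector_square.

Section bounded_processes.
Context {R : realType} {d : measure_display} {T : measurableType d}.
Variable P : probability T R.
Notation mu := (@lebesgue_measure R).

Definition measurable_process (k l : nat) (f : R -> T -> 'M[R]_(k, l)) :=
  forall S i j, 0 <= S -> jointly_measurable S (fun t w => f t w i j).

(** Entrywise bounds for almost every pair of time and sample point. They say nothing at a fixed
    time, so they are applied only under integrals over both variables. *)
Definition bounded_process (c : R) (k l : nat) (f : R -> T -> 'M[R]_(k, l)) :=
  measurable_process f /\
  {ae (mu \x P)%E, forall p : R * T, 0 <= p.1 -> forall i j, `|f p.1 p.2 i j| <= c}.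

Lemma measurable_process_mul k l r (f : R -> T -> 'M[R]_(k, l))
    (g : R -> T -> 'M[R]_(l, r)) : measurable_process f -> measurable_process g ->
  measurable_process (fun t w => f t w *m g t w).
Proof.
move=> mf mg S i j S0; rewrite /jointly_measurable.
under eq_fun do rewrite mxE.
by apply: measurable_sum => h; apply: measurable_funM; [exact: mf|exact: mg].
Qed.

Lemma measurable_process_add k l (f g : R -> T -> 'M[R]_(k, l)) :
  measurable_process f -> measurable_process g ->
  measurable_process (fun t w => f t w + g t w).
Proof.
move=> mf mg S i j S0; rewrite /jointly_measurable.
under eq_fun do rewrite mxE.
by apply: measurable_funD; [exact: mf|exact: mg].
Qed.

Lemma measurable_process_sub k l (f g : R -> T -> 'M[R]_(k, l)) :
  measurable_process f -> measurable_process g ->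
  measurable_process (fun t w => f t w - g t w).
Proof.
move=> mf mg S i j S0; rewrite /jointly_measurable.
under eq_fun do rewrite !mxE.
by apply: measurable_funB; [exact: mf|exact: mg].
Qed.

Lemma jointly_measurable_vsq n (f : R -> T -> 'cV[R]_n) S : 0 <= S ->
  measurable_process f -> jointly_measurable S (fun t w => vsq (f t w)).
Proof.
by move=> S0 mf; apply: measurable_sum => i; apply: measurable_funX; exact: mf.
Qed.

Lemma measurable_time_integral S (f : R -> T -> R) : jointly_measurable S f ->
    (forall t w, 0 <= t <= S -> 0 <= f t w) ->
  measurable_fun setT (fun w => \int[mu]_(t in `[0%R, S]) (f t w)%:E)%E.
Proof.
move=> mf f0.
have : measurable_fun setT (fubini_G mu ((fun p : R * T => (f p.1 p.2)%:E) \_ (time_slab S))).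
  apply: measurable_fun_fubini_tonelli_G; first exact: jointly_measurable_restrict.
  move=> -[t w]; rewrite time_slab_patch /patch; case: ifPn => //.
  by rewrite inE/= in_itv/= lee_fin => /f0.
apply: eq_measurable_fun => w _; rewrite /fubini_G [RHS]integral_mkcond.
by apply: eq_integral => t _; rewrite time_slab_patch.
Qed.

Lemma le_expected_integral S (f g : R -> T -> R) : jointly_measurable S f ->
    jointly_measurable S g -> (forall t w, 0 <= t <= S -> 0 <= f t w) ->
    (forall t w, 0 <= t <= S -> 0 <= g t w) ->
    {ae (mu \x P)%E, forall p : R * T, 0 <= p.1 <= S -> f p.1 p.2 <= g p.1 p.2} ->
  (expected_integral P S f <= expected_integral P S g)%E.
Proof.
move=> mf mg f0 g0 fg; rewrite !expected_integralE//.
apply: ae_ge0_le_integral.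
- exact: measurable_time_slab.
- by move=> [t w] [/= + _]; rewrite in_itv/= lee_fin => /f0.
- exact/measurable_EFinP.
- by move=> [t w] [/= + _]; rewrite in_itv/= lee_fin => /g0.
- exact/measurable_EFinP.
- apply: filterS fg => -[t w] /= fg [/= + _].
  by rewrite in_itv/= lee_fin => /fg.
Qed.

Lemma expected_integralZ S (k : R) (f : R -> T -> R) : 0 <= k ->
    jointly_measurable S f -> (forall t w, 0 <= t <= S -> 0 <= f t w) ->
  (expected_integral P S (fun t w => (k * f t w)%R) = k%:E * expected_integral P S f)%E.
Proof.
move=> k0 mf f0; rewrite !expected_integralE//; last 2 first.
- by apply: measurable_funM.
- by move=> t w tS; rewrite mulr_ge0// f0.
rewrite -ge0_integralZl//; first exact: measurable_time_slab.
- exact/measurable_EFinP.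
- by move=> [t w] [/= + _]; rewrite in_itv/= lee_fin => /f0.
Qed.

End bounded_processes.

Section linear_estimate.
Context {R : realType} {d : measure_display} {T : measurableType d}.
Variables (P : probability T R) (W : R -> T -> R) (G : R -> set (set T)).
Hypothesis Wb : brownian_wrt P W G.
Notation mu := (@lebesgue_measure R).
Notation kappa := (@normal_variance_unit R).

(** The mean square of [Y t] is at most 3 times that of the initial value plus [L] times its own
    time integral, and Gronwall concludes. [K] is chosen before the coefficients and the solution,
    so one value serves a whole family of solutions. *)
Lemma linear_sde_estimate (n : nat) (c S : R) : 0 <= S ->
  exists2 K : R, 0 <= K &
  forall (M C : R -> T -> 'M[R]_n) (Y : R -> T -> 'cV[R]_n) (Y0 : T -> 'cV[R]_n),
    bounded_process P c M -> bounded_process P c C ->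
    measurable_process Y -> (forall i, measurable_fun setT (fun w => Y0 w i 0)) ->
    (expected_integral P S (fun t w => vsq (Y t w)) < +oo)%E ->
    (\int[P]_w (vsq (Y0 w))%:E < +oo)%E ->
    (forall t, 0 <= t <= S -> forall i, exists2 J : T -> R,
      ito_limit P W G t (fun s w => (C s w *m Y s w) i 0) J &
      {ae P, forall w, Y t w i 0 = Y0 w i 0 +
        \int[mu]_(s in `[0, t]) ((M s w *m Y s w) i 0) + J w}) ->
  forall t, 0 <= t <= S ->
    (\int[P]_w (vsq (Y t w))%:E <= K%:E * \int[P]_w (vsq (Y0 w))%:E)%E.
Proof.
move=> S0.
(* The 3 comes from squaring a sum of three terms. Cauchy-Schwarz in time contributes the factor [S]
   to the drift, and [le_ito_limit] the factor 4 kappa to the noise. The last factor bounds an entry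
   of a matrix product, and the outer n sums over the components. *)
pose L := n%:R * (3 * S + 12 * kappa) * (c ^+ 2 * n%:R).
have k0 : 0 <= kappa := normal_variance_unit_ge0.
have L0 : 0 <= L.
  rewrite /L; apply: mulr_ge0; last by apply: mulr_ge0; [exact: sqr_ge0|exact: ler0n].
  by apply: mulr_ge0; [exact: ler0n|apply: addr_ge0; apply: mulr_ge0].
have [K K0 gron] := gronwall L0 S0.
exists (K * 3); first by rewrite mulr_ge0.
move=> M C Y Y0 [mM Mc] [mC Cc] mY mY0 Yoo Y0oo eqY.
have vY0 S' t w : 0 <= t <= S' -> 0 <= vsq (Y t w) by move=> _; exact: vsq_ge0.
have mvY S' : 0 <= S' -> jointly_measurable S' (fun t w => vsq (Y t w)).
  by move=> S'0; exact: jointly_measurable_vsq.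
pose f t := (\int[P]_w (vsq (Y t w))%:E)%E.
have a0 : (0 <= \int[P]_w (vsq (Y0 w))%:E)%E.
  by apply: integral_ge0 => w _; rewrite lee_fin vsq_ge0.
have [a aE] : exists a, (\int[P]_w (vsq (Y0 w))%:E = a%:E)%E.
  by exists (fine (\int[P]_w (vsq (Y0 w))%:E)%E); rewrite fineK// ge0_fin_numE.
rewrite aE -EFinM -mulrA; apply: (gron f).
- by rewrite mulr_ge0// -lee_fin -aE.
- exact: measurable_expectation_time (mvY S S0) (vY0 S).
- by move=> t tS; apply: integral_ge0 => w _; rewrite lee_fin vsq_ge0.
- by rewrite -expected_integral_swap; [|exact: (mvY S S0)|exact: (vY0 S)].
move=> t tS; have [t0 tS'] := andP tS.
have mYt i : measurable_fun setT (fun w => Y t w i 0).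
  apply: (jointly_measurable_slice (S := t) (f := fun t w => Y t w i 0)) => //.
    by rewrite t0 lexx.
  exact: mY.
rewrite -expected_integral_swap; [|exact: (mvY t t0)|exact: (vY0 t)].
set E := expected_integral _ _ _.
have E0 : (0 <= E)%E.
  by apply: integral_ge0 => w _; apply: integral_ge0 => s _; rewrite lee_fin vsq_ge0.
have bnd (B : R -> T -> 'M[R]_n) i : bounded_process P c B ->
    (expected_integral P t (fun s w => ((B s w *m Y s w) i 0 ^+ 2)%R) <=
    (c ^+ 2 * n%:R)%:E * E)%E.
  move=> [mB Bc]; rewrite -expected_integralZ; [|by rewrite mulr_ge0 ?sqr_ge0|exact: (mvY t t0)|exact: (vY0 t)].
  apply: le_expected_integral.
  - by apply: measurable_funX; apply: (measurable_process_mul mB mY).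
  - by apply: measurable_funM => //; exact: (mvY t t0).
  - by move=> s w _; exact: sqr_ge0.
  - by move=> s w _; apply: mulr_ge0; [rewrite mulr_ge0 ?sqr_ge0|exact: vsq_ge0].
  - apply: filterS Bc => -[s w] /= Bc /andP[s0 _].
    by apply: mulmx_entry_sqr_le; exact: Bc.
have comp i : (\int[P]_w (Y t w i 0 ^+ 2)%:E <= 3%:E * \int[P]_w (Y0 w i 0 ^+ 2)%:E +
    ((3 * S + 12 * kappa) * (c ^+ 2 * n%:R))%:E * E)%E.
  have [J JI eqi] := eqY t tS i.
  have mJ : measurable_fun setT J by case: JI.
  have mMY : jointly_measurable t (fun s w => (M s w *m Y s w) i 0).
    exact: (measurable_process_mul mM mY).
  have mCY : jointly_measurable t (fun s w => (C s w *m Y s w) i 0).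
    exact: (measurable_process_mul mC mY).
  pose I2 w := (\int[mu]_(s in `[0%R, t]) ((M s w *m Y s w) i 0 ^+ 2)%:E)%E.
  have mI2 : measurable_fun setT I2.
    apply: (measurable_time_integral (f := fun s w => (M s w *m Y s w) i 0 ^+ 2)).
      exact: measurable_funX.
    by move=> s w _; exact: sqr_ge0.
  have I20 w : (0 <= I2 w)%E by exact: integral_sqr_ge0.
  have mZ (h : T -> R) : measurable_fun setT h ->
    measurable_fun setT (fun w => 3%:E * (h w ^+ 2)%:E)%E.
    by move=> mh; apply: emeasurable_funM => //; exact: measurable_sqr_EFin.
  have Z0 (h : T -> R) w : (0 <= 3%:E * (h w ^+ 2)%:E)%E.
    by rewrite -EFinM lee_fin mulr_ge0// sqr_ge0.
  have mI3 : measurable_fun setT (fun w => (3 * t)%:E * I2 w)%E by exact: emeasurable_funM.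
  have I30 w : (0 <= (3 * t)%:E * I2 w)%E by rewrite mule_ge0// lee_fin mulr_ge0.
  have Z12 w : (0 <= 3%:E * (Y0 w i 0 ^+ 2)%:E + (3 * t)%:E * I2 w)%E.
    by apply: adde_ge0; [exact: (Z0 (fun w => Y0 w i 0))|exact: I30].
  have m12 : measurable_fun setT (fun w => 3%:E * (Y0 w i 0 ^+ 2)%:E + (3 * t)%:E * I2 w)%E.
    by apply: emeasurable_funD => //; exact: (mZ (fun w => Y0 w i 0)).
  apply: (@le_trans _ _ (\int[P]_w (3%:E * (Y0 w i 0 ^+ 2)%:E + (3 * t)%:E * I2 w +
      3%:E * (J w ^+ 2)%:E))%E).
    apply: ae_ge0_le_integral => //.
    - by move=> w _; rewrite lee_fin sqr_ge0.
    - exact: measurable_sqr_EFin.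
    - by move=> w _; apply: adde_ge0; [exact: Z12|exact: Z0].
    - by apply: emeasurable_funD; [exact: m12|exact: mZ].
    - apply: filterS eqi => w -> _.
      have mMw : measurable_fun `[0, t] (fun s => (M s w *m Y s w) i 0).
        exact: jointly_measurable_section mMY.
      apply: (@le_trans _ _ (3%:E * (Y0 w i 0 ^+ 2)%:E +
        3%:E * ((\int[mu]_(s in `[0, t]) ((M s w *m Y s w) i 0)) ^+ 2)%:E +
        3%:E * (J w ^+ 2)%:E)%E).
        rewrite -!EFinM -!EFinD lee_fin.
        set x := Y0 w i 0; set y := Rintegral _ _ _; set z := J w.
        have := sqr_ge0 (x - y); have := sqr_ge0 (x - z); have := sqr_ge0 (y - z); nra.
      apply: leeD2r; apply: leeD2l.
      rewrite (_ : (3 * t)%:E * I2 w = 3%:E * (t%:E * I2 w))%E; last by rewrite muleA -EFinM.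
      apply: lee_wpmul2l; rewrite ?lee_fin//.
      exact: Rintegral_sqr_le.
  rewrite ge0_integralD//; last exact: mZ.
  rewrite ge0_integralD//; [|by move=> w _; exact: (Z0 (fun w => Y0 w i 0))|exact: (mZ (fun w => Y0 w i 0))].
  rewrite !ge0_integralZl//; try exact: measurable_sqr_EFin;
    try (by move=> w _; rewrite lee_fin sqr_ge0); try by rewrite lee_fin mulr_ge0.
  rewrite -addeA; apply: leeD2l.
  have h1 := bnd M i (conj mM Mc); have h2 := bnd C i (conj mC Cc).
  have h3 := le_ito_limit Wb mCY JI.
  have g0 : (0 <= (c ^+ 2 * n%:R)%:E * E)%E by rewrite mule_ge0// lee_fin mulr_ge0 ?sqr_ge0.
  rewrite (_ : ((3 * S + 12 * kappa) * (c ^+ 2 * n%:R))%:E * E =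
    (3 * S)%:E * ((c ^+ 2 * n%:R)%:E * E) + (12 * kappa)%:E * ((c ^+ 2 * n%:R)%:E * E))%E;
    last by rewrite EFinM -muleA EFinD ge0_muleDl ?lee_fin ?mulr_ge0.
  apply: leeD.
    apply: (@le_trans _ _ ((3 * t)%:E * ((c ^+ 2 * n%:R)%:E * E))%E).
      by apply: lee_wpmul2l h1; rewrite lee_fin mulr_ge0.
    by apply: lee_wpmul2r => //; rewrite lee_fin ler_wpM2l.
  rewrite (_ : 12 * kappa = 3 * (4 * kappa)); last by ring.
  rewrite [in leRHS]EFinM -[leRHS]muleA; apply: lee_wpmul2l; first by rewrite lee_fin.
  by apply: (le_trans h3); apply: lee_wpmul2l h2; rewrite lee_fin mulr_ge0.
have fE : f t = (\sum_i \int[P]_w (Y t w i 0 ^+ 2)%:E)%E.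
  rewrite /f; under eq_integral do rewrite -sumEFin.
  rewrite ge0_integral_sum//; first by move=> i; exact: measurable_sqr_EFin.
  by move=> i w _; rewrite lee_fin sqr_ge0.
have aS : a%:E = (\sum_i \int[P]_w (Y0 w i 0 ^+ 2)%:E)%E.
  rewrite -aE; under eq_integral do rewrite -sumEFin.
  rewrite ge0_integral_sum//; first by move=> i; exact: measurable_sqr_EFin.
  by move=> i w _; rewrite lee_fin sqr_ge0.
rewrite fE; apply: (le_trans (lee_sum _ (fun i _ => comp i))).
rewrite big_split/= -ge0_sume_distrr; last by move=> i _; exact: integral_sqr_ge0.
rewrite -aS EFinM; apply: leeD2l.
set r := ((3 * S + 12 * kappa) * (c ^+ 2 * n%:R)).
rewrite (eq_bigr (fun=> 1%:E * (r%:E * E))%E); last by move=> i _; rewrite mul1e.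
rewrite -ge0_sume_distrl// sumEFin sumr_const card_ord muleA -EFinM.
by have -> : L = n%:R * r by rewrite /L /r -mulrA.
Qed.

End linear_estimate.

(** * Progressive and essentially bounded processes *)

Section progressive_processes.
Context {R : realType} {d : measure_display} {T : measurableType d}.
Variables (P : probability T R) (G : R -> set (set T)).
Hypothesis sG : forall t, 0 <= t -> sigma_algebra setT (G t) /\ G t `<=` measurable.
Notation mu := (@lebesgue_measure R).

Lemma progressive_measurable_process k l (X : R -> T -> 'M[R]_(k, l)) :
  progressive G X -> measurable_process X.
Proof.
move=> pX S i j S0 _ U mU.
have := pX S S0 i j U mU.
rewrite (_ : [set p : R * T | 0 <= p.1 <= S] = time_slab S); last first.
  by apply/seteqP; split => -[t w]; rewrite /time_slab /= in_itv/= => // -[].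
move: (time_slab S `&` _); apply: smallest_sub; first exact: sigma_algebra_measurable.
by move=> _ [I [A [mI GA ->]]]; apply: measurableX => //; exact: (sG S0).2.
Qed.

(** The sets of pairs whose section at time [t] lies in [G t] form a sigma-algebra that contains the
    generating rectangles. *)
Lemma progressive_adapted k l (X : R -> T -> 'M[R]_(k, l)) t i j :
  progressive G X -> 0 <= t -> sys_measurable (G t) (fun w => X t w i j).
Proof.
move=> pX t0 U mU.
have := pX t t0 i j U mU; set E := _ `&` _ => sE.
suff : G t [set w | E (t, w)].
  rewrite (_ : [set w | E (t, w)] = (fun w => X t w i j) @^-1` U)//.
  by apply/seteqP; split => w; rewrite /E /= ?t0 ?lexx => // -[].
move: E sE; apply: smallest_sub => [|_ [I [A [mI GA ->]]] /=]; last first.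
  have [It|nIt] := pselect (I t).
    by rewrite (_ : [set w | (I `*` A) (t, w)] = A)//; apply/seteqP; split => w // [].
  rewrite (_ : [set w | (I `*` A) (t, w)] = set0); first by case: (sG t0).1.
  by apply/seteqP; split => w // [].
have [[G0 GC GU] _] := sG t0; split => //.
- by move=> E GE; rewrite setTD; rewrite -[X in G t X]setTD; exact: GC.
- by move=> F GF; apply: (GU (fun k => [set w | F k (t, w)])).
Qed.

End progressive_processes.

Section bounded_process_lemmas.
Context {R : realType} {d : measure_display} {T : measurableType d}.
Variables (P : probability T R).
Notation mu := (@lebesgue_measure R).

Lemma mxnorm_sqr k l (M : 'M[R]_(k, l)) : mxnorm M ^+ 2 = \sum_i \sum_j M i j ^+ 2.
Proof.
by rewrite sqr_sqrtr//; apply: sumr_ge0 => i _; apply: sumr_ge0 => j _; exact: sqr_ge0.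
Qed.

Lemma mxnorm_vsq n (y : 'cV[R]_n) : mxnorm y ^+ 2 = vsq y.
Proof. by rewrite mxnorm_sqr; apply: eq_bigr => i _; rewrite big_ord1. Qed.

Lemma entry_le_mxnorm k l (M : 'M[R]_(k, l)) i j : `|M i j| <= mxnorm M.
Proof.
rewrite -[leRHS]ger0_norm ?sqrtr_ge0// -ler_sqr_norm mxnorm_sqr.
rewrite (bigD1 i)//= (bigD1 j)//= -addrA lerDl addr_ge0//.
  by apply: sumr_ge0 => ? _; exact: sqr_ge0.
by apply: sumr_ge0 => ? _; apply: sumr_ge0 => ? _; exact: sqr_ge0.
Qed.

Lemma bounded_processS c c' k l (f : R -> T -> 'M[R]_(k, l)) : c <= c' ->
  bounded_process P c f -> bounded_process P c' f.
Proof.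
move=> cc' [mf fc]; split => //; apply: filterS fc => p fc p0 i j.
exact: le_trans (fc p0 i j) cc'.
Qed.

Lemma Linfty_bounded_process (G : R -> set (set T)) k l (f : R -> T -> 'M[R]_(k, l)) :
    (forall t, 0 <= t -> sigma_algebra setT (G t) /\ G t `<=` measurable) ->
    Linfty_process P G f ->
  exists2 c, 0 <= c & bounded_process P c f.
Proof.
move=> sG [pf]; set e := ess_sup _ _ => eoo.
have [c c0 ec] : exists2 c : R, 0 <= c & (e <= c%:E)%E.
  case: (e) eoo => [r| |]// _; last by exists 0 => //; rewrite leNye.
  by exists `|r|; rewrite ?lee_fin ?ler_norm.
exists c => //; split; first exact: progressive_measurable_process pf.
move/ess_supP : ec; apply: filterS => -[t w] /= + t0 i j.
rewrite patchE mem_set; last by split => //=; rewrite in_itv/= t0.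
by rewrite lee_fin; apply: le_trans; exact: entry_le_mxnorm.
Qed.

Lemma bounded_process_mul c c' k l r (f : R -> T -> 'M[R]_(k, l))
    (g : R -> T -> 'M[R]_(l, r)) : 0 <= c -> bounded_process P c f ->
  bounded_process P c' g -> bounded_process P (l%:R * (c * c')) (fun t w => f t w *m g t w).
Proof.
move=> c0 [mf fc] [mg gc]; split; first exact: measurable_process_mul.
apply: filterS2 fc gc => p fc gc p0 i j; rewrite mxE.
apply: (le_trans (ler_norm_sum _ _ _)).
apply: (@le_trans _ _ (\sum_(h < l) c * c')).
  by apply: ler_sum => h _; rewrite normrM ler_pM// ?fc// gc.
by rewrite sumr_const card_ord mulr_natl.
Qed.

Lemma bounded_process_add c c' k l (f g : R -> T -> 'M[R]_(k, l)) :
  bounded_process P c f -> bounded_process P c' g ->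
  bounded_process P (c + c') (fun t w => f t w + g t w).
Proof.
move=> [mf fc] [mg gc]; split; first exact: measurable_process_add.
apply: filterS2 fc gc => p fc gc p0 i j; rewrite mxE.
by apply: (le_trans (ler_normD _ _)); rewrite lerD ?fc ?gc.
Qed.

Lemma expected_integral_bounded_lty c k l (f : R -> T -> 'M[R]_(k, l)) S i j :
  0 <= S -> bounded_process P c f ->
  (expected_integral P S (fun t w => (f t w i j ^+ 2)%R) < +oo)%E.
Proof.
move=> S0 [mf fc].
apply: (@le_lt_trans _ _ (expected_integral P S (fun _ _ => c ^+ 2))).
  apply: le_expected_integral.
  - by apply: measurable_funX; exact: mf.
  - exact: measurable_cst.
  - by move=> t w _; exact: sqr_ge0.
  - by move=> t w _; exact: sqr_ge0.
  - apply: filterS fc => -[t w] /= fc /andP[t0 _].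
    by rewrite ler_sqr_norm (le_trans (fc t0 i j))// ler_norm.
have muS : mu `[0, S] = S%:E.
  rewrite lebesgue_measure_itv/= lte_fin; case: ltP => [_|S0']; first by rewrite sube0.
  by congr EFin; apply/eqP; rewrite eq_le S0 S0'.
have inner : (\int[mu]_(t in `[0%R, S]) (c ^+ 2)%:E = (c ^+ 2 * S)%:E)%E.
  by rewrite (integral_cst mu _ (c ^+ 2)%:E)// [in RHS]EFinM; congr (_ * _)%E.
rewrite /expected_integral (eq_integral (cst (c ^+ 2 * S)%:E)); last by move=> w _; rewrite inner.
by rewrite integral_cst// [X in (_ * X)%E]probability_setT mule1 ltry.
Qed.

Lemma expected_integral_mulmx_le c n S (B : R -> T -> 'M[R]_n) (Y : R -> T -> 'cV[R]_n) i :
  0 <= S -> bounded_process P c B -> measurable_process Y ->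
  (expected_integral P S (fun s w => ((B s w *m Y s w) i 0 ^+ 2)%R) <=
   (c ^+ 2 * n%:R)%:E * expected_integral P S (fun s w => vsq (Y s w)))%E.
Proof.
move=> S0 [mB Bc] mY.
have mvY := jointly_measurable_vsq S0 mY.
rewrite -expected_integralZ; [|by rewrite mulr_ge0 ?sqr_ge0|exact: mvY|by move=> s w _; exact: vsq_ge0].
apply: le_expected_integral.
- by apply: measurable_funX; apply: (measurable_process_mul mB mY).
- by apply: measurable_funM => //; exact: mvY.
- by move=> s w _; exact: sqr_ge0.
- by move=> s w _; apply: mulr_ge0; [rewrite mulr_ge0 ?sqr_ge0|exact: vsq_ge0].
- apply: filterS Bc => -[s w] /= Bc /andP[s0 _].
  by apply: mulmx_entry_sqr_le; exact: Bc.
Qed.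

(** Almost every path is square integrable on [[0, S]], hence integrable, since |g| is at most 1 +
    g^2. Additivity of [Rintegral] in the equations depends on this. *)
Lemma ae_section_integrable S (g : R -> T -> R) : 0 <= S -> jointly_measurable S g ->
    (expected_integral P S (fun t w => (g t w ^+ 2)%R) < +oo)%E ->
  {ae P, forall w, mu.-integrable `[0, S] (fun t => (g t w)%:E)}.
Proof.
move=> S0 mg goo.
pose h w := (\int[mu]_(t in `[0%R, S]) (g t w ^+ 2)%:E)%E.
have mh : measurable_fun setT h.
  apply: (measurable_time_integral (f := fun t w => g t w ^+ 2)).
    exact: measurable_funX.
  by move=> *; exact: sqr_ge0.
have h0 w : (0 <= h w)%E by exact: integral_sqr_ge0.
have ih : P.-integrable setT h.
  by apply/integrableP; split => //; under eq_integral do rewrite gee0_abs//.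
apply: filterS (integrable_ae measurableT ih) => w /(_ I) hw.
have mgw := jointly_measurable_section w mg.
have i1 : mu.-integrable `[0, S] (EFin \o cst 1).
  apply: measurable_bounded_integrable => //=; last exact: bounded_cst.
  by rewrite lebesgue_measure_itv/=; case: ifP => _; rewrite -?EFinB ltry.
have i2 : mu.-integrable `[0, S] (fun t => (g t w ^+ 2)%:E).
  apply/integrableP; split; first exact: measurable_sqr_EFin.
  under eq_integral do rewrite gee0_abs ?lee_fin ?sqr_ge0//.
  by move: hw; rewrite ge0_fin_numE//; exact.
have i3 : mu.-integrable `[0, S] (fun t => (1 + g t w ^+ 2)%:E) by exact: integrable_addr.
apply: le_integrable i3 => //.
  exact/measurable_EFinP.
move=> t _; rewrite /= lee_fin [leRHS]ger0_norm; last by have := sqr_ge0 (g t w); lra.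
have := sqr_ge0 (`|g t w| - 1); have := sqr_ge0 (g t w).
by rewrite sqrrB real_normK ?num_real// => ? ?; have := normr_ge0 (g t w); lra.
Qed.

End bounded_process_lemmas.

(** * Linear operations on Ito processes *)

Section ito_process.
Context {R : realType} {d : measure_display} {T : measurableType d}.
Variables (P : probability T R) (W : R -> T -> R) (G : R -> set (set T)).
Hypothesis Wb : brownian_wrt P W G.
Notation mu := (@lebesgue_measure R).

(** A scalar Ito process with drift [g] and diffusion [h]. The equation is required at each fixed
    time, up to a null set depending on it, with some stochastic integral [J]. Square integrability
    of the drift makes its path integrals additive, so that the class is closed under linear
    operations. *)
Record ito_process (y0 : T -> R) (g h y : R -> T -> R) : Prop := ItoProcess {
  ito_process_drift : forall S, 0 <= S -> jointly_measurable S g;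
  ito_process_diffusion : forall S, 0 <= S -> jointly_measurable S h;
  ito_process_lty : forall S, 0 <= S ->
    (expected_integral P S (fun t w => (g t w ^+ 2)%R) < +oo)%E;
  ito_process_eq : forall t, 0 <= t -> exists2 J : T -> R, ito_limit P W G t h J &
    {ae P, forall w, y t w = y0 w + \int[mu]_(s in `[0, t]) g s w + J w} }.

Lemma ito_processD y0 g h y y0' g' h' y' :
  ito_process y0 g h y -> ito_process y0' g' h' y' ->
  ito_process (fun w => y0 w + y0' w) (fun t w => g t w + g' t w)
    (fun t w => h t w + h' t w) (fun t w => y t w + y' t w).
Proof.
move=> [mg mh goo eqy] [mg' mh' goo' eqy']; split.
- by move=> S S0; apply: measurable_funD; [exact: mg|exact: mg'].
- by move=> S S0; apply: measurable_funD; [exact: mh|exact: mh'].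
- move=> S S0; apply: (@le_lt_trans _ _ (2%:E * expected_integral P S (fun t w => (g t w ^+ 2)%R) +
    2%:E * expected_integral P S (fun t w => (g' t w ^+ 2)%R))%E).
    apply: le_expected_integral_sqrD => //; [|exact: mg|exact: mg'].
    by apply: measurable_funD; [exact: mg|exact: mg'].
  by apply: lte_add_pinfty; apply: lte_scale_pinfty (ler0n _ _) _; [exact: goo|exact: goo'].
- move=> t t0; have [J JI eJ] := eqy t t0; have [J' JI' eJ'] := eqy' t t0.
  exists (fun w => J w + J' w).
    by apply: (ito_limitD Wb) => //; [exact: mh|exact: mh'].
  have i := ae_section_integrable t0 (mg t t0) (goo t t0).
  have i' := ae_section_integrable t0 (mg' t t0) (goo' t t0).
  apply: filterS3 (filterI i i') eJ eJ' => w [iw iw'] -> ->.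
  by rewrite RintegralD//; ring.
Qed.

(** [z] is bounded and known at time zero, so it commutes with both the path integral and the
    stochastic integral. *)
Lemma ito_processZ y0 g h y z : bounded_adapted G 0 z -> ito_process y0 g h y ->
  ito_process (fun w => z w * y0 w) (fun t w => z w * g t w)
    (fun t w => z w * h t w) (fun t w => z w * y t w).
Proof.
move=> zb [mg mh goo eqy].
have [Gz [M zM]] := zb; have mz := sys_measurable_fun Wb (lexx 0) Gz.
have mz2 S : jointly_measurable S (fun _ => z).
  by apply: measurable_funTS; exact: measurableT_comp mz measurable_snd.
split.
- by move=> S S0; apply: measurable_funM; [exact: mz2|exact: mg].
- by move=> S S0; apply: measurable_funM; [exact: mz2|exact: mh].
- move=> S S0; apply: (@le_lt_trans _ _ (expected_integral P S (fun t w => (M ^+ 2 * g t w ^+ 2)%R))).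
    apply: le_expected_integral.
    + by apply: measurable_funX; apply: measurable_funM; [exact: mz2|exact: mg].
    + by apply: measurable_funM => //; apply: measurable_funX; exact: mg.
    + by move=> t w _; exact: sqr_ge0.
    + by move=> t w _; rewrite mulr_ge0 ?sqr_ge0.
    + apply: aeW => -[t w] _ /=; rewrite exprMn ler_wpM2r ?sqr_ge0//.
      by rewrite ler_sqr_norm (le_trans (zM w))// ler_norm.
  rewrite expected_integralZ ?sqr_ge0//.
  + by rewrite lte_mul_pinfty ?lee_fin ?sqr_ge0// goo.
  + by apply: measurable_funX; exact: mg.
  + by move=> t w _; exact: sqr_ge0.
- move=> t t0; have [J JI eJ] := eqy t t0.
  exists (fun w => z w * J w); first by apply: (ito_limitZ Wb) => //; exact: mh.
  apply: filterS2 (ae_section_integrable t0 (mg t t0) (goo t t0)) eJ => w iw ->.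
  by rewrite RintegralZl//; ring.
Qed.

Lemma bounded_adapted_cst (k : R) : bounded_adapted G 0 (fun=> k).
Proof.
split; last by exists `|k|.
by apply: sys_measurable_cst; case: Wb => + _ _ _ _ => /(_ 0 (lexx 0))[].
Qed.

Lemma ito_processB y0 g h y y0' g' h' y' :
  ito_process y0 g h y -> ito_process y0' g' h' y' ->
  ito_process (fun w => y0 w - y0' w) (fun t w => g t w - g' t w)
    (fun t w => h t w - h' t w) (fun t w => y t w - y' t w).
Proof.
move=> p p'; have := ito_processD p (ito_processZ (bounded_adapted_cst (- 1)) p').
have e1 (a b : T -> R) : (fun w => a w + -1 * b w) = (fun w => a w - b w).
  by apply/funext => w; rewrite mulN1r.
have e2 (a b : R -> T -> R) : (fun t w => a t w + -1 * b t w) = (fun t w => a t w - b t w).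
  by apply/funext => t; exact: e1.
by rewrite !e1 !e2.
Qed.

Lemma ito_process0 : ito_process (fun=> 0) (fun _ _ => 0) (fun _ _ => 0) (fun _ _ => 0).
Proof.
split.
- by move=> S _; exact: measurable_cst.
- by move=> S _; exact: measurable_cst.
- move=> S _; rewrite (_ : expected_integral _ _ _ = 0%E) ?ltry//.
  by apply: integral0_eq => w _; apply: integral0_eq => t _; rewrite expr0n.
- move=> t t0; exists (fun=> 0); first exact: ito_limit0.
  by apply: aeW => w; rewrite Rintegral_cst// mul0r !addr0.
Qed.

Lemma ito_process_sum (n : nat) (y0 : 'I_n -> T -> R) (g h y : 'I_n -> R -> T -> R) :
  (forall j, ito_process (y0 j) (g j) (h j) (y j)) ->
  ito_process (fun w => \sum_j y0 j w) (fun t w => \sum_j g j t w)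
    (fun t w => \sum_j h j t w) (fun t w => \sum_j y j t w).
Proof.
move=> p.
suff : forall s : seq 'I_n, ito_process (fun w => \sum_(j <- s) y0 j w)
  (fun t w => \sum_(j <- s) g j t w) (fun t w => \sum_(j <- s) h j t w)
  (fun t w => \sum_(j <- s) y j t w) by apply.
have e1 (f : 'I_n -> T -> R) j s : (fun w => \sum_(i <- j :: s) f i w) =
    (fun w => f j w + \sum_(i <- s) f i w).
  by apply/funext => w; rewrite big_cons.
have e2 (f : 'I_n -> R -> T -> R) j s : (fun t w => \sum_(i <- j :: s) f i t w) =
    (fun t w => f j t w + \sum_(i <- s) f i t w).
  by apply/funext => t; apply/funext => w; rewrite big_cons.
have e3 (f : 'I_n -> T -> R) : (fun w => \sum_(i <- [::]) f i w) = (fun=> 0).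
  by apply/funext => w; rewrite big_nil.
have e4 (f : 'I_n -> R -> T -> R) : (fun t w => \sum_(i <- [::]) f i t w) = (fun _ _ => 0).
  by apply/funext => t; apply/funext => w; rewrite big_nil.
elim=> [|j s IH]; first by rewrite !e3 !e4; exact: ito_process0.
by rewrite !e1 !e2; exact: ito_processD.
Qed.

End ito_process.

(** * Truncation of the initial value and the mean-square bound *)

Section truncation.
Context {R : realType}.

Definition truncation (N x : R) : R := if `|x| <= N then x else 0.

Lemma measurable_truncation N : measurable_fun setT (truncation N).
Proof. by apply: measurable_fun_ifT => //; exact: measurable_fun_ler. Qed.

Lemma truncation_bound N x : 0 <= N -> `|truncation N x| <= N.
Proof. by move=> N0; rewrite /truncation; case: ifP; rewrite ?normr0. Qed.

Lemma truncation_le N x : `|truncation N x| <= `|x|.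
Proof. by rewrite /truncation; case: ifP; rewrite ?normr0. Qed.

Lemma truncation_sub_le N x : `|x - truncation N x| <= `|x|.
Proof. by rewrite /truncation; case: ifP; rewrite ?subrr ?subr0 ?normr0. Qed.

Lemma truncation_id N x : `|x| <= N -> truncation N x = x.
Proof. by rewrite /truncation => ->. Qed.

Definition msq (k l : nat) (M : 'M[R]_(k, l)) : R := \sum_i \sum_j M i j ^+ 2.

Lemma msq_ge0 k l (M : 'M[R]_(k, l)) : 0 <= msq M.
Proof. by apply: sumr_ge0 => i _; apply: sumr_ge0 => j _; exact: sqr_ge0. Qed.

(** The terms are left as products of one entry of [M] and one entry of [z], the form to which
    independence applies; replacing [y] by the larger [z] removes the truncation. *)
Lemma vsq_mulmx_le n (M : 'M[R]_n) (y z : 'cV[R]_n) :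
    (forall j, `|y j 0| <= `|z j 0|) ->
  vsq (M *m y) <= n%:R * \sum_i \sum_j M i j ^+ 2 * z j 0 ^+ 2.
Proof.
move=> yz; rewrite /vsq mulr_sumr; apply: ler_sum => i _.
rewrite mxE; apply: (le_trans (sqr_sum_le _)); rewrite ler_wpM2l ?ler0n//.
by apply: ler_sum => j _; rewrite exprMn ler_wpM2l ?sqr_ge0// ler_sqr_norm.
Qed.

Lemma vsqB_le n (y z : 'cV[R]_n) : vsq (y - z) <= 2 * vsq y + 2 * vsq z.
Proof.
rewrite /vsq !mulr_sumr -big_split/=; apply: ler_sum => i _; rewrite !mxE.
by have := sqr_ge0 (y i 0 + z i 0); nra.
Qed.

End truncation.

Section mean_square_bound.
Context {R : realType} {d : measure_display} {T : measurableType d}.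
Variables (P : probability T R) (W : R -> T -> R) (G : R -> set (set T)).
Hypothesis Wb : brownian_wrt P W G.
Notation mu := (@lebesgue_measure R).

Lemma measurable_vsq n (y : T -> 'cV[R]_n) :
  (forall i, measurable_fun setT (fun w => y w i 0)) ->
  measurable_fun setT (fun w => vsq (y w)).
Proof. by move=> my; apply: measurable_sum => i; exact: measurable_funX. Qed.

Variables (n : nat) (c : R) (M C Phi : R -> T -> 'M[R]_n).
Variables (D : R -> T -> 'cV[R]_n) (eta : T -> 'cV[R]_n).
Hypotheses (cM : bounded_process P c M) (cC : bounded_process P c C).
Hypotheses (mD : measurable_process D) (mPhi : measurable_process Phi).
Hypothesis D_lty : forall S, 0 <= S ->
  (expected_integral P S (fun t w => vsq (D t w)) < +oo)%E.
Hypothesis Phi_lty : forall S, 0 <= S ->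
  (expected_integral P S (fun t w => msq (Phi t w)) < +oo)%E.
Hypothesis eta_G0 : forall i, sys_measurable (G 0) (fun w => eta w i 0).
Hypothesis eta_lty : (\int[P]_w (vsq (eta w))%:E < +oo)%E.
Hypothesis D_eq : forall i, ito_process P W G (fun w => eta w i 0)
  (fun t w => (M t w *m D t w) i 0) (fun t w => (C t w *m D t w) i 0)
  (fun t w => D t w i 0).
Hypothesis Phi_eq : forall i j, ito_process P W G (fun w => (1%:M : 'M[R]_n) i j)
  (fun t w => (M t w *m Phi t w) i j) (fun t w => (C t w *m Phi t w) i j)
  (fun t w => Phi t w i j).
Hypothesis Phi_eta : forall t i j k, 0 <= t ->
  independent_fun P (fun w => Phi t w i j) (fun w => eta w k 0).

Let meta i : measurable_fun setT (fun w => eta w i 0).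
Proof. exact: (sys_measurable_fun Wb (lexx 0) (eta_G0 i)). Qed.

Let etaN (N : nat) w : 'cV[R]_n := \col_i truncation N%:R (eta w i 0).

(** The error made by replacing the initial difference with its truncation and propagating it by
    [Phi]. *)
Let Y N t w := D t w - Phi t w *m etaN N w.

Let metaN N i : measurable_fun setT (fun w => etaN N w i 0).
Proof.
under eq_fun do rewrite mxE.
by apply: measurableT_comp => //; exact: measurable_truncation.
Qed.

Let meB N i : measurable_fun setT (fun w => (eta w - etaN N w) i 0).
Proof.
have -> : (fun w => (eta w - etaN N w) i 0) = (fun w => eta w i 0 - etaN N w i 0).
  by apply/funext => w; rewrite !mxE.
exact: measurable_funB.
Qed.

Let bN N j : bounded_adapted G 0 (fun w => etaN N w j 0).
Proof.
split; last by exists N%:R => w; rewrite mxE truncation_bound.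
under eq_fun do rewrite mxE.
by apply: (sys_measurable_comp (measurable_truncation _)); exact: eta_G0.
Qed.

(** The entries of the truncated initial value are bounded and known at time zero, so they can be
    moved inside the integrals of the entries of [Phi]; the sum over columns is then subtracted from
    the equation of [D]. *)
Let Y_eq N i : ito_process P W G (fun w => (eta w - etaN N w) i 0)
  (fun t w => (M t w *m Y N t w) i 0) (fun t w => (C t w *m Y N t w) i 0)
  (fun t w => Y N t w i 0).
Proof.
have := ito_processB Wb (D_eq i) (ito_process_sum Wb (fun j => ito_processZ Wb (bN N j) (Phi_eq i j))).
have e1 (a : T -> 'cV[R]_n) (F : T -> 'M[R]_n) :
    (fun w => a w i 0 - \sum_j etaN N w j 0 * F w i j) =
    (fun w => (a w - F w *m etaN N w) i 0).
  apply/funext => w; rewrite !mxE; congr (_ - _).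
  by apply: eq_bigr => j _; rewrite mulrC.
have e2 (a : R -> T -> 'cV[R]_n) (F : R -> T -> 'M[R]_n) :
    (fun t w => a t w i 0 - \sum_j etaN N w j 0 * F t w i j) =
    (fun t w => (a t w - F t w *m etaN N w) i 0).
  by apply/funext => t; exact: (e1 (a t) (F t)).
rewrite (e1 eta (fun=> 1%:M)) !e2.
rewrite (_ : (fun w => (eta w - 1%:M *m etaN N w) i 0) = (fun w => (eta w - etaN N w) i 0)).
  rewrite (_ : (fun t w => (M t w *m D t w - _) i 0) = (fun t w => (M t w *m Y N t w) i 0)).
    rewrite (_ : (fun t w => (C t w *m D t w - _) i 0) = (fun t w => (C t w *m Y N t w) i 0))//.
    by apply/funext => t; apply/funext => w; rewrite /Y mulmxBr mulmxA.
  by apply/funext => t; apply/funext => w; rewrite /Y mulmxBr mulmxA.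
by apply/funext => w; rewrite mul1mx.
Qed.

Let mPhieta N : measurable_process (fun t w => Phi t w *m etaN N w).
Proof.
apply: measurable_process_mul => // S i j S0.
apply: measurable_funTS; rewrite (ord1 j).
exact: measurableT_comp (metaN N i) measurable_snd.
Qed.

Let mY N : measurable_process (Y N).
Proof. exact: measurable_process_sub. Qed.

Let mmsq S : 0 <= S -> jointly_measurable S (fun t w => msq (Phi t w)).
Proof.
move=> S0; apply: measurable_sum => i; apply: measurable_sum => j.
by apply: measurable_funX; exact: mPhi.
Qed.

(** The finiteness demanded by [linear_sde_estimate]. It rests on the bound [N%:R] for the truncated
    entries; the constant [k] may grow with [N], as only finiteness matters. *)
Let Y_lty N S : 0 <= S -> (expected_integral P S (fun t w => vsq (Y N t w)) < +oo)%E.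
Proof.
move=> S0; pose k : R := 2 * (n%:R * N%:R ^+ 2).
have k0 : 0 <= k by rewrite !mulr_ge0.
have mvD := jointly_measurable_vsq S0 mD.
apply: (@le_lt_trans _ _ (expected_integral P S (fun t w => 2 * vsq (D t w) + k * msq (Phi t w)))).
  apply: le_expected_integral.
  - exact: jointly_measurable_vsq.
  - by apply: measurable_funD; apply: measurable_funM => //; exact: mmsq.
  - by move=> t w _; exact: vsq_ge0.
  - by move=> t w _; rewrite addr_ge0// mulr_ge0 ?vsq_ge0 ?msq_ge0.
  - apply: aeW => -[t w] _ /=; apply: (le_trans (vsqB_le _ _)); rewrite lerD2l /k -mulrA ler_wpM2l//.
    apply: (le_trans (vsq_mulmx_le (z := const_mx N%:R) _ _)).
      by move=> j; rewrite !mxE (ger0_norm (ler0n _ _)) truncation_bound.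
    rewrite -mulrA ler_wpM2l// mulr_sumr; apply: ler_sum => i _.
    by rewrite mulr_sumr; apply: ler_sum => j _; rewrite mxE mulrC.
rewrite expected_integralE; first last.
- by move=> t w _; rewrite addr_ge0// mulr_ge0 ?vsq_ge0 ?msq_ge0.
- by apply: measurable_funD; apply: measurable_funM => //; exact: mmsq.
under eq_integral do rewrite EFinD.
rewrite ge0_integralD; first last.
- by apply/measurable_EFinP; apply: measurable_funM => //; exact: mmsq.
- by move=> p _; rewrite lee_fin mulr_ge0 ?msq_ge0.
- by apply/measurable_EFinP; apply: measurable_funM.
- by move=> p _; rewrite lee_fin mulr_ge0 ?vsq_ge0.
- exact: measurable_time_slab.
rewrite -(expected_integralE P (f := fun t w => 2 * vsq (D t w))); first last.
- by move=> t w _; rewrite mulr_ge0 ?vsq_ge0.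
- exact: measurable_funM.
rewrite -(expected_integralE P (f := fun t w => k * msq (Phi t w))); first last.
- by move=> t w _; rewrite mulr_ge0 ?msq_ge0.
- by apply: measurable_funM => //; exact: mmsq.
rewrite (expected_integralZ P k0 (mmsq S0) (fun t w _ => msq_ge0 _)).
rewrite (expected_integralZ P (ler0n R 2) mvD (fun t w _ => vsq_ge0 _)).
apply: lte_add_pinfty.
- exact: lte_scale_pinfty (ler0n _ _) (D_lty S0).
- exact: lte_scale_pinfty k0 (Phi_lty S0).
Qed.

(** Dominated convergence: at each sample point the truncation is inactive from some [N] on, and
    [vsq (eta w)] dominates. *)
Let truncation_cvg0 : (fun N : nat => \int[P]_w (vsq (eta w - etaN N w))%:E)%E @ \oo --> 0%E.
Proof.
have ieta : P.-integrable setT (fun w => (vsq (eta w))%:E).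
  apply/integrableP; split; first by apply/measurable_EFinP; exact: measurable_vsq.
  by under eq_integral do rewrite gee0_abs ?lee_fin ?vsq_ge0//.
rewrite -[X in _ --> X](integral0 P setT).
apply: (@dominated_cvg _ _ _ P setT measurableT (fun N w => (vsq (eta w - etaN N w))%:E)
  (cst 0%E) (fun w => (vsq (eta w))%:E)) => //.
- by move=> N; apply/measurable_EFinP; apply: measurable_vsq => i; exact: meB.
- move=> w _; apply: cvg_near_cst.
  have [K Kb] : exists K : nat, forall i, `|eta w i 0| <= K%:R.
    exists (Num.bound (\sum_i `|eta w i 0|)) => i.
    apply: le_trans (ltW (archi_boundP _)); last by apply: sumr_ge0.
    by rewrite (bigD1 i)//= lerDl sumr_ge0.
  exists K => // N /= KN; rewrite (_ : etaN N w = eta w) ?subrr.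
    by congr EFin; rewrite /vsq big1// => i _; rewrite mxE expr0n.
  apply/matrixP => i j; rewrite (ord1 j) mxE truncation_id//.
  by apply: le_trans (Kb i) _; rewrite ler_nat.
- move=> N w _; rewrite /= lee_fin ger0_norm ?vsq_ge0//.
  by apply: ler_sum => i _; rewrite !mxE ler_sqr_norm truncation_sub_le.
Qed.

(** [D] is split into [Y N] plus [Phi] applied to the truncated value, at the cost of a factor 2.
    The first part vanishes as [N] grows, and the second is bounded through independence, uniformly
    in [N]; the factor n is from Cauchy-Schwarz in the matrix product. *)
Lemma mean_square_bound t : 0 <= t ->
  (\int[P]_w (vsq (D t w))%:E <=
   (2 * n%:R)%:E * (\int[P]_w (msq (Phi t w))%:E * \int[P]_w (vsq (eta w))%:E))%E.
Proof.
move=> t0; have [K K0 est] := linear_sde_estimate Wb n c t0.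
have ttt : 0 <= t <= t by rewrite t0 lexx.
have slice k l (f : R -> T -> 'M[R]_(k, l)) i j : measurable_process f ->
    measurable_fun setT (fun w => f t w i j).
  by move=> mf; apply: (jointly_measurable_slice ttt (f := fun t w => f t w i j)); exact: mf.
(* [K] was fixed before [N], so the error 2 K E|eta - eta_N|^2 tends to zero. The second sequence is
   a dummy with weight 0. *)
apply: (le_cvge0 (cvge0_comb (2 * K) 0 truncation_cvg0 truncation_cvg0)) => N.
rewrite mul0e adde0.
have hY : (\int[P]_w (vsq (Y N t w))%:E <= K%:E * \int[P]_w (vsq (eta w - etaN N w))%:E)%E.
  apply: (est M C (Y N)) => //; first exact: Y_lty.
  - apply: (@le_lt_trans _ _ (\int[P]_w (vsq (eta w))%:E)%E) => //.
    apply: ge0_le_integral => //.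
    + by move=> w _; rewrite lee_fin vsq_ge0.
    + by apply/measurable_EFinP; apply: measurable_vsq => i; exact: meB.
    + by apply/measurable_EFinP; apply: measurable_vsq.
    + by move=> w _; rewrite lee_fin; apply: ler_sum => i _; rewrite !mxE ler_sqr_norm truncation_sub_le.
  - by move=> s /andP[s0 _] i; case: (Y_eq N i) => _ _ _; exact.
have hD : (\int[P]_w (vsq (D t w))%:E <= 2%:E * \int[P]_w (vsq (Y N t w))%:E +
   2%:E * \int[P]_w (vsq (Phi t w *m etaN N w))%:E)%E.
  have mYt : measurable_fun setT (fun w => vsq (Y N t w)).
    by apply: measurable_vsq => i; exact: slice (mY N).
  have mPt : measurable_fun setT (fun w => vsq (Phi t w *m etaN N w)).
    by apply: measurable_vsq => i; exact: slice (mPhieta N).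
  have mDt : measurable_fun setT (fun w => vsq (D t w)).
    by apply: measurable_vsq => i; exact: slice mD.
  rewrite -!ge0_integralZl//; try (by apply/measurable_EFinP);
    try by move=> w _; rewrite lee_fin vsq_ge0.
  rewrite -ge0_integralD//; first last.
  - by apply: emeasurable_funM => //; exact/measurable_EFinP.
  - by move=> w _; rewrite mule_ge0// lee_fin vsq_ge0.
  - by apply: emeasurable_funM => //; exact/measurable_EFinP.
  - by move=> w _; rewrite mule_ge0// lee_fin vsq_ge0.
  apply: ge0_le_integral => //.
  - by move=> w _; rewrite lee_fin vsq_ge0.
  - exact/measurable_EFinP.
  - by apply: emeasurable_funD; apply: emeasurable_funM => //; exact/measurable_EFinP.
  - move=> w _; rewrite -!EFinM -EFinD lee_fin.
    rewrite (_ : D t w = Y N t w - - (Phi t w *m etaN N w)); last by rewrite opprK subrK.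
    apply: (le_trans (vsqB_le _ _)); rewrite lerD2l ler_wpM2l//.
    by apply: ler_sum => i _; rewrite mxE sqrrN.
have hPhi : (\int[P]_w (vsq (Phi t w *m etaN N w))%:E <=
   n%:R%:E * (\int[P]_w (msq (Phi t w))%:E * \int[P]_w (vsq (eta w))%:E))%E.
  have mPt i j : measurable_fun setT (fun w => Phi t w i j) by exact: slice mPhi.
  have mprod i j : measurable_fun setT (fun w => Phi t w i j ^+ 2 * eta w j 0 ^+ 2).
    by apply: measurable_funM; apply: measurable_funX.
  apply: (@le_trans _ _ (\int[P]_w (n%:R%:E *
      \sum_i \sum_j (Phi t w i j ^+ 2 * eta w j 0 ^+ 2)%:E))%E).
    apply: ge0_le_integral => //.
    - by move=> w _; rewrite lee_fin vsq_ge0.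
    - by apply/measurable_EFinP; apply: measurable_vsq => i; exact: slice (mPhieta N).
    - apply: emeasurable_funM => //; apply: emeasurable_sum => i.
      by apply: emeasurable_sum => j; exact/measurable_EFinP.
    - move=> w _; under eq_bigr do rewrite sumEFin; rewrite sumEFin -EFinM lee_fin.
      by apply: vsq_mulmx_le => j; rewrite mxE truncation_le.
  rewrite ge0_integralZl//; first last.
  - move=> w _; apply: sume_ge0 => i _; apply: sume_ge0 => j _.
    by rewrite lee_fin mulr_ge0 ?sqr_ge0.
  - by apply: emeasurable_sum => i; apply: emeasurable_sum => j; exact/measurable_EFinP.
  apply: lee_wpmul2l; first by rewrite lee_fin.
  have msqE : (\int[P]_w (msq (Phi t w))%:E =
      \sum_i \sum_j \int[P]_w (Phi t w i j ^+ 2)%:E)%E.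
    under eq_integral do rewrite -sumEFin.
    rewrite ge0_integral_sum//; first last.
    - by move=> i w _; rewrite lee_fin sumr_ge0// => j _; exact: sqr_ge0.
    - by move=> i; apply/measurable_EFinP; apply: measurable_sum => j; exact: measurable_funX.
    apply: eq_bigr => i _; under eq_integral do rewrite -sumEFin.
    rewrite ge0_integral_sum//; first by move=> j; exact: measurable_sqr_EFin.
    by move=> j w _; rewrite lee_fin sqr_ge0.
  rewrite ge0_integral_sum//; first last.
  - by move=> i w _; apply: sume_ge0 => j _; rewrite lee_fin mulr_ge0 ?sqr_ge0.
  - by move=> i; apply: emeasurable_sum => j; exact/measurable_EFinP.
  have v0 : (0 <= \int[P]_w (vsq (eta w))%:E)%E.
    by apply: integral_ge0 => w _; rewrite lee_fin vsq_ge0.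
  rewrite msqE ge0_sume_distrl; last first.
    by move=> i _; apply: sume_ge0 => j _; exact: integral_sqr_ge0.
  apply: lee_sum => i _; rewrite ge0_integral_sum//; first last.
  - by move=> j w _; rewrite lee_fin mulr_ge0 ?sqr_ge0.
  - by move=> j; exact/measurable_EFinP.
  rewrite ge0_sume_distrl; last by move=> j _; exact: integral_sqr_ge0.
  apply: lee_sum => j _.
  (* Each term pairs one entry of [Phi] with one entry of [eta], so entrywise independence
     suffices. *)
  rewrite (independent_ge0_expectationM (f := fun w => Phi t w i j ^+ 2) (g := fun w => eta w j 0 ^+ 2)); first last.
  - by move=> w; exact: sqr_ge0.
  - by move=> w; exact: sqr_ge0.
  - by apply: (independent_fun_comp (u := fun x => x ^+ 2) (v := fun x => x ^+ 2)) => //; exact: Phi_eta.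
  - exact: measurable_funX.
  - exact: measurable_funX.
  apply: lee_wpmul2l; first exact: integral_sqr_ge0.
  apply: ge0_le_integral => //.
  - by move=> w _; rewrite lee_fin sqr_ge0.
  - exact: measurable_sqr_EFin.
  - by apply/measurable_EFinP; exact: measurable_vsq.
  - move=> w _; rewrite lee_fin /vsq (bigD1 j)//= lerDl.
    by apply: sumr_ge0 => k _; exact: sqr_ge0.
apply: (le_trans hD); apply: leeD.
  by rewrite EFinM -muleA lee_wpmul2l// lee_fin.
by rewrite EFinM -muleA lee_wpmul2l// lee_fin.
Qed.

End mean_square_bound.

(** * Quadratic cost *)

Section quadratic_cost.
Context {R : realType}.

(** The l^1 norm, for which products with bounded matrices are estimated without square roots;
    [norm1_sqr_le] trades it for [vsq] at the end. *)
Definition norm1 (n : nat) (x : 'cV[R]_n) : R := \sum_i `|x i 0|.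

Lemma norm1_ge0 n (x : 'cV[R]_n) : 0 <= norm1 x.
Proof. exact: sumr_ge0. Qed.

Lemma norm1D n (x y : 'cV[R]_n) : norm1 (x + y) <= norm1 x + norm1 y.
Proof.
by rewrite /norm1 -big_split/=; apply: ler_sum => i _; rewrite mxE ler_normD.
Qed.

Lemma norm1_bounded n c (x : 'cV[R]_n) : (forall i j, `|x i j| <= c) ->
  norm1 x <= n%:R * c.
Proof.
move=> xc; apply: (@le_trans _ _ (\sum_(i < n) c)); first exact: ler_sum.
by rewrite sumr_const card_ord mulr_natl.
Qed.

Lemma norm1_mulmx k n c (M : 'M[R]_(k, n)) x : (forall i j, `|M i j| <= c) ->
  norm1 (M *m x) <= k%:R * c * norm1 x.
Proof.
move=> Mc; apply: (@le_trans _ _ (\sum_(i < k) c * norm1 x)); last first.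
  by rewrite sumr_const card_ord -mulrA mulr_natl.
apply: ler_sum => i _; rewrite mxE mulr_sumr.
apply: (le_trans (ler_norm_sum _ _ _)); apply: ler_sum => j _.
by rewrite normrM ler_wpM2r.
Qed.

Lemma dotv_norm1 n c (x y : 'cV[R]_n) : (forall i, `|x i 0| <= c) ->
  `|dotv x y| <= c * norm1 y.
Proof.
move=> xc; rewrite mulr_sumr; apply: (le_trans (ler_norm_sum _ _ _)).
by apply: ler_sum => i _; rewrite normrM ler_wpM2r.
Qed.

Lemma dotv_mulmx_norm1 k n c (M : 'M[R]_(k, n)) x y : (forall i j, `|M i j| <= c) ->
  `|dotv (M *m x) y| <= c * norm1 x * norm1 y.
Proof.
move=> Mc; apply: dotv_norm1 => i; rewrite mxE mulr_sumr.
apply: (le_trans (ler_norm_sum _ _ _)); apply: ler_sum => j _.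
by rewrite normrM ler_wpM2r.
Qed.

Lemma dotvDl n (x y z : 'cV[R]_n) : dotv (x + y) z = dotv x z + dotv y z.
Proof. by rewrite /dotv -big_split/=; apply: eq_bigr => i _; rewrite mxE mulrDl. Qed.

Lemma dotvDr n (x y z : 'cV[R]_n) : dotv z (x + y) = dotv z x + dotv z y.
Proof. by rewrite /dotv -big_split/=; apply: eq_bigr => i _; rewrite mxE mulrDr. Qed.

Lemma norm1_sqr_le n (x : 'cV[R]_n) : norm1 x ^+ 2 <= n%:R * vsq x.
Proof.
apply: (le_trans (sqr_sum_le _)); rewrite ler_wpM2l// /vsq.
by apply: ler_sum => i _; rewrite real_normK// num_real.
Qed.

(** The running cost with time and sample point frozen, in the same shape as [running_cost], so that
    pointwise bounds transfer by conversion. *)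
Definition cost (n m : nat) (Q : 'M[R]_n) (S : 'M[R]_(m, n)) (Rm : 'M[R]_m)
    (q : 'cV[R]_n) (rho : 'cV[R]_m) (x : 'cV[R]_n) (u : 'cV[R]_m) : R :=
  dotv (Q *m x) x + 2 * dotv (S *m x) u + dotv (Rm *m u) u
  + 2 * dotv q x + 2 * dotv rho u.

Variables (n m : nat) (c : R) (Q : 'M[R]_n) (S : 'M[R]_(m, n)) (Rm : 'M[R]_m).
Variables (q : 'cV[R]_n) (rho : 'cV[R]_m) (Theta : 'M[R]_(m, n)) (v : 'cV[R]_m).
Hypotheses (c0 : 0 <= c) (Qc : forall i j, `|Q i j| <= c)
  (Sc : forall i j, `|S i j| <= c) (Rc : forall i j, `|Rm i j| <= c)
  (qc : forall i j, `|q i j| <= c) (rhoc : forall i j, `|rho i j| <= c)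
  (Thetac : forall i j, `|Theta i j| <= c) (vc : forall i j, `|v i j| <= c).

Let U := m%:R * c.

Let U0 : 0 <= U. Proof. by rewrite mulr_ge0. Qed.

(** Counts the terms of the cost difference: 4 from [Q] and [q], 6 U from [S] and [rho], 2 U^2 from
    [Rm], where [U] bounds the growth of the control. Each bilinear term splits in two, and the
    factors 2 of the cost are included. *)
Definition cost_const := c * (4 + 6 * U + 2 * U ^+ 2).

Lemma cost_const_ge0 : 0 <= cost_const.
Proof. by rewrite mulr_ge0// !addr_ge0// ?mulr_ge0// sqr_ge0. Qed.

Let control x := Theta *m x + v.

Let norm1_control x : norm1 (control x) <= U * (1 + norm1 x).
Proof.
apply: (le_trans (norm1D _ _)); rewrite mulrDr mulr1 addrC lerD//.
  exact: norm1_bounded.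
exact: norm1_mulmx.
Qed.

(** Every term is at most a multiple of (1 + r)^2 with r the l^1 norm of [x], and this is at most 2
    (1 + n vsq x). The bound supplies the integrability of the cost along the periodic state. *)
Lemma cost_bound x : `|cost Q S Rm q rho x (control x)| <=
  2 * cost_const * (1 + n%:R * vsq x).
Proof.
have r0 := norm1_ge0 x; have u0 := norm1_ge0 (control x).
have ub := norm1_control x; have r2 := norm1_sqr_le x.
have h1 := dotv_mulmx_norm1 x x Qc.
have h2 := dotv_mulmx_norm1 x (control x) Sc.
have h3 := dotv_mulmx_norm1 (control x) (control x) Rc.
have h4 := dotv_norm1 x (fun i => qc i 0).
have h5 := dotv_norm1 (control x) (fun i => rhoc i 0).
set r := norm1 x in r0 ub r2 h1 h2 h3 h4 h5 *.
set u := norm1 (control x) in u0 ub h2 h3 h5 *.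
have s1 : 1 <= 1 + r by rewrite lerDl.
have rs : r <= 1 + r by rewrite lerDr.
have s0 : 0 <= 1 + r by rewrite addr_ge0.
have k1 : c * r * r <= c * (1 + r) ^+ 2.
  by have := ler_wpM2l c0 (ler_pM r0 r0 rs rs); rewrite mulrA -expr2.
have k2 : c * r * u <= c * U * (1 + r) ^+ 2.
  have := ler_wpM2l c0 (ler_pM r0 u0 rs ub); rewrite mulrA => /le_trans; apply.
  by rewrite le_eqVlt; apply/orP; left; apply/eqP; ring.
have k3 : c * u * u <= c * U ^+ 2 * (1 + r) ^+ 2.
  have := ler_wpM2l c0 (ler_pM u0 u0 ub ub); rewrite mulrA => /le_trans; apply.
  by rewrite le_eqVlt; apply/orP; left; apply/eqP; ring.
have k4 : c * r <= c * (1 + r) ^+ 2.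
  have := ler_wpM2l c0 (ler_pM r0 ler01 rs s1); rewrite mulr1 => /le_trans; apply.
  by rewrite expr2.
have k5 : c * u <= c * U * (1 + r) ^+ 2.
  have := ler_wpM2l c0 (ler_pM u0 ler01 ub s1); rewrite mulr1 => /le_trans; apply.
  by rewrite le_eqVlt; apply/orP; left; apply/eqP; ring.
have s2 : (1 + r) ^+ 2 <= 2 * (1 + n%:R * vsq x).
  by have := sqr_ge0 (1 - r); nra.
have K0 := cost_const_ge0.
apply: (@le_trans _ _ (cost_const * (1 + r) ^+ 2)); last first.
  have -> : 2 * cost_const * (1 + n%:R * vsq x) = cost_const * (2 * (1 + n%:R * vsq x)) by ring.
  by apply: ler_wpM2l.
rewrite /cost.
have tri (a1 a2 a3 a4 a5 : R) : `|a1 + 2 * a2 + a3 + 2 * a4 + 2 * a5| <=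
    `|a1| + 2 * `|a2| + `|a3| + 2 * `|a4| + 2 * `|a5|.
  have e (z : R) : 2 * `|z| = `|2 * z| by rewrite normrM ger0_norm.
  by rewrite !e; do 3![apply: (le_trans (ler_normD _ _)); rewrite lerD2r//]; exact: ler_normD.
apply: (le_trans (tri _ _ _ _ _)).
rewrite /cost_const; set z := (1 + r) ^+ 2 in k1 k2 k3 k4 k5 *.
have z0 : 0 <= z by exact: sqr_ge0.
have cUz : 0 <= c * U * z by rewrite !mulr_ge0.
have cU2z : 0 <= c * U ^+ 2 * z by rewrite !mulr_ge0// sqr_ge0.
have cz : 0 <= c * z by rewrite !mulr_ge0.
have -> : c * (4 + 6 * U + 2 * U ^+ 2) * z =
  4 * (c * z) + 6 * (c * U * z) + 2 * (c * U ^+ 2 * z) by ring.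
lra.
Qed.

(** Each term of the difference contains a factor D = x - y, so the whole is at most a multiple of p
    (1 + r + p), with p and r the norms of D and [x]. Young's inequality with weight [e] separates
    p^2 from 1 + r^2. The weight is left free because the time average of 1 + r^2 does not vanish
    and only a small [e] suppresses it. *)
Lemma cost_diff_bound x y (e : R) : 0 < e ->
  `|cost Q S Rm q rho x (control x) - cost Q S Rm q rho y (control y)| <=
  cost_const * ((1 + e^-1) * (n%:R * vsq (x - y)) + e * (1 + n%:R * vsq x)).
Proof.
move=> e0; set D := x - y.
have r0 := norm1_ge0 x; have p0 := norm1_ge0 D.
have r2 := norm1_sqr_le x; have p2 := norm1_sqr_le D.
have yE : y = x - D by rewrite /D; apply/matrixP => i j; rewrite !mxE; ring.
have norm1N (z : 'cV[R]_n) : norm1 (- z) = norm1 z.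
  by apply: eq_bigr => i _; rewrite mxE normrN.
have yb : norm1 y <= norm1 x + norm1 D.
  by rewrite yE; apply: (le_trans (norm1D _ _)); rewrite norm1N.
have y0 := norm1_ge0 y.
have dub : norm1 (Theta *m D) <= U * norm1 D by exact: norm1_mulmx.
have du0 := norm1_ge0 (Theta *m D).
have u1b := norm1_control x; have u10 := norm1_ge0 (control x).
have u2b := norm1_control y; have u20 := norm1_ge0 (control y).
have uE : control x = control y + Theta *m D.
  by rewrite /control /D mulmxBr; move: (Theta *m x) (Theta *m y) => a b0; apply/matrixP => i j; rewrite !mxE; ring.
have xE : x = y + D by rewrite /D; apply/matrixP => i j; rewrite !mxE; ring.
(* The products are telescoped so that each summand carries [D] or its image under [Theta]. *)
have dec : cost Q S Rm q rho x (control x) - cost Q S Rm q rho y (control y) =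
    (dotv (Q *m D) x + dotv (Q *m y) D)
    + 2 * (dotv (S *m D) (control x) + dotv (S *m y) (Theta *m D))
    + (dotv (Rm *m (Theta *m D)) (control x) + dotv (Rm *m control y) (Theta *m D))
    + 2 * dotv q D + 2 * dotv rho (Theta *m D).
  have gen (y' D' : 'cV[R]_n) (w w' : 'cV[R]_m) :
      cost Q S Rm q rho (y' + D') (w + w') - cost Q S Rm q rho y' w =
      (dotv (Q *m D') (y' + D') + dotv (Q *m y') D')
      + 2 * (dotv (S *m D') (w + w') + dotv (S *m y') w')
      + (dotv (Rm *m w') (w + w') + dotv (Rm *m w) w')
      + 2 * dotv q D' + 2 * dotv rho w'.
    by rewrite /cost !mulmxDr !dotvDl !dotvDr; ring.
  by have := gen y D (control y) (Theta *m D); rewrite -xE -uE.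
rewrite dec {dec}.
have h1 := dotv_mulmx_norm1 D x Qc.
have h2 := dotv_mulmx_norm1 y D Qc.
have h3 := dotv_mulmx_norm1 D (control x) Sc.
have h4 := dotv_mulmx_norm1 y (Theta *m D) Sc.
have h5 := dotv_mulmx_norm1 (Theta *m D) (control x) Rc.
have h6 := dotv_mulmx_norm1 (control y) (Theta *m D) Rc.
have h7 := dotv_norm1 D (fun i => qc i 0).
have h8 := dotv_norm1 (Theta *m D) (fun i => rhoc i 0).
set p := norm1 D in p0 p2 yb dub h1 h2 h3 h7 *.
set r := norm1 x in r0 r2 yb u1b h1 *.
set du := norm1 (Theta *m D) in dub du0 h4 h5 h6 h8 *.
set u1 := norm1 (control x) in u1b u10 h3 h5 *.
set u2 := norm1 (control y) in u2b u20 h6 *.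
set y1 := norm1 y in yb y0 u2b h2 h4 *.
pose s := 1 + r + p.
have s1 : 1 <= s by rewrite /s -addrA lerDl addr_ge0.
have s0 : 0 <= s by exact: le_trans s1.
have rs : r <= s by rewrite /s; lra.
have ys : y1 <= s by rewrite /s; lra.
have u1s : u1 <= U * s by apply: (le_trans u1b); rewrite ler_wpM2l// /s; lra.
have u2s : u2 <= U * s by apply: (le_trans u2b); rewrite ler_wpM2l// /s; lra.
have mul3 (a a' b b' : R) : 0 <= a -> 0 <= b -> a <= a' -> b <= b' ->
    c * a * b <= c * (a' * b').
  by move=> a0 b0 aa bb; rewrite -mulrA ler_wpM2l// ler_pM.
have k1 := le_trans h1 (mul3 _ _ _ _ p0 r0 (lexx p) rs).
have k2 := le_trans h2 (mul3 _ _ _ _ y0 p0 ys (lexx p)).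
have k3 := le_trans h3 (mul3 _ _ _ _ p0 u10 (lexx p) u1s).
have k4 := le_trans h4 (mul3 _ _ _ _ y0 du0 ys dub).
have k5 := le_trans h5 (mul3 _ _ _ _ du0 u10 dub u1s).
have k6 := le_trans h6 (mul3 _ _ _ _ u20 du0 u2s dub).
have k7 : `|dotv q D| <= c * (p * s).
  by apply: (le_trans h7); rewrite ler_wpM2l// ler_peMr.
have k8 : `|dotv rho (Theta *m D)| <= c * (U * p * s).
  apply: (le_trans h8); rewrite ler_wpM2l// (le_trans dub)// ler_peMr//.
  exact: mulr_ge0.
have psle : p * s <= (1 + e^-1) * (n%:R * vsq D) + e * (1 + n%:R * vsq x).
  have ei : 0 < e^-1 by rewrite invr_gt0.
  have ee : e * e^-1 = 1 by rewrite divff// gt_eqF.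
  have q1 : p <= p ^+ 2 * e^-1 / 2 + e / 2.
    have := mulr_ge0 (ltW ei) (sqr_ge0 (p - e)).
    have -> : e^-1 * (p - e) ^+ 2 = p ^+ 2 * e^-1 - 2 * p * (e * e^-1) + e * (e * e^-1) by ring.
    rewrite ee; lra.
  have q2 : p * r <= p ^+ 2 * e^-1 / 2 + e * r ^+ 2 / 2.
    have := mulr_ge0 (ltW ei) (sqr_ge0 (p - e * r)).
    have -> : e^-1 * (p - e * r) ^+ 2 =
      p ^+ 2 * e^-1 - 2 * (p * r) * (e * e^-1) + e * r ^+ 2 * (e * e^-1) by ring.
    rewrite ee; lra.
  have q3 := ler_wpM2l (ltW ei) p2.
  have q4 := ler_wpM2l (ltW e0) r2.
  have q5 : 0 <= e * r ^+ 2 by rewrite mulr_ge0 ?sqr_ge0// ltW.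
  rewrite /s; lra.
apply: (@le_trans _ _ (cost_const * (p * s))); last by rewrite ler_wpM2l// cost_const_ge0.
set t1 := dotv (Q *m D) x in k1 *; set t2 := dotv (Q *m y) D in k2 *.
set t3 := dotv (S *m D) _ in k3 *; set t4 := dotv (S *m y) _ in k4 *.
set t5 := dotv (Rm *m (Theta *m D)) _ in k5 *; set t6 := dotv (Rm *m control y) _ in k6 *.
set t7 := dotv q D in k7 *; set t8 := dotv rho _ in k8 *.
have -> : cost_const * (p * s) = 4 * (c * (p * s)) + 6 * (c * (U * p * s)) +
  2 * (c * (U * p * (U * s))) by rewrite /cost_const; ring.
have e1 : c * (s * p) = c * (p * s) by ring.
have e3 : c * (p * (U * s)) = c * (U * p * s) by ring.
have e4 : c * (s * (U * p)) = c * (U * p * s) by ring.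
have e6 : c * (U * s * (U * p)) = c * (U * p * (U * s)) by ring.
rewrite e1 in k2; rewrite e3 in k3; rewrite e4 in k4; rewrite e6 in k6.
move: k1 k2 k3 k4 k5 k6 k7 k8; rewrite !ler_norml.
set A := c * (p * s); set B := c * (U * p * s); set C := c * (U * p * (U * s)).
move=> /andP[? ?] /andP[? ?] /andP[? ?] /andP[? ?] /andP[? ?] /andP[? ?] /andP[? ?] /andP[? ?].
by apply/andP; split; lra.
Qed.

End quadratic_cost.

(** * Time averages of random periodic processes *)

Section periodic_integral.
Context {R : realType}.
Notation mu := (@lebesgue_measure R).
Local Open Scope ereal_scope.

Lemma measurable_shift (a : R) :
  measurable_fun setT ((fun x => x + a)%R : R -> measurableTypeR R).
Proof. by apply: measurable_funD. Qed.

Lemma lebesgue_measure_shift (a : R) (A : set R) : measurable A ->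
  pushforward mu ((fun x => x + a)%R : _ -> measurableTypeR R) A = mu A.
Proof.
have ms := measurable_shift a.
move=> mA; apply/esym/lebesgue_measure_unique => //= _ [[x y]] _ <-.
rewrite /pushforward.
have -> : (fun z : R => z + a)%R @^-1` `]x, y] = `](x - a)%R, (y - a)%R]%classic.
  by apply/seteqP; split => t /=; rewrite !in_itv/= ltrBlDr lerBrDr.
rewrite !lebesgue_measure_itv/= !lte_fin ltrD2r; case: ifP => // _.
by rewrite -!EFinB; congr EFin; ring.
Qed.

Lemma ge0_integral_shift (a : R) (f : R -> \bar R) : measurable_fun setT f ->
  (forall x, 0 <= f x) -> \int[mu]_x f (x + a)%R = \int[mu]_x f x.
Proof.
have ms := measurable_shift a.
move=> mf f0.
transitivity (\int[pushforward mu ((fun x => x + a)%R : _ -> measurableTypeR R)]_x f x).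
  by rewrite ge0_integral_pushforward//= preimage_setT.
by apply: eq_measure_integral => //= A mA _; exact: lebesgue_measure_shift.
Qed.

Variables (tau : R) (phi : R -> \bar R).
Hypothesis tau0 : (0 < tau)%R.
Hypothesis mphi : forall S : R, (0 <= S)%R -> measurable_fun `[0%R, S] phi.
Hypothesis phi0 : forall t : R, (0 <= t)%R -> 0 <= phi t.
Hypothesis phi_per : forall t : R, (0 <= t)%R -> phi (t + tau)%R = phi t.

Let Psi (S : R) := \int[mu]_(t in `[0%R, S]) phi t.

Let Psi_le S S' : (S <= S')%R -> (0 <= S')%R -> Psi S <= Psi S'.
Proof.
move=> SS' S'0; apply: ge0_subset_integral => //; first exact: mphi.
  by move=> t /=; rewrite in_itv/= => /andP[t0 _]; exact: phi0.
by apply: subset_itvl; rewrite bnd_simp.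
Qed.

Let Psi_ge0 S : 0 <= Psi S.
Proof. by apply: integral_ge0 => t /=; rewrite in_itv/= => /andP[t0 _]; exact: phi0. Qed.

Let Psi_shift S : (0 <= S)%R -> Psi (S + tau)%R = Psi tau + Psi S.
Proof.
move=> S0.
have St0 : (0 <= S + tau)%R by rewrite addr_ge0// ltW.
have split_itv : `[0%R, (S + tau)%R]%classic = `[0%R, tau] `|` `]tau, (S + tau)%R].
  apply/seteqP; split => s /=; rewrite !in_itv/=.
    by move=> /andP[s0 sr]; case: (leP s tau) => h; [left|right]; rewrite ?s0.
  case=> /andP[s0 sr]; first by rewrite s0 (le_trans sr)// lerDr.
  by rewrite sr (le_trans (ltW tau0) (ltW s0)).
rewrite {1}/Psi split_itv ge0_integral_setU//; last 3 first.
- by rewrite -split_itv; exact: mphi.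
- by move=> s; rewrite -split_itv /= in_itv/= => /andP[s0 sr]; apply: phi0.
- apply/disj_setPS => s [] /=; rewrite !in_itv/= => /andP[_ sr] /andP[rs _].
  by move: (lt_le_trans rs sr); rewrite ltxx.
congr (_ + _).
have mtS : measurable_fun `]tau, (S + tau)%R] phi.
  by apply: measurable_funS (mphi St0) => //; rewrite split_itv; exact: subsetUr.
rewrite integral_mkcond -(ge0_integral_shift tau); last 2 first.
- by apply/(measurable_restrictT phi (measurable_itv _)).
- move=> t; rewrite patchE; case: ifPn => //; rewrite inE/= in_itv/= => /andP[h _].
  by apply: phi0; rewrite (le_trans (ltW tau0))// ltW.
(* Translation turns []tau, S + tau]] into []0, S]]; the missing endpoint 0 has measure zero. *)
rewrite /Psi -integral_itv_obnd_cbnd; last first.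
  apply: measurable_funS (mphi S0) => //; apply: subset_itvr; by rewrite bnd_simp.
rewrite [RHS]integral_mkcond; apply: eq_integral => t _.
rewrite !patchE !mem_setE !in_itv/= ltrDr lerD2r.
by case: ifP => // /andP[t0 _]; rewrite phi_per// ltW.
Qed.

Let Psi_mul (k : nat) : Psi (k%:R * tau)%R = k%:R%:E * Psi tau.
Proof.
elim: k => [|k IH]; first by rewrite mul0r mul0e /Psi set_itv1 integral_set1.
rewrite -natr1 mulrDl mul1r Psi_shift ?mulr_ge0// ?(ltW tau0)// IH addeC.
by rewrite EFinD ge0_muleDl ?lee_fin// mul1e.
Qed.

(** With k the integer part of S / tau, [S] lies between k tau and (k + 1) tau. The integral of a
    nonnegative function is monotone in the horizon, so it lies between k a and (k + 1) a. *)
Lemma periodic_integral_bounds (a S : R) : \int[mu]_(t in `[0%R, tau]) phi t = a%:E ->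
  (0 <= S)%R ->
  (S / tau * a - a)%:E <= \int[mu]_(t in `[0%R, S]) phi t <= (S / tau * a + a)%:E.
Proof.
move=> Pa S0; rewrite -/(Psi S).
have a0 : (0 <= a)%R by rewrite -lee_fin -Pa; exact: Psi_ge0.
have St0 : (0 <= S / tau)%R by rewrite divr_ge0// ltW.
have /andP[kS Sk] := truncn_itv St0; set k := Num.truncn _ in kS Sk.
have h1 : (k%:R * tau <= S)%R by rewrite -ler_pdivlMr.
have h2 : (S <= k.+1%:R * tau)%R by rewrite -ler_pdivrMr// ltW.
apply/andP; split.
  apply: (@le_trans _ _ (Psi (k%:R * tau)%R)); last exact: Psi_le.
  rewrite Psi_mul /Psi Pa -EFinM lee_fin.
  have := ler_wpM2r a0 (ltW Sk); rewrite -natr1; lra.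
apply: (@le_trans _ _ (Psi (k.+1%:R * tau)%R)).
  by apply: Psi_le; rewrite ?mulr_ge0 ?(ltW tau0).
rewrite Psi_mul /Psi Pa -EFinM lee_fin.
have := ler_wpM2r a0 kS; rewrite -natr1; lra.
Qed.

End periodic_integral.

Section random_periodic_integral.
Context {R : realType} {d : measure_display} {T : measurableType d}.
Variables (P : probability T R) (theta : R -> T -> T) (tau : R).
Hypothesis tau0 : 0 < tau.
Hypothesis mtheta : measurable_fun setT (theta tau).
Hypothesis Ptheta : forall E : set T, measurable E -> P (theta tau @^-1` E) = P E.
Notation mu := (@lebesgue_measure R).

(** Since [theta tau] preserves the measure, the expectation of [f] at a given time is
    [tau]-periodic, although the paths need not be. *)
Lemma random_periodic_expected_integral (f : R -> T -> R) (a S : R) :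
    (forall S, 0 <= S -> jointly_measurable S f) -> (forall t w, 0 <= f t w) ->
    random_periodic P theta tau f -> expected_integral P tau f = a%:E -> 0 <= S ->
  ((S / tau * a - a)%:E <= expected_integral P S f <= (S / tau * a + a)%:E)%E.
Proof.
move=> mf f0 pf; rewrite expected_integral_swap//; last by apply: mf; exact: ltW.
move=> fa S0; rewrite expected_integral_swap//; last exact: mf.
apply: periodic_integral_bounds => //.
- by move=> S' S'0; apply: measurable_expectation_time => //; exact: mf.
- by move=> t t0; apply: integral_ge0 => w _; rewrite lee_fin.
move=> t t0.
have mft s : 0 <= s -> measurable_fun setT (f s).
  by move=> s0; apply: (jointly_measurable_slice (S := s)); [rewrite s0 lexx|exact: mf].
transitivity (\int[P]_w (f t (theta tau w))%:E)%E.
  apply: ge0_ae_eq_integral => //.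
  - by apply/measurable_EFinP; apply: mft; rewrite addr_ge0// ltW.
  - apply/measurable_EFinP; apply: measurableT_comp => //; exact: mft.
  - by move=> w _; rewrite lee_fin.
  - by move=> w _; rewrite lee_fin.
  - by apply: filterS (pf t t0) => w -> _.
transitivity (\int[pushforward P (theta tau)]_w (f t w)%:E)%E.
  rewrite ge0_integral_pushforward//=; first exact/measurable_EFinP/mft.
  by move=> w _; rewrite lee_fin.
by apply: eq_measure_integral => //= A mA _; exact: Ptheta.
Qed.

End random_periodic_integral.

(** * Comparison of ergodic averages *)

Section liminf.
Context {R : realType}.

(** The two-sided bounds make this an ordinary limit, with which the lower limit agrees. *)
Lemma limf_einf_pinfty (f : R -> \bar R) (l : R) :
  (forall e : R, 0 < e -> \forall S \near +oo%R, ((l - e)%:E <= f S <= (l + e)%:E)%E) ->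
  limf_einf f (pinfty_nbhs R) = l%:E.
Proof.
move=> fl; rewrite limf_einfE; apply/eqP; rewrite eq_le; apply/andP; split.
  apply: ge_ereal_sup => _ [V FV <-].
  apply/lee_addgt0Pr => e e0.
  have [S [/andP[_ h] VS]] : exists S, ((l - e)%:E <= f S <= (l + e)%:E)%E /\ V S.
    have [M1 [_ h1]] := fl e e0; have [M2 [_ h2]] := FV.
    exists (Num.max M1 M2 + 1); split; [apply: h1|apply: h2].
      by apply: (@le_lt_trans _ _ (Num.max M1 M2)); rewrite ?ltrDl// le_max lexx.
    by apply: (@le_lt_trans _ _ (Num.max M1 M2)); rewrite ?ltrDl// le_max lexx orbT.
  apply: le_trans (_ : f S <= _)%E; last by rewrite -EFinD.
  by apply: ereal_inf_lbound; exists S.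
apply/lee_addgt0Pr => e e0; rewrite -leeBlDr//.
apply: (@le_trans _ _ (ereal_inf (f @` [set S | (l - e)%:E <= f S <= (l + e)%:E]%E))).
  by apply: le_ereal_inf_tmp => _ [S /andP[h _] <-]; rewrite -EFinB.
by apply: ereal_sup_ubound; eexists; last reflexivity; exact: fl.
Qed.

End liminf.

Section slab_integrals.
Context {R : realType} {d : measure_display} {T : measurableType d}.
Variable P : probability T R.
Notation mu := (@lebesgue_measure R).

Lemma slab_integrable S (f g : R -> T -> R) : jointly_measurable S f ->
    jointly_measurable S g -> (forall t w, 0 <= t <= S -> 0 <= g t w) ->
    {ae (mu \x P)%E, forall p : R * T, 0 <= p.1 <= S -> `|f p.1 p.2| <= g p.1 p.2} ->
    (expected_integral P S g < +oo)%E ->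
  (mu \x P)%E.-integrable (time_slab S) (fun p => (f p.1 p.2)%:E).
Proof.
move=> mf mg g0 fg goo; apply/integrableP; split; first exact/measurable_EFinP.
apply: le_lt_trans goo.
have -> : (\int[mu \x P]_(p in time_slab S) `|(f p.1 p.2)%:E| =
    expected_integral P S (fun t w => `|f t w|%R))%E.
  rewrite expected_integralE//; exact: measurableT_comp.
by apply: le_expected_integral => //; exact: measurableT_comp.
Qed.

Lemma slab_integral_fin_num S (f : R -> T -> R) :
  (mu \x P)%E.-integrable (time_slab S) (fun p => (f p.1 p.2)%:E) ->
  (\int[mu \x P]_(p in time_slab S) (f p.1 p.2)%:E)%E \is a fin_num.
Proof. by move=> fi; apply: integrable_fin_num => //; exact: measurable_time_slab. Qed.

(** Fubini for signed integrands, complementing the nonnegative case of [expected_integralE]. *)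
Lemma expected_integral_integrable S (f : R -> T -> R) :
  (mu \x P)%E.-integrable (time_slab S) (fun p => (f p.1 p.2)%:E) ->
  (expected_integral P S f = \int[mu \x P]_(p in time_slab S) (f p.1 p.2)%:E)%E.
Proof.
move=> fi0.
have fi : (mu \x P)%E.-integrable setT ((fun p : R * T => (f p.1 p.2)%:E) \_ (time_slab S)).
  have [h _] := @integrable_mkcond _ _ R (mu \x P)%E (time_slab S)
    (fun p : R * T => (f p.1 p.2)%:E) (measurable_time_slab S).
  exact: (h fi0).
rewrite [RHS]integral_mkcond -(integral21_prod_meas1 fi).
rewrite /expected_integral; apply: eq_integral => w _.
rewrite integral_mkcond /fubini_G; apply: eq_integral => t _.
by rewrite time_slab_patch.
Qed.

Lemma expected_integralD S (f g : R -> T -> R) : jointly_measurable S f ->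
    jointly_measurable S g -> (forall t w, 0 <= f t w) -> (forall t w, 0 <= g t w) ->
  (expected_integral P S (fun t w => (f t w + g t w)%R) =
   expected_integral P S f + expected_integral P S g)%E.
Proof.
move=> mf mg f0 g0; rewrite !expected_integralE//; last 2 first.
- exact: measurable_funD.
- by move=> t w _; rewrite addr_ge0.
under eq_integral do rewrite EFinD.
rewrite ge0_integralD; first by [].
- exact: measurable_time_slab.
- by move=> p _; rewrite lee_fin.
- exact/measurable_EFinP.
- by move=> p _; rewrite lee_fin.
- exact/measurable_EFinP.
Qed.

Lemma expected_integral_cst S (k : R) : 0 <= S ->
  (expected_integral P S (fun _ _ => k) = (k * S)%:E)%E.
Proof.
move=> S0.
have muS : mu `[0, S] = S%:E.
  rewrite lebesgue_measure_itv/= lte_fin; case: ltP => [_|S0']; first by rewrite sube0.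
  by congr EFin; apply/eqP; rewrite eq_le S0 S0'.
have inner : (\int[mu]_(t in `[0%R, S]) k%:E = (k * S)%:E)%E.
  by rewrite (integral_cst mu _ k%:E)// EFinM; congr (_ * _)%E.
rewrite /expected_integral (eq_integral (cst (k * S)%:E)); last by move=> w _; rewrite inner.
by rewrite integral_cst// [X in (_ * X)%E]probability_setT mule1.
Qed.

End slab_integrals.

Section ergodic_limit.
Context {R : realType} {d : measure_display} {T : measurableType d}.
Variables (P : probability T R) (theta : R -> T -> T) (tau : R).
Hypothesis tau0 : 0 < tau.
Hypothesis mtheta : measurable_fun setT (theta tau).
Hypothesis Ptheta : forall E : set T, measurable E -> P (theta tau @^-1` E) = P E.
Notation mu := (@lebesgue_measure R).

(** [F1] stands for the cost along the periodic state, [F2] for the cost along the state started at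
    the given point, [Dq] for the squared difference of the two states and [Xq] for the squared norm
    of the periodic one. [kD] bounds the integral of [Dq] over all horizons at once. *)
Variables (F1 F2 Dq Xq : R -> T -> R) (K K' N kD : R).
Hypotheses (K0 : 0 <= K) (K'0 : 0 <= K') (N0 : 0 <= N).
Hypothesis mF1 : forall S, 0 <= S -> jointly_measurable S F1.
Hypothesis mF2 : forall S, 0 <= S -> jointly_measurable S F2.
Hypothesis mDq : forall S, 0 <= S -> jointly_measurable S Dq.
Hypothesis mXq : forall S, 0 <= S -> jointly_measurable S Xq.
Hypothesis Dq0 : forall t w, 0 <= Dq t w.
Hypothesis Xq0 : forall t w, 0 <= Xq t w.
Hypothesis F1_per : random_periodic P theta tau F1.
Hypothesis Xq_per : random_periodic P theta tau Xq.
Hypothesis Dq_le : forall S, 0 <= S -> (expected_integral P S Dq <= kD%:E)%E.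
Hypothesis Xq_lty : (expected_integral P tau Xq < +oo)%E.
Hypothesis F1_le : {ae (mu \x P)%E, forall p : R * T, 0 <= p.1 ->
  `|F1 p.1 p.2| <= K' * (1 + N * Xq p.1 p.2)}.
Hypothesis F12_le : forall e, 0 < e -> {ae (mu \x P)%E, forall p : R * T, 0 <= p.1 ->
  `|F1 p.1 p.2 - F2 p.1 p.2| <=
  K * ((1 + e^-1) * (N * Dq p.1 p.2) + e * (1 + N * Xq p.1 p.2))}.

Let b := fine (expected_integral P tau Xq).

Let Xq_tau : expected_integral P tau Xq = b%:E.
Proof.
rewrite /b fineK// ge0_fin_numE//; apply: integral_ge0 => w _.
by apply: integral_ge0 => t _; rewrite lee_fin.
Qed.

Let b0 : 0 <= b.
Proof.
rewrite -lee_fin -Xq_tau; apply: integral_ge0 => w _.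
by apply: integral_ge0 => t _; rewrite lee_fin.
Qed.

Let Xq_le S : 0 <= S -> (expected_integral P S Xq <= (S / tau * b + b)%:E)%E.
Proof.
move=> S0.
by case/andP: (random_periodic_expected_integral tau0 mtheta Ptheta mXq Xq0 Xq_per Xq_tau S0).
Qed.

Let gX t w := 1 + N * Xq t w.

Let gX0 t w : 0 <= gX t w. Proof. by rewrite addr_ge0// mulr_ge0. Qed.

Let mgX S : 0 <= S -> jointly_measurable S gX.
Proof.
move=> S0; apply: measurable_funD; first exact: measurable_cst.
by apply: measurable_funM => //; exact: mXq.
Qed.

Let gX_le S : 0 <= S ->
  (expected_integral P S gX <= (S + N * (S / tau * b + b))%:E)%E.
Proof.
move=> S0.
have m1 : jointly_measurable S (fun (_ : R) (_ : T) => 1 : R) by exact: measurable_cst.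
have m2 : jointly_measurable S (fun t w => N * Xq t w).
  by apply: measurable_funM => //; exact: mXq.
have h2 t w : 0 <= N * Xq t w by rewrite mulr_ge0.
rewrite (expected_integralD P m1 m2 (fun _ _ => ler01) h2).
rewrite expected_integral_cst// mul1r EFinD; apply: leeD2l.
rewrite (expected_integralZ P N0 (mXq S0) (fun t w _ => Xq0 t w)) EFinM.
by apply: lee_wpmul2l; rewrite ?lee_fin// Xq_le.
Qed.

Let g e t w := K * ((1 + e^-1) * (N * Dq t w) + e * gX t w).

Let g0 e t w : 0 < e -> 0 <= g e t w.
Proof.
move=> e0; rewrite mulr_ge0// addr_ge0//.
  by rewrite mulr_ge0 ?addr_ge0 ?invr_ge0 ?(ltW e0)// mulr_ge0.
by rewrite mulr_ge0 ?(ltW e0).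
Qed.

Let mg e S : 0 <= S -> jointly_measurable S (g e).
Proof.
move=> S0; apply: measurable_funM => //; apply: measurable_funD.
  by apply: measurable_funM => //; apply: measurable_funM => //; exact: mDq.
by apply: measurable_funM => //; exact: mgX.
Qed.

(** Only the term with factor [e] grows with [S]; the term with [e^-1] stays bounded because [kD]
    does not depend on the horizon. After division by [S] the former is of order [e] and the latter
    vanishes in the limit. *)
Let gbound e S := K * ((1 + e^-1) * (N * kD) + e * (S + N * (S / tau * b + b))).

Let g_le e S : 0 < e -> 0 <= S ->
  (expected_integral P S (g e) <= (gbound e S)%:E)%E.
Proof.
move=> e0 S0.
have e1 : 0 <= 1 + e^-1 by rewrite addr_ge0 ?invr_ge0 ?(ltW e0).
have ND0 t w : 0 <= N * Dq t w by rewrite mulr_ge0.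
have mND : jointly_measurable S (fun t w => N * Dq t w).
  by apply: measurable_funM => //; exact: mDq.
have h1 t w : 0 <= (1 + e^-1) * (N * Dq t w) by rewrite mulr_ge0.
have h2 t w : 0 <= e * gX t w by rewrite mulr_ge0 ?(ltW e0).
have m1 : jointly_measurable S (fun t w => (1 + e^-1) * (N * Dq t w)).
  exact: measurable_funM.
have m2 : jointly_measurable S (fun t w => e * gX t w).
  by apply: measurable_funM => //; exact: mgX.
rewrite (expected_integralZ P K0); [|exact: measurable_funD|by move=> t w _; exact: addr_ge0].
rewrite (expected_integralD P m1 m2 h1 h2).
rewrite (expected_integralZ P e1 mND (fun t w _ => ND0 t w)).
rewrite (expected_integralZ P N0 (mDq S0) (fun t w _ => Dq0 t w)).
rewrite (expected_integralZ P (ltW e0) (mgX S0) (fun t w _ => gX0 t w)).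
rewrite /gbound [leRHS]EFinM [X in (_ <= _ * X)%E]EFinD; apply: lee_wpmul2l; first by rewrite lee_fin.
apply: leeD; rewrite [leRHS]EFinM; apply: lee_wpmul2l; rewrite ?lee_fin ?(ltW e0)//.
  by rewrite [leRHS]EFinM; apply: lee_wpmul2l; rewrite ?lee_fin// Dq_le.
exact: gX_le.
Qed.

Let iF1 S : 0 <= S -> (mu \x P)%E.-integrable (time_slab S) (fun p => (F1 p.1 p.2)%:E).
Proof.
move=> S0; apply: (slab_integrable (g := fun t w => K' * gX t w)).
- exact: mF1.
- by apply: measurable_funM => //; exact: mgX.
- by move=> t w _; rewrite mulr_ge0.
- by apply: filterS F1_le => p h /andP[p0 _]; exact: h.
- rewrite (expected_integralZ P K'0 (mgX S0) (fun t w _ => gX0 t w)).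
  apply: (lte_scale_pinfty K'0).
  by apply: (le_lt_trans (gX_le S0)); rewrite ltry.
Qed.

Let iF12 S : 0 <= S ->
  (mu \x P)%E.-integrable (time_slab S) (fun p => (F1 p.1 p.2 - F2 p.1 p.2)%:E).
Proof.
move=> S0; apply: (slab_integrable (f := fun t w => F1 t w - F2 t w) (g := g 1)).
- by apply: measurable_funB; [exact: mF1|exact: mF2].
- exact: mg.
- by move=> t w _; exact: g0.
- by apply: filterS (F12_le ltr01) => p h /andP[p0 _]; exact: h.
- by apply: (le_lt_trans (g_le ltr01 S0)); rewrite ltry.
Qed.

Let iF2 S : 0 <= S -> (mu \x P)%E.-integrable (time_slab S) (fun p => (F2 p.1 p.2)%:E).
Proof.
move=> S0.
have -> : (fun p : R * T => (F2 p.1 p.2)%:E) =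
    (fun p => (F1 p.1 p.2 - (F1 p.1 p.2 - F2 p.1 p.2))%:E).
  by apply/funext => p; congr EFin; ring.
by apply: integrable_subr => //; [exact: measurable_time_slab|exact: iF1|exact: iF12].
Qed.

Let diff_le e S : 0 < e -> 0 <= S ->
  `|fine (expected_integral P S F1) - fine (expected_integral P S F2)| <= gbound e S.
Proof.
move=> e0 S0.
rewrite !expected_integral_integrable; [|exact: iF2|exact: iF1].
have f1 := slab_integral_fin_num (iF1 S0).
have f2 := slab_integral_fin_num (iF2 S0).
rewrite -fineB//.
have <- : (\int[mu \x P]_(p in time_slab S) (F1 p.1 p.2 - F2 p.1 p.2)%:E =
    \int[mu \x P]_(p in time_slab S) (F1 p.1 p.2)%:E -
    \int[mu \x P]_(p in time_slab S) (F2 p.1 p.2)%:E)%E.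
  by apply: integral_subr; [exact: measurable_time_slab|exact: iF1|exact: iF2].
have f12 := slab_integral_fin_num (f := fun t w => F1 t w - F2 t w) (iF12 S0).
rewrite -lee_fin -abse_EFin fineK//.
apply: le_trans (g_le e0 S0).
apply: (@le_trans _ _ (\int[mu \x P]_(p in time_slab S) `|(F1 p.1 p.2 - F2 p.1 p.2)%:E|)%E).
  apply: le_abse_integral; first exact: measurable_time_slab.
  by case/integrableP: (iF12 S0).
have -> : (\int[mu \x P]_(p in time_slab S) `|(F1 p.1 p.2 - F2 p.1 p.2)%:E| =
    expected_integral P S (fun t w => `|F1 t w - F2 t w|%R))%E.
  rewrite expected_integralE//; apply: measurableT_comp => //.
  by apply: measurable_funB; [exact: mF1|exact: mF2].
apply: le_expected_integral => //.
- apply: measurableT_comp => //.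
  by apply: measurable_funB; [exact: mF1|exact: mF2].
- exact: mg.
- by move=> t w _; exact: g0.
- by apply: filterS (F12_le e0) => p h /andP[p0 _]; exact: h.
Qed.

(** Used with [u] the positive and the negative part. Each part of the cost is nonnegative and
    inherits random periodicity from [F1], so the bounds by whole periods, which rest on
    monotonicity, apply to it. *)
Let part_bounds (u : R -> R) : measurable_fun setT u -> (forall x, 0 <= u x <= `|x|) ->
  exists2 a, 0 <= a & expected_integral P tau (fun t w => u (F1 t w)) = a%:E /\
  forall S, 0 <= S -> [/\ (mu \x P)%E.-integrable (time_slab S) (fun p => (u (F1 p.1 p.2))%:E) &
    ((S / tau * a - a)%:E <= expected_integral P S (fun t w => u (F1 t w)) <=
    (S / tau * a + a)%:E)%E].
Proof.
move=> mu' ub.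
have muF S : 0 <= S -> jointly_measurable S (fun t w => u (F1 t w)).
  by move=> S0; apply: measurableT_comp => //; exact: mF1.
have u0 t w : 0 <= u (F1 t w) by case/andP: (ub (F1 t w)).
have iu S : 0 <= S -> (mu \x P)%E.-integrable (time_slab S) (fun p => (u (F1 p.1 p.2))%:E).
  move=> S0; apply: le_integrable (iF1 S0) => //.
  - exact: measurable_time_slab.
  - by apply/measurable_EFinP; exact: muF.
  - by move=> p _; have /andP[h1 h2] := ub (F1 p.1 p.2); rewrite /= lee_fin ger0_norm.
have per : random_periodic P theta tau (fun t w => u (F1 t w)).
  by move=> t t0; apply: filterS (F1_per t0) => w ->.
set E := expected_integral P tau _.
have Ea : E = (fine E)%:E.
  rewrite fineK// /E expected_integral_integrable; last by apply: iu; exact: ltW.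
  by apply: integrable_fin_num; [exact: measurable_time_slab|apply: iu; exact: ltW].
exists (fine E).
  by apply: fine_ge0; apply: integral_ge0 => w _; apply: integral_ge0 => t _; rewrite lee_fin.
split => // S S0; split; first exact: iu.
exact: (random_periodic_expected_integral tau0 mtheta Ptheta muF u0 per Ea S0).
Qed.

Lemma ergodic_limit :
  limf_einf (fun S : R => (S^-1)%:E * expected_integral P S F2)%E (pinfty_nbhs R) =
  ((tau^-1)%:E * expected_integral P tau F1)%E.
Proof.
have [ap ap0 [Ep Bp]] := @part_bounds (fun x => Num.max x 0) ltac:(by apply: measurable_maxr)
  ltac:(by move=> x; rewrite le_max lexx orbT ge_max ler_norm normr_ge0).
have [am am0 [Em Bm]] := @part_bounds (fun x => Num.max (- x) 0) ltac:(by apply: measurable_maxr)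
  ltac:(by move=> x; rewrite le_max lexx orbT ge_max -normrN ler_norm normr_ge0).
have F1E S : 0 <= S -> expected_integral P S F1 =
    (expected_integral P S (fun t w => Num.max (F1 t w) 0%R) -
     expected_integral P S (fun t w => Num.max (- F1 t w)%R 0%R))%E.
  move=> S0; have [ip _] := Bp S S0; have [im _] := Bm S S0.
  rewrite !expected_integral_integrable//; last exact: iF1.
  rewrite -integral_subr//; last exact: measurable_time_slab.
  apply: eq_integral => p _; congr EFin.
  by case: (leP 0 (F1 p.1 p.2)) => h; case: (leP 0 (- F1 p.1 p.2)) => h'; lra.
pose l := ap - am.
have F1tau : expected_integral P tau F1 = l%:E.
  by rewrite F1E ?(ltW tau0)// Ep Em -EFinB.
rewrite F1tau -EFinM; apply: limf_einf_pinfty => e e0.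
(* The growth rate of [gbound e S] in [S], divided by [e]. *)
pose Q := K * (1 + N * (b / tau)).
have Q0 : 0 <= Q by rewrite mulr_ge0// addr_ge0// mulr_ge0// divr_ge0// ltW.
(* Makes e1 Q at most e/2; the added 1 keeps the denominator positive when [Q] is 0. *)
pose e1 := e / (2 * (Q + 1)).
have Q1 : 0 < 2 * (Q + 1) by rewrite mulr_gt0// ltr_wpDl.
have e10 : 0 < e1 by rewrite divr_gt0.
have Qe : e1 * Q <= e / 2.
  rewrite /e1 mulrAC ler_pdivrMr//.
  have := mulr_ge0 (ltW e0) Q0; lra.
(* All contributions that do not grow with [S]: the errors [ap] and [am] from incomplete periods and
   the bounded part of [gbound]. For S beyond 2 C0 / e they are at most (e/2) S. *)
pose C0 := ap + am + K * ((1 + e1^-1) * (N * kD)) + K * e1 * (N * b).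
exists (Num.max 1 (2 * C0 / e)); split; first exact: num_real.
move=> S; rewrite gt_max => /andP[S1 Sb].
have S0 : 0 < S by exact: lt_trans S1.
have S0' := ltW S0.
have C0S : C0 <= e / 2 * S by move: Sb; rewrite ltr_pdivrMr//; lra.
have fF2 : expected_integral P S F2 = (fine (expected_integral P S F2))%:E.
  rewrite fineK// expected_integral_integrable; last exact: iF2.
  by apply: integrable_fin_num; [exact: measurable_time_slab|exact: iF2].
have := diff_le e10 S0'; rewrite /= fF2 /=; set v := fine (expected_integral P S F2).
have [_ /andP[]] := Bp S S0'; have [_ /andP[]] := Bm S S0'; rewrite (F1E S S0').
case: (expected_integral P S (fun t w => Num.max (- F1 t w)%R 0%R)) => [m| |]//.
case: (expected_integral P S (fun t w => Num.max (F1 t w) 0%R)) => [p| |]//.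
rewrite !lee_fin /= => m1 m2 p1 p2; rewrite ler_norml => /andP[d1 d2].
have gE : gbound e1 S = K * ((1 + e1^-1) * (N * kD)) + K * e1 * (N * b) + e1 * Q * S.
  rewrite /gbound /Q; field.
  by rewrite !gt_eqF.
rewrite gE in d1 d2.
have QeS : e1 * Q * S <= e / 2 * S by rewrite ler_wpM2r.
have lS : S / tau * ap - S / tau * am = tau^-1 * l * S by rewrite /l; ring.
have SvE : S * (S^-1 * v) = v by rewrite mulrA divff ?mul1r// gt_eqF.
rewrite -(ler_pM2l S0) -[X in _ && X](ler_pM2l S0) SvE.
rewrite /C0 in C0S.
by apply/andP; split; lra.
Qed.

End ergodic_limit.

(** * Closed-loop states *)

Section linear_states.
Context {R : realType} {d : measure_display} {T : measurableType d}.
Variables (P : probability T R) (W : R -> T -> R) (G : R -> set (set T)).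
Notation mu := (@lebesgue_measure R).

(** No measurability enters: the integral of a nonnegative function is a supremum over the simple
    functions below it. This serves to compare path integrals over a bounded horizon with those over
    the half-line. *)
Lemma ge0_le_integralT (d' : measure_display) (X : measurableType d')
    (m : {measure set X -> \bar R}) (f g : X -> \bar R) :
  (forall x, 0 <= f x)%E -> (forall x, f x <= g x)%E ->
  (\int[m]_x f x <= \int[m]_x g x)%E.
Proof.
move=> f0 fg; rewrite !ge0_integralTE//; last by move=> x; exact: le_trans (f0 x) (fg x).
apply: ereal_sup_le => _ [h hf <-]; exists h => // x.
exact: le_trans (hf x) (fg x).
Qed.

Lemma msq_col k l (M : 'M[R]_(k, l)) j : vsq (col j M) <= msq M.
Proof.
apply: ler_sum => i _; rewrite mxE (bigD1 j)//= lerDl.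
by apply: sumr_ge0 => h _; exact: sqr_ge0.
Qed.

Lemma jointly_measurable_msq k l (X : R -> T -> 'M[R]_(k, l)) S : 0 <= S ->
  measurable_process X -> jointly_measurable S (fun t w => msq (X t w)).
Proof.
move=> S0 mX; apply: measurable_sum => i; apply: measurable_sum => j.
by apply: measurable_funX; exact: mX.
Qed.

Lemma measurable_process_col k l (X : R -> T -> 'M[R]_(k, l)) (j : 'I_l) :
  measurable_process X -> measurable_process (fun t w => col j (X t w)).
Proof.
move=> mX S i h S0; rewrite /jointly_measurable.
by under eq_fun do rewrite mxE; exact: mX.
Qed.

(** An equation on a filtration [G'] is read entrywise as scalar Ito processes on a larger [G]. The
    number of columns is left free to cover both the states and the fundamental matrix. Square
    integrability of the drift comes from the bounds on the coefficients and that of [X]. *)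
Lemma linear_sde_ito_process (G' : R -> set (set T)) (n k : nat) (c : R)
    (M C : R -> T -> 'M[R]_n) (a c' : R -> T -> 'M[R]_(n, k))
    (x : T -> 'M[R]_(n, k)) (X : R -> T -> 'M[R]_(n, k)) :
  (forall t, 0 <= t -> G' t `<=` G t) ->
  (forall t, 0 <= t -> sigma_algebra setT (G' t) /\ G' t `<=` measurable) ->
  bounded_process P c M -> bounded_process P c C ->
  bounded_process P c a -> bounded_process P c c' ->
  linear_sde_solution P W G' M a C c' x X ->
  [/\ measurable_process X,
      forall S, 0 <= S -> (expected_integral P S (fun t w => msq (X t w)) < +oo)%E &
      forall i j, ito_process P W G (fun w => x w i j)
        (fun t w => (M t w *m X t w + a t w) i j)
        (fun t w => (C t w *m X t w + c' t w) i j)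
        (fun t w => X t w i j)].
Proof.
move=> G'G sG' cM cC ca cc' [[pX Xoo] _ _ Xeq].
have mX := progressive_measurable_process sG' pX.
have X_lty S : 0 <= S -> (expected_integral P S (fun t w => msq (X t w)) < +oo)%E.
  move=> S0; have := Xoo S S0.
  by under [X in expected_integral _ _ X]eq_fun do under eq_fun do rewrite mxnorm_sqr.
split; [exact: mX|exact: X_lty|move=> i j; split].
- move=> S S0; apply: (measurable_process_add _ ca.1) => //.
  exact: measurable_process_mul cM.1 mX.
- move=> S S0; apply: (measurable_process_add _ cc'.1) => //.
  exact: measurable_process_mul cC.1 mX.
- move=> S S0.
  have mMX : jointly_measurable S (fun t w => (M t w *m X t w) i j).
    exact: measurable_process_mul cM.1 mX _ _ _ S0.
  have ma : jointly_measurable S (fun t w => a t w i j) by exact: ca.1.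
  apply: (@le_lt_trans _ _ (2%:E * expected_integral P S (fun t w => ((M t w *m X t w) i j ^+ 2)%R) +
    2%:E * expected_integral P S (fun t w => (a t w i j ^+ 2)%R))%E).
    apply: le_expected_integral_sqrD => //; last by move=> t w; rewrite mxE.
    exact: (measurable_process_add (measurable_process_mul cM.1 mX) ca.1).
  have aoo := expected_integral_bounded_lty i j S0 ca.
  apply: lte_add_pinfty; apply: (lte_scale_pinfty (ler0n _ _)); last exact: aoo.
  (* Entry (i, j) of the product involves only column j of [X], which reduces the bound to the
     vector case. *)
  have mc := measurable_process_col j mX.
  have h := expected_integral_mulmx_le i S0 cM mc.
  have e : (fun t w => (M t w *m X t w) i j ^+ 2) =
      (fun t w => (M t w *m col j (X t w)) i 0 ^+ 2).
    apply/funext => t; apply/funext => w; rewrite !mxE.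
    by congr (_ ^+ 2); apply: eq_bigr => p _; rewrite mxE.
  rewrite e; apply: (le_lt_trans h).
  have k0 : 0 <= c ^+ 2 * n%:R by apply: mulr_ge0; rewrite ?ler0n// sqr_ge0.
  apply: (lte_scale_pinfty k0).
  apply: (@le_lt_trans _ _ (expected_integral P S (fun t w => msq (X t w)))); last exact: X_lty.
  apply: le_expected_integral.
  + exact: jointly_measurable_vsq.
  + exact: jointly_measurable_msq.
  + by move=> t w _; exact: vsq_ge0.
  + by move=> t w _; exact: msq_ge0.
  + by apply: aeW => p _; exact: msq_col.
- move=> t t0; have [I JI eI] := Xeq t t0.
  exists (fun w => I w i j); first by apply: (ito_limit_is_ito G'G); exact: JI.
  by apply: filterS eI => w ->; rewrite !mxE.
Qed.

End linear_states.

Section running_cost_process.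
Context {R : realType} {d : measure_display} {T : measurableType d}.
Variables (P : probability T R).
Notation mu := (@lebesgue_measure R).

Lemma jointly_measurable_dotv k (x y : R -> T -> 'cV[R]_k) S : 0 <= S ->
  measurable_process x -> measurable_process y ->
  jointly_measurable S (fun t w => dotv (x t w) (y t w)).
Proof.
move=> S0 mx my; apply: measurable_sum => i.
by apply: measurable_funM; [exact: mx|exact: my].
Qed.

Variables (n m : nat) (c : R) (Q : R -> T -> 'M[R]_n) (S : R -> T -> 'M[R]_(m, n)).
Variables (Rm : R -> T -> 'M[R]_m) (q : R -> T -> 'cV[R]_n) (rho : R -> T -> 'cV[R]_m).
Variables (Theta : R -> T -> 'M[R]_(m, n)) (v : R -> T -> 'cV[R]_m).
Hypotheses (c0 : 0 <= c) (cQ : bounded_process P c Q) (cS : bounded_process P c S)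
  (cR : bounded_process P c Rm) (cq : bounded_process P c q)
  (crho : bounded_process P c rho) (cTheta : bounded_process P c Theta)
  (cv : bounded_process P c v).

Let F X := running_cost Q S Rm q rho X (feedback Theta v X).

Lemma jointly_measurable_running_cost X t : 0 <= t -> measurable_process X ->
  jointly_measurable t (F X).
Proof.
move=> t0 mX.
have mu' : measurable_process (feedback Theta v X).
  exact: (measurable_process_add (measurable_process_mul cTheta.1 mX) cv.1).
have mQ := jointly_measurable_dotv t0 (measurable_process_mul cQ.1 mX) mX.
have mS := jointly_measurable_dotv t0 (measurable_process_mul cS.1 mX) mu'.
have mR := jointly_measurable_dotv t0 (measurable_process_mul cR.1 mu') mu'.
have mq := jointly_measurable_dotv t0 cq.1 mX.
have mrho := jointly_measurable_dotv t0 crho.1 mu'.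
do 2![apply: measurable_funD; last exact: measurable_funM].
by apply: measurable_funD => //; apply: measurable_funD => //; exact: measurable_funM.
Qed.

(** Merges the almost everywhere bounds on all coefficients into one, so that the pointwise cost
    estimates lift to processes. *)
Lemma ae_coefficients (p : set (R * T)) :
  (forall z, 0 <= z.1 -> (forall i j, `|Q z.1 z.2 i j| <= c) ->
   (forall i j, `|S z.1 z.2 i j| <= c) -> (forall i j, `|Rm z.1 z.2 i j| <= c) ->
   (forall i j, `|q z.1 z.2 i j| <= c) -> (forall i j, `|rho z.1 z.2 i j| <= c) ->
   (forall i j, `|Theta z.1 z.2 i j| <= c) -> (forall i j, `|v z.1 z.2 i j| <= c) -> p z) ->
  {ae (mu \x P)%E, forall z : R * T, 0 <= z.1 -> p z}.
Proof.
move=> h; have [_ hQ] := cQ; have [_ hS] := cS; have [_ hR] := cR.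
have [_ hq] := cq; have [_ hrho] := crho; have [_ hTheta] := cTheta; have [_ hv] := cv.
apply: filterS2 (filterI hQ hS) (filterI (filterI hR hq) (filterI hrho (filterI hTheta hv))).
move=> z [aQ aS] [[aR aq] [arho [aTheta av]]] z0.
by apply: h => // i j; [exact: aQ|exact: aS|exact: aR|exact: aq|exact: arho|exact: aTheta|exact: av].
Qed.

Lemma running_cost_bound X : {ae (mu \x P)%E, forall z : R * T, 0 <= z.1 ->
  `|F X z.1 z.2| <= 2 * cost_const m c * (1 + n%:R * vsq (X z.1 z.2))}.
Proof. by apply: ae_coefficients => z _ *; exact: cost_bound. Qed.

Lemma running_cost_diff_bound X Y e : 0 < e ->
  {ae (mu \x P)%E, forall z : R * T, 0 <= z.1 ->
  `|F X z.1 z.2 - F Y z.1 z.2| <= cost_const m c *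
    ((1 + e^-1) * (n%:R * vsq (X z.1 z.2 - Y z.1 z.2)) +
     e * (1 + n%:R * vsq (X z.1 z.2)))}.
Proof. by move=> e0; apply: ae_coefficients => z _ *; exact: cost_diff_bound. Qed.

Lemma random_periodic_running_cost theta tau X :
    random_periodic P theta tau Q -> random_periodic P theta tau S ->
    random_periodic P theta tau Rm -> random_periodic P theta tau q ->
    random_periodic P theta tau rho -> random_periodic P theta tau Theta ->
    random_periodic P theta tau v -> random_periodic P theta tau X ->
  random_periodic P theta tau (F X).
Proof.
move=> pQ pS pR pq prho pTheta pv pX t t0.
apply: filterS2 (filterI (filterI (pQ t t0) (pS t t0)) (filterI (pR t t0) (pq t t0)))
  (filterI (filterI (prho t t0) (pTheta t t0)) (filterI (pv t t0) (pX t t0))).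
move=> w [[eQ eS] [eR eq]] [[erho eTheta] [ev eX]].
by rewrite /F /running_cost /feedback eQ eS eR eq erho eTheta ev eX.
Qed.

End running_cost_process.

(** * Difference of the two closed-loop states *)

Section difference_of_states.
Context {R : realType} {d : measure_display} {T : measurableType d}.
Variables (P : probability T R) (W : R -> T -> R).
Hypotheses (Pcomplete : measure_is_complete P) (Wb : brownian_motion P W).
Notation mu := (@lebesgue_measure R).
Notation FF := (natural_filtration P W).

Lemma bounded_process0 c k l : 0 <= c ->
  bounded_process P c (fun _ _ => 0 : 'M[R]_(k, l)).
Proof.
move=> c0; split; first by move=> S i j _; exact: measurable_cst.
by apply: aeW => p _ i j; rewrite mxE normr0.
Qed.

Lemma vsq_msq n (y : 'cV[R]_n) : vsq y = msq y.
Proof. by rewrite -mxnorm_vsq mxnorm_sqr. Qed.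

Lemma sigma_of_sys_measurable k l (Y : T -> 'M[R]_(k, l)) i j :
  sys_measurable (sigma_of Y) (fun w => Y w i j).
Proof. by move=> U mU; apply: sub_sigma_algebra; exists i, j, U. Qed.

Variables (n : nat) (c : R) (M C Phi : R -> T -> 'M[R]_n).
Variables (a c' X Y : R -> T -> 'cV[R]_n) (x : 'cV[R]_n) (xi : T -> 'cV[R]_n).
Hypotheses (c0 : 0 <= c) (cM : bounded_process P c M) (cC : bounded_process P c C)
  (ca : bounded_process P c a) (cc' : bounded_process P c c').
Hypotheses (L2xi : L2_random_variable P xi)
  (ixi : independent P (sigma_of xi) (filtration_infty FF)).
Hypothesis sX : linear_sde_solution P W FF M a C c' (fun=> x) X.
Hypothesis sY : linear_sde_solution P W (enlarged_filtration FF xi) M a C c' xi Y.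
Hypothesis sPhi : fundamental_solution P W M C Phi.

(** The filtration common to all three equations: [X] and [Phi] are adapted to the smaller [FF], [Y]
    to [G] itself, and [eta] is measurable for [G 0]. *)
Let G := enlarged_filtration FF xi.

Let WG : brownian_wrt P W G.
Proof. by apply: brownian_wrt_enlarged => //; case: L2xi. Qed.

Let FG t : 0 <= t -> FF t `<=` G t.
Proof. by move=> _ E FE; apply: sub_sigma_algebra; left. Qed.

Let sF t : 0 <= t -> sigma_algebra setT (FF t) /\ FF t `<=` measurable.
Proof. by have [+ _ _ _ _] := brownian_wrt_natural Pcomplete Wb; apply. Qed.

Let sG t : 0 <= t -> sigma_algebra setT (G t) /\ G t `<=` measurable.
Proof. by case: WG => + _ _ _ _; apply. Qed.

Let eta w := xi w - x.

Let D t w := Y t w - X t w.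

Let eta_measurable (H : set (set T)) i : sigma_algebra setT H -> sigma_of xi `<=` H ->
  sys_measurable H (fun w => eta w i 0).
Proof.
move=> sH xiH; rewrite /eta.
have -> : (fun w => (xi w - x) i 0) = (fun w => xi w i 0 - x i 0).
  by apply/funext => w; rewrite !mxE.
apply: sys_measurableB => //; last exact: sys_measurable_cst.
by move=> U mU; apply: xiH; exact: sigma_of_sys_measurable.
Qed.

Let eta_lty : (\int[P]_w (vsq (eta w))%:E < +oo)%E.
Proof.
have [mxi xioo] := L2xi.
have mv : measurable_fun setT (fun w => vsq (xi w)) by apply: measurable_vsq => i; exact: mxi.
apply: (@le_lt_trans _ _ (\int[P]_w (2%:E * (vsq (xi w))%:E + (2 * vsq x)%:E))%E).
  apply: ge0_le_integralT => w; first by rewrite lee_fin vsq_ge0.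
  by rewrite -EFinM -EFinD lee_fin vsqB_le.
rewrite ge0_integralD//; last 3 first.
- by move=> w _; rewrite -EFinM lee_fin mulr_ge0 ?vsq_ge0.
- by apply: measurable_funeM; exact/measurable_EFinP.
- by move=> w _; rewrite lee_fin mulr_ge0 ?vsq_ge0.
rewrite ge0_integralZl//; last 2 first.
- exact/measurable_EFinP.
- by move=> w _; rewrite lee_fin vsq_ge0.
apply: lte_add_pinfty.
  apply: lte_scale_pinfty (ler0n _ _) _.
  by under eq_integral do rewrite -mxnorm_vsq.
rewrite (integral_cst P measurableT (2 * vsq x)%:E).
by rewrite -[X in (_ * X < _)%E]fineK ?fin_num_measure// -EFinM ltry.
Qed.

(** Integrates [mean_square_bound] over time. The integral of |Phi|^2 over the half-line and [Omega]
    is finite by the [L2_process] clause of [fundamental_solution], which makes the bound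
    independent of the horizon. *)
Lemma expected_integral_difference_bound : exists kD : R,
  forall S, 0 <= S -> (expected_integral P S (fun t w => vsq (D t w)) <= kD%:E)%E.
Proof.
have [mX X_lty X_eq] := linear_sde_ito_process FG sF cM cC ca cc' sX.
have [mY Y_lty Y_eq] := linear_sde_ito_process (fun t _ => @subset_refl _ _) sG cM cC ca cc' sY.
have [sPhi1 [pPhi Phi_oo]] := sPhi.
have z0 := bounded_process0 n n c0.
have [mPhi Phi_lty Phi_eq] := linear_sde_ito_process FG sF cM cC z0 z0 sPhi1.
have mD : measurable_process D by exact: measurable_process_sub.
have D_lty S : 0 <= S -> (expected_integral P S (fun t w => vsq (D t w)) < +oo)%E.
  move=> S0.
  apply: (@le_lt_trans _ _ (expected_integral P S (fun t w => (2 * msq (Y t w))%R) +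
    expected_integral P S (fun t w => (2 * msq (X t w))%R))%E).
    have mv (Z : R -> T -> 'cV[R]_n) : measurable_process Z ->
        jointly_measurable S (fun t w => 2 * msq (Z t w)).
      by move=> mZ; apply: measurable_funM => //; exact: jointly_measurable_msq.
    rewrite -expected_integralD; last first.
    - by move=> t w; rewrite mulr_ge0 ?msq_ge0.
    - by move=> t w; rewrite mulr_ge0 ?msq_ge0.
    - exact: mv.
    - exact: mv.
    apply: le_expected_integral.
    - exact: jointly_measurable_vsq.
    - by apply: measurable_funD; exact: mv.
    - by move=> t w _; exact: vsq_ge0.
    - by move=> t w _; rewrite addr_ge0// mulr_ge0 ?msq_ge0.
    - by apply: aeW => p _; rewrite -!vsq_msq vsqB_le.
  have z2 (Z : R -> T -> 'cV[R]_n) : measurable_process Z ->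
      (expected_integral P S (fun t w => msq (Z t w)) < +oo)%E ->
      (expected_integral P S (fun t w => (2 * msq (Z t w))%R) < +oo)%E.
    move=> mZ Zoo; rewrite expected_integralZ//; last 2 first.
    - exact: jointly_measurable_msq.
    - by move=> t w _; exact: msq_ge0.
    exact: lte_scale_pinfty (ler0n _ _) Zoo.
  by apply: lte_add_pinfty; [exact: z2 mY (Y_lty S S0)|exact: z2 mX (X_lty S S0)].
have eta_G0 i : sys_measurable (G 0) (fun w => eta w i 0).
  apply: eta_measurable; first by case: (sG (lexx 0)).
  by move=> E xiE; apply: sub_sigma_algebra; right.
have D_eq i : ito_process P W G (fun w => eta w i 0)
    (fun t w => (M t w *m D t w) i 0) (fun t w => (C t w *m D t w) i 0)
    (fun t w => D t w i 0).
  have := ito_processB WG (Y_eq i 0) (X_eq i 0).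
  have e1 (N : R -> T -> 'M[R]_n) (b : R -> T -> 'cV[R]_n) :
      (fun t w => (N t w *m Y t w + b t w) i 0 - (N t w *m X t w + b t w) i 0) =
      (fun t w => (N t w *m D t w) i 0).
    apply/funext => t; apply/funext => w; rewrite /D mulmxBr !mxE.
    by rewrite opprD addrACA subrr addr0.
  rewrite !e1.
  have -> : (fun w => xi w i 0 - x i 0) = (fun w => eta w i 0).
    by apply/funext => w; rewrite !mxE.
  have -> // : (fun t w => Y t w i 0 - X t w i 0) = (fun t w => D t w i 0).
  by apply/funext => t; apply/funext => w; rewrite !mxE.
have Phi_eq' i j : ito_process P W G (fun w => (1%:M : 'M[R]_n) i j)
    (fun t w => (M t w *m Phi t w) i j) (fun t w => (C t w *m Phi t w) i j)
    (fun t w => Phi t w i j).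
  have := Phi_eq i j.
  have e (N : R -> T -> 'M[R]_n) : (fun t w => (N t w *m Phi t w + 0) i j) =
      (fun t w => (N t w *m Phi t w) i j).
    by apply/funext => t; apply/funext => w; rewrite addr0.
  by rewrite !e.
(* Adaptedness of [Phi] to the Brownian filtration, rather than to its enlargement, is what makes it
   independent of [xi]. *)
have Phi_eta t i j k : 0 <= t ->
    independent_fun P (fun w => Phi t w i j) (fun w => eta w k 0).
  move=> t0 U V mU mV; rewrite setIC ixi.
  - exact: muleC.
  - by apply: (eta_measurable k (smallest_sigma_algebra _ _)).
  - apply: (natural_filtration_infty t0); exact: (progressive_adapted sF i j pPhi t0).
have bound t := mean_square_bound WG cM cC mD mPhi D_lty Phi_lty eta_G0 eta_lty D_eq Phi_eq' Phi_eta (t := t).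
have [e eE] : exists e : R, (\int[P]_w (vsq (eta w))%:E)%E = e%:E.
  exists (fine (\int[P]_w (vsq (eta w))%:E)); rewrite fineK// ge0_fin_numE//.
  by apply: integral_ge0 => w _; rewrite lee_fin vsq_ge0.
set I := (\int[P]_w \int[mu]_(t in `[0%R, +oo[) _)%E in Phi_oo.
have I0 : (0 <= I)%E.
  by apply: integral_ge0 => w _; apply: integral_ge0 => t _; rewrite lee_fin sqr_ge0.
have e0 : 0 <= e.
  by rewrite -lee_fin -eE; apply: integral_ge0 => w _; rewrite lee_fin vsq_ge0.
exists (2 * n%:R * e * fine I) => S S0.
have k0 : 0 <= 2 * n%:R * e by rewrite !mulr_ge0.
rewrite EFinM fineK ?ge0_fin_numE//.
rewrite expected_integral_swap; [|exact: jointly_measurable_vsq|by move=> *; exact: vsq_ge0].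
have mmPhi := jointly_measurable_msq S0 mPhi.
apply: (@le_trans _ _ ((2 * n%:R * e)%:E * expected_integral P S (fun t w => msq (Phi t w)))%E).
  rewrite expected_integral_swap//; last by move=> t w _; exact: msq_ge0.
  rewrite -ge0_integralZl//.
  - apply: ge0_le_integral => //.
    + by move=> t _; apply: integral_ge0 => w _; rewrite lee_fin vsq_ge0.
    + apply: measurable_expectation_time; first exact: jointly_measurable_vsq.
      by move=> t w _; exact: vsq_ge0.
    + by apply: measurable_funeM; apply: measurable_expectation_time => // t w _; exact: msq_ge0.
    move=> t /=; rewrite in_itv/= => /andP[t0 _].
    apply: (le_trans (bound t t0)); rewrite eE.
    by rewrite [X in (_ * X)%E]muleC muleA -EFinM.
  - by apply: measurable_expectation_time => // t w _; exact: msq_ge0.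
  - by move=> t _; apply: integral_ge0 => w _; rewrite lee_fin msq_ge0.
rewrite lee_wpmul2l ?lee_fin//; apply: ge0_le_integralT => w.
  by apply: integral_ge0 => t _; rewrite lee_fin msq_ge0.
(* Both path integrals are extended by zero to the whole line, where the integrands compare
   pointwise. *)
rewrite integral_mkcond [leRHS]integral_mkcond; apply: ge0_le_integralT => t.
  by apply: erestrict_ge0 => ? _; rewrite lee_fin msq_ge0.
rewrite !patchE; case: ifPn => [|_].
  rewrite inE/= in_itv/= => /andP[t0 _]; rewrite mem_set; last by rewrite /= in_itv/= t0.
  by rewrite lee_fin mxnorm_sqr.
by case: ifPn => // _; rewrite lee_fin sqr_ge0.
Qed.

End difference_of_states.

Unset Implicit Arguments.
Set Strict Implicit.

Theorem theorem5p2 (R : realType) (d : measure_display)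
    (Omega : measurableType d) (P : probability Omega R)
    (W : R -> Omega -> R) (theta : R -> Omega -> Omega)
    (n m : nat) (tau : R)
    (A C : R -> Omega -> 'M[R]_n) (B : R -> Omega -> 'M[R]_(n, m))
    (b sigma q : R -> Omega -> 'cV[R]_n)
    (Q : R -> Omega -> 'M[R]_n) (S : R -> Omega -> 'M[R]_(m, n))
    (Rm : R -> Omega -> 'M[R]_m) (rho : R -> Omega -> 'cV[R]_m)
    (Theta : R -> Omega -> 'M[R]_(m, n)) (v : R -> Omega -> 'cV[R]_m)
    (x : 'cV[R]_n) (X : R -> Omega -> 'cV[R]_n)
    (xi : Omega -> 'cV[R]_n) (Xxi : R -> Omega -> 'cV[R]_n)
    (Pcomplete : measure_is_complete P)
    (W_brownian : brownian_motion P W)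
    (theta_shift : brownian_shift P W theta)
    (tau_gt0 : 0 < tau)
    (A_B : B_tau P W theta tau A) (C_B : B_tau P W theta tau C)
    (B_B : B_tau P W theta tau B)
    (b_B : B_tau P W theta tau b) (sigma_B : B_tau P W theta tau sigma)
    (q_B : B_tau P W theta tau q)
    (Q_B : B_tau P W theta tau Q) (Q_sym : symmetric_process Q)
    (S_B : B_tau P W theta tau S)
    (R_B : B_tau P W theta tau Rm) (R_sym : symmetric_process Rm)
    (rho_B : B_tau P W theta tau rho)
    (ABC_stabilizable : stabilizable P W theta tau A C B)
    (Theta_v_admissible : admissible P W theta tau A C B Theta v)
    (X_state : closed_loop_state P W (natural_filtration P W)
                 A C B b sigma Theta v (fun _ => x) X)
    (xi_state : random_periodic_initial P W theta tau
                  A C B b sigma Theta v xi Xxi) :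
  ergodic_cost P Q S Rm q rho X (feedback Theta v X) =
  ((tau^-1)%:E *
   expected_integral P tau
     (running_cost Q S Rm q rho Xxi (feedback Theta v Xxi)))%E.
Proof.
have [sF _ _ _ _] := brownian_wrt_natural Pcomplete W_brownian.
have [L2xi ixi Xxi_state Xxi_per] := xi_state.
have [[bTheta Theta_stable] v_B] := Theta_v_admissible.
(* Stability of the closed loop provides its fundamental solution. *)
have [_ [_ [_ [_ _ _ [Phi [sPhi _ _ _]]]]]] := Theta_stable.
have [sG _ _ _ _] := brownian_wrt_enlarged Pcomplete W_brownian L2xi.1 ixi.
have bounded k l (f : R -> Omega -> 'M[R]_(k, l)) : B_tau P W theta tau f ->
    exists2 c, 0 <= c & bounded_process P c f.
  by move=> [fb _]; exact: Linfty_bounded_process sF fb.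
have [cA cA0 bA] := bounded _ _ _ A_B.
have [cC cC0 bC] := bounded _ _ _ C_B.
have [cB cB0 bB] := bounded _ _ _ B_B.
have [cb cb0 bb] := bounded _ _ _ b_B.
have [cs cs0 bs] := bounded _ _ _ sigma_B.
have [cq cq0 bq] := bounded _ _ _ q_B.
have [cQ cQ0 bQ] := bounded _ _ _ Q_B.
have [cS cS0 bS] := bounded _ _ _ S_B.
have [cR cR0 bR] := bounded _ _ _ R_B.
have [cr cr0 br] := bounded _ _ _ rho_B.
have [cT cT0 bT] := bounded _ _ _ bTheta.
have [cv cv0 bv] := bounded _ _ _ v_B.
have bM := bounded_process_add bA (bounded_process_mul cB0 bB bT).
have ba := bounded_process_add (bounded_process_mul cB0 bB bv) bb.
set cM := _ + _ in bM; set ca := _ + _ in ba.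
have cM0 : 0 <= cM by rewrite addr_ge0// mulr_ge0// mulr_ge0.
have ca0 : 0 <= ca by rewrite addr_ge0// mulr_ge0// mulr_ge0.
have [kD D_le] : exists kD : R, forall S', 0 <= S' ->
    (expected_integral P S' (fun t w => vsq (Xxi t w - X t w)) <= kD%:E)%E.
  (* The sum of the nonnegative bounds is a common bound for all coefficients of the closed-loop
     equation; the same is done below for the cost and the feedback. *)
  pose c := cM + ca + cC + cs.
  have c0 : 0 <= c by rewrite /c; lra.
  apply: (expected_integral_difference_bound Pcomplete W_brownian c0 _ _ _ _ L2xi ixi
    X_state Xxi_state sPhi).
  - by apply: bounded_processS bM; rewrite /c; lra.
  - by apply: bounded_processS bC; rewrite /c; lra.
  - by apply: bounded_processS ba; rewrite /c; lra.
  - by apply: bounded_processS bs; rewrite /c; lra.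
pose c := cq + cQ + cS + cR + cr + cT + cv.
have c0 : 0 <= c by rewrite /c; lra.
have {}bQ : bounded_process P c Q by apply: bounded_processS bQ; rewrite /c; lra.
have {}bS : bounded_process P c S by apply: bounded_processS bS; rewrite /c; lra.
have {}bR : bounded_process P c Rm by apply: bounded_processS bR; rewrite /c; lra.
have {}bq : bounded_process P c q by apply: bounded_processS bq; rewrite /c; lra.
have {}br : bounded_process P c rho by apply: bounded_processS br; rewrite /c; lra.
have {}bT : bounded_process P c Theta by apply: bounded_processS bT; rewrite /c; lra.
have {}bv : bounded_process P c v by apply: bounded_processS bv; rewrite /c; lra.
have [[pX _] _ _ _] := X_state; have [[pXxi Xxi_lty] _ _ _] := Xxi_state.
have mX := progressive_measurable_process sF pX.
have mXxi := progressive_measurable_process sG pXxi.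
have [mtheta _ _ _ Ptheta] := theta_shift.
have tau_ge0 := ltW tau_gt0.
have Xxi_vsq_per : random_periodic P theta tau (fun t w => vsq (Xxi t w)).
  by move=> t t0; apply: filterS (Xxi_per t t0) => w ->.
have Xxi_vsq_lty : (expected_integral P tau (fun t w => vsq (Xxi t w)) < +oo)%E.
  have := Xxi_lty tau tau_ge0.
  by under [X in expected_integral _ _ X]eq_fun do under eq_fun do rewrite mxnorm_vsq.
have K0 : 0 <= cost_const m c by exact: cost_const_ge0.
(* The cost along the periodic state plays the role of [F1], the cost along [X] that of [F2]; the
   two constants are those of [cost_diff_bound] and [cost_bound]. *)
apply: (@ergodic_limit _ _ _ P theta tau tau_gt0 (mtheta _ tau_ge0).1 (Ptheta _ tau_ge0) _ _
  (fun t w => vsq (Xxi t w - X t w)) (fun t w => vsq (Xxi t w))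
  (cost_const m c) (2 * cost_const m c) n%:R kD) => //.
- exact: mulr_ge0.
- by move=> t t0; exact: (jointly_measurable_running_cost bQ bS bR bq br bT bv).
- by move=> t t0; exact: (jointly_measurable_running_cost bQ bS bR bq br bT bv).
- by move=> t t0; apply: jointly_measurable_vsq => //; exact: measurable_process_sub.
- by move=> t t0; exact: jointly_measurable_vsq.
- by move=> t w; exact: vsq_ge0.
- by move=> t w; exact: vsq_ge0.
- apply: random_periodic_running_cost => //; [exact: Q_B.2|exact: S_B.2|exact: R_B.2|exact: q_B.2|
    exact: rho_B.2|exact: bTheta.2|exact: v_B.2].
- exact: (running_cost_bound c0 bQ bS bR bq br bT bv).
- by move=> e e0; exact: (running_cost_diff_bound c0 bQ bS bR bq br bT bv).
Qed.
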